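(* Let $\omega$ be a nonzero real number and $\lambda\in\mathbb{C}$ with $\mathrm{Re}\,\lambda\neq0$. Consider the holomorphic system $$\dot x=i\omega x+y+f,\quad \dot y=i\omega y+g,\quad \dot z=\lambda z+h,$$ where $f,g,h$ are holomorphic near $0\in\mathbb{C}^3$ and vanish to order at least $2$. Then the system has a unique $x$-invariant holomorphic center manifold at the origin, and it contains an isochronous center family of period $2\pi/|\omega|$.
   Context: An $x$-invariant holomorphic center manifold at the origin is a germ at $0$ of a one-dimensional complex submanifold of $\mathbb{C}^3$ through $0$ that is invariant under the system and tangent at $0$ to the $x$-axis. Such a manifold $S$ contains an isochronous center family of period $T$ if every real-time trajectory of the system starting at a point of $S\setminus\{0\}$ sufficiently close to $0$ is periodic of period $T$. *)

(* Defs.v *)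
From Stdlib Require Export Reals.
Open Scope R_scope.

Definition Cx : Type := (R * R)%type.
Definition Cre (z : Cx) : R := fst z.
Definition Cim (z : Cx) : R := snd z.
Definition C0 : Cx := (0, 0).
Definition Cadd (z w : Cx) : Cx := (fst z + fst w, snd z + snd w).
Definition Copp (z : Cx) : Cx := (- fst z, - snd z).
Definition Csub (z w : Cx) : Cx := Cadd z (Copp w).
Definition Cmul (z w : Cx) : Cx :=
  (fst z * fst w - snd z * snd w, fst z * snd w + snd z * fst w).
Definition Cabs (z : Cx) : R := sqrt (fst z ^ 2 + snd z ^ 2).
Definition Ci (w : R) : Cx := (0, w).

Definition Chasderiv (u : Cx -> Cx) (z L : Cx) : Prop :=
  forall eps, 0 < eps -> exists delta, 0 < delta /\
    forall h, Cabs h < delta ->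
      Cabs (Csub (Csub (u (Cadd z h)) (u z)) (Cmul L h)) <= eps * Cabs h.

Definition Holo1 (r : R) (u : Cx -> Cx) : Prop :=
  0 < r /\ forall z, Cabs z < r -> exists L, Chasderiv u z L.

Definition in_polydisc (r : R) (x y z : Cx) : Prop :=
  Cabs x < r /\ Cabs y < r /\ Cabs z < r.

(** F : Cx^3 -> Cx is holomorphic on the polydisc of radius r about 0:
    jointly continuous and complex differentiable in each variable
    separately (equivalent to holomorphy by Osgood's lemma). *)
Definition Holo3 (r : R) (F : Cx -> Cx -> Cx -> Cx) : Prop :=
  0 < r /\
  (forall x y z, in_polydisc r x y z ->
     forall eps, 0 < eps -> exists delta, 0 < delta /\
       forall x' y' z', Cabs (Csub x' x) < delta -> Cabs (Csub y' y) < delta ->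
         Cabs (Csub z' z) < delta -> Cabs (Csub (F x' y' z') (F x y z)) < eps) /\
  (forall x y z, in_polydisc r x y z ->
     (exists L, Chasderiv (fun w => F w y z) x L) /\
     (exists L, Chasderiv (fun w => F x w z) y L) /\
     (exists L, Chasderiv (fun w => F x y w) z L)).

Definition holo_near0 (F : Cx -> Cx -> Cx -> Cx) : Prop := exists r, Holo3 r F.

Definition vanish_order2 (F : Cx -> Cx -> Cx -> Cx) : Prop :=
  F C0 C0 C0 = C0 /\
  Chasderiv (fun w => F w C0 C0) C0 C0 /\
  Chasderiv (fun w => F C0 w C0) C0 C0 /\
  Chasderiv (fun w => F C0 C0 w) C0 C0.

Definition Xdot (w : R) (f : Cx -> Cx -> Cx -> Cx) (x y z : Cx) : Cx :=
  Cadd (Cadd (Cmul (Ci w) x) y) (f x y z).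
Definition Ydot (w : R) (g : Cx -> Cx -> Cx -> Cx) (x y z : Cx) : Cx :=
  Cadd (Cmul (Ci w) y) (g x y z).
Definition Zdot (lam : Cx) (h : Cx -> Cx -> Cx -> Cx) (x y z : Cx) : Cx :=
  Cadd (Cmul lam z) (h x y z).

(** An x-invariant holomorphic center manifold germ at 0: a one-dimensional
    complex submanifold through 0 tangent to the x-axis, represented (as any
    such germ locally is) as the graph {(x, phi x, psi x)} with phi, psi
    holomorphic, vanishing with zero derivative at 0; invariance means the
    vector field is tangent to the graph. *)
Definition x_center_manifold (w : R) (lam : Cx) (f g h : Cx -> Cx -> Cx -> Cx)
    (phi psi : Cx -> Cx) : Prop :=
  exists r, Holo1 r phi /\ Holo1 r psi /\
    phi C0 = C0 /\ psi C0 = C0 /\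
    Chasderiv phi C0 C0 /\ Chasderiv psi C0 C0 /\
    forall x, Cabs x < r ->
      forall L1 L2, Chasderiv phi x L1 -> Chasderiv psi x L2 ->
        Cmul L1 (Xdot w f x (phi x) (psi x)) = Ydot w g x (phi x) (psi x) /\
        Cmul L2 (Xdot w f x (phi x) (psi x)) = Zdot lam h x (phi x) (psi x).

Definition same_germ (phi1 psi1 phi2 psi2 : Cx -> Cx) : Prop :=
  exists rho, 0 < rho /\ forall x, Cabs x < rho -> phi1 x = phi2 x /\ psi1 x = psi2 x.

Definition Rderiv_C (u : R -> Cx) (t : R) (v : Cx) : Prop :=
  derivable_pt_lim (fun s => fst (u s)) t (fst v) /\
  derivable_pt_lim (fun s => snd (u s)) t (snd v).

Definition trajectory (w : R) (lam : Cx) (f g h : Cx -> Cx -> Cx -> Cx)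
    (gx gy gz : R -> Cx) : Prop :=
  forall t,
    Rderiv_C gx t (Xdot w f (gx t) (gy t) (gz t)) /\
    Rderiv_C gy t (Ydot w g (gx t) (gy t) (gz t)) /\
    Rderiv_C gz t (Zdot lam h (gx t) (gy t) (gz t)).

Definition isochronous_center (w : R) (lam : Cx) (f g h : Cx -> Cx -> Cx -> Cx)
    (phi psi : Cx -> Cx) (T : R) : Prop :=
  exists rho, 0 < rho /\
    forall x0, 0 < Cabs x0 < rho ->
      (exists gx gy gz, trajectory w lam f g h gx gy gz /\
         gx 0 = x0 /\ gy 0 = phi x0 /\ gz 0 = psi x0) /\
      (forall gx gy gz, trajectory w lam f g h gx gy gz ->
         gx 0 = x0 -> gy 0 = phi x0 -> gz 0 = psi x0 ->
         (forall t, gx (t + T) = gx t /\ gy (t + T) = gy t /\ gz (t + T) = gz t) /\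
         (forall s, 0 < s < T -> ~ (gx s = x0 /\ gy s = phi x0 /\ gz s = psi x0))).

(* Main.v *)
(** A center manifold is sought as a holomorphic curve P(s) = (s, 0, 0) + O(s^2) such that
    t |-> P(s e^{iwt}) is a trajectory for every small s. Expanding in powers of s, there is no
    resonance: i w (n - 1) and i w n - lambda do not vanish for n >= 2, and they stay away from 0.
    Instead of power series, the linear equations are solved by averages over the rotations
    s |-> s e^{iwt}, which preserve holomorphy and are bounded in the sup norm; a contraction argument
    on a small disc gives existence and uniqueness of P. Since the first component of P is tangent to
    the identity, it has a holomorphic inverse, and P is a graph over the x-axis filled with periodic
    trajectories of period 2 pi / |w|. Conversely every center manifold carries such a curve, obtained
    from the same existence theorem applied to the reduced equation, so it coincides with the range
    of P.

    The Cauchy theory needed is: Goursat's theorem in logarithmic coordinates gives the mean value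
    formula for the derivative, hence Cauchy estimates, hence Taylor expansions with uniform
    quadratic remainder for separately holomorphic functions. *)
Require Import Defs.
From Stdlib Require Import Reals Lra Lia Classical ClassicalEpsilon.
From Coquelicot Require Import Coquelicot.
Open Scope R_scope.

(** * Complex derivatives *)

(** The linear part has a Jordan block in (x, y): [y] drives [x] with coefficient 1, so a component
    of [y] along [s] would create a secular term t e^{iwt}. Tangency to the x-axis excludes it, and
    the forcing terms averaged by the iteration are all O(s^2). The condition P(s) = (s, 0, 0) +
    O(s^2) also removes the freedom of rescaling the parameter, which is what allows two center
    manifolds to be compared through their curves. Distances between curves are divided by |s|:
    measured so, a nonlinearity of order two gains a factor |s|, and a small disc makes the
    iteration contract however large the kernels are. Holomorphy is given as differentiability at
    each point, with no control on derivatives, so estimates are carried as inequalities on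
    increments, which survive limits and integrals. Nothing is known of f, g, h away from 0. A
    competing trajectory can therefore not be assumed to stay near 0, and it is controlled by an
    estimate valid only while it is close to the circle orbit. *)

Lemma Cabs_Cmod z : Cabs z = Cmod z.
Proof. reflexivity. Qed.

Lemma Chasderiv_is_derive (u : C -> C) (z L : C) :
  Chasderiv u z L <-> is_derive (K := C_AbsRing) (V := AbsRing_NormedModule C_AbsRing) u z L.
Proof.
split.
- intros H; split; [apply is_linear_scal_l|].
  intros x Hx.
  apply (@is_filter_lim_locally_unique C_AbsRing (AbsRing_NormedModule C_AbsRing)) in Hx; subst x.
  intros eps. destruct (H eps (cond_pos eps)) as (d & Hd & H1).
  exists (mkposreal d Hd). intros y Hy.
  specialize (H1 (Cminus y z) Hy).
  change (Cmod (u (z + (y - z)) - u z - L * (y - z)) <= eps * Cmod (y - z))%C in H1.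
  assert (E : forall a b : C, (a + (b - a) = b)%C) by (intros; ring).
  rewrite E in H1.
  rewrite Cmult_comm in H1. exact H1.
- intros [_ H] eps Heps.
  destruct (H z (fun P HP => HP) (mkposreal eps Heps)) as (d & Hd).
  exists d; split; [apply cond_pos|]. intros h Hh.
  specialize (Hd (Cplus z h)).
  change (Cmod (u (z + h) - u z - L * h) <= eps * Cmod h)%C.
  assert (E : (z + h - z = h)%C) by ring.
  assert (B : Cmod (z + h - z) < d) by (rewrite E; exact Hh).
  specialize (Hd B).
  change (Cmod (u (z + h) - u z - (z + h - z) * L) <= eps * Cmod (z + h - z))%C in Hd.
  rewrite E, (Cmult_comm h) in Hd. exact Hd.
Qed.

Lemma Chasderiv_ext_loc (u v : C -> C) z L d : 0 < d ->
  (forall h, Cmod h < d -> u (z + h)%C = v (z + h)%C) ->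
  Chasderiv u z L -> Chasderiv v z L.
Proof.
intros Hd E H eps He. destruct (H eps He) as (d' & Hd' & H1).
exists (Rmin d d'); split; [now apply Rmin_pos|].
intros h Hh. change (Cabs h) with (Cmod h) in Hh.
change (Cadd z h) with (z + h)%C.
assert (E0 := E 0%C). rewrite Cplus_0_r in E0.
rewrite <- E, <- E0.
- apply H1. apply Rlt_le_trans with (1 := Hh). apply Rmin_r.
- rewrite Cmod_0; lra.
- apply Rlt_le_trans with (1 := Hh). apply Rmin_l.
Qed.

Lemma Chasderiv_ext (u v : C -> C) z L : (forall x, u x = v x) ->
  Chasderiv u z L -> Chasderiv v z L.
Proof. intros E. apply Chasderiv_ext_loc with 1; auto with real. Qed.

Lemma Chasderiv_const (c z : C) : Chasderiv (fun _ => c) z (RtoC 0).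
Proof. apply Chasderiv_is_derive. apply (is_derive_const (K:=C_AbsRing) (V:=AbsRing_NormedModule C_AbsRing) c z). Qed.

Lemma Chasderiv_id (z : C) : Chasderiv (fun x => x) z (RtoC 1).
Proof. apply Chasderiv_is_derive. apply (is_derive_id (K:=C_AbsRing) z). Qed.

Lemma Chasderiv_plus (u v : C -> C) z L1 L2 : Chasderiv u z L1 -> Chasderiv v z L2 ->
  Chasderiv (fun x => u x + v x)%C z (L1 + L2)%C.
Proof.
rewrite !Chasderiv_is_derive. apply (is_derive_plus (K:=C_AbsRing) (V:=AbsRing_NormedModule C_AbsRing)).
Qed.

Lemma Chasderiv_mult (u v : C -> C) z L1 L2 : Chasderiv u z L1 -> Chasderiv v z L2 ->
  Chasderiv (fun x => u x * v x)%C z (L1 * v z + u z * L2)%C.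
Proof.
rewrite !Chasderiv_is_derive. intros H1 H2.
apply (is_derive_mult (K:=C_AbsRing) u v z L1 L2 H1 H2). exact Cmult_comm.
Qed.

Lemma Chasderiv_comp (u v : C -> C) z L1 L2 : Chasderiv u (v z) L1 -> Chasderiv v z L2 ->
  Chasderiv (fun x => u (v x)) z (L1 * L2)%C.
Proof.
rewrite !Chasderiv_is_derive. intros H1 H2. rewrite Cmult_comm.
apply (is_derive_comp (K:=C_AbsRing) (V:=AbsRing_NormedModule C_AbsRing) u v z L1 L2 H1 H2).
Qed.

Lemma Chasderiv_scal (c : C) (u : C -> C) z L : Chasderiv u z L ->
  Chasderiv (fun x => c * u x)%C z (c * L)%C.
Proof.
intros H. replace (c * L)%C with (0 * u z + c * L)%C by ring.
apply Chasderiv_mult; auto. apply Chasderiv_const.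
Qed.

Lemma Chasderiv_minus (u v : C -> C) z L1 L2 : Chasderiv u z L1 -> Chasderiv v z L2 ->
  Chasderiv (fun x => u x - v x)%C z (L1 - L2)%C.
Proof.
intros H1 H2. apply (Chasderiv_scal (-(1))%C) in H2.
apply (Chasderiv_ext (fun x => u x + -(1) * v x)%C); [intros; ring|].
replace (L1 - L2)%C with (L1 + - (1) * L2)%C by ring.
now apply Chasderiv_plus.
Qed.

Lemma Chasderiv_lipschitz u z L : Chasderiv u z L ->
  exists d, 0 < d /\ forall h, Cmod h < d ->
    Cmod (u (z + h) - u z)%C <= (Cmod L + 1) * Cmod h.
Proof.
intros H. destruct (H 1 Rlt_0_1) as (d & Hd & H1). exists d; split; auto.
intros h Hh. specialize (H1 h Hh).
change (Cmod (u (z + h) - u z - L * h)%C <= 1 * Cmod h) in H1.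
replace (u (z+h) - u z)%C with ((u (z + h) - u z - L * h) + L * h)%C by ring.
eapply Rle_trans; [apply Cmod_triangle|]. rewrite Cmod_mult. lra.
Qed.

Lemma Cmod_triangle_rev (x y : C) : Cmod x <= Cmod y + Cmod (x - y).
Proof.
replace x with (y + (x - y))%C at 1 by ring. apply Cmod_triangle.
Qed.

Lemma Cmod_minus_sym (x y : C) : Cmod (x - y) = Cmod (y - x).
Proof. rewrite <- Cmod_opp. f_equal; ring. Qed.

Lemma Cmod_minus_le (x y : C) : Cmod (x - y) <= Cmod x + Cmod y.
Proof.
eapply Rle_trans; [apply Cmod_triangle|]. rewrite Cmod_opp. lra.
Qed.

Lemma fst_le_Cmod (z : C) : Rabs (fst z) <= Cmod z.
Proof. eapply Rle_trans; [|apply Rmax_Cmod]. apply Rmax_l. Qed.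

Lemma snd_le_Cmod (z : C) : Rabs (snd z) <= Cmod z.
Proof. eapply Rle_trans; [|apply Rmax_Cmod]. apply Rmax_r. Qed.

Lemma Cmod_le_fst_snd (z : C) : Cmod z <= Rabs (fst z) + Rabs (snd z).
Proof.
destruct z as [a b]. replace ((a,b):C) with (RtoC a + Ci * RtoC b)%C at 1.
- eapply Rle_trans; [apply Cmod_triangle|]. rewrite Cmod_mult, Cmod_Ci, !Cmod_R. simpl fst; simpl snd; lra.
- apply injective_projections; simpl; ring.
Qed.

Definition Hol (r : R) (u : C -> C) := forall z, Cmod z < r -> exists L, Chasderiv u z L.

Lemma Hol_le r r' u : r' <= r -> Hol r u -> Hol r' u.
Proof. intros H Hu z Hz. apply Hu; lra. Qed.

Lemma Chasderiv_eq u z (L L' : C) : Chasderiv u z L -> L = L' -> Chasderiv u z L'.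
Proof. now intros H <-. Qed.

Ltac Ceq := apply injective_projections; simpl; ring.

(** * Complex-valued functions of a real variable *)

Definition Ccont (f : R -> C) (t : R) :=
  continuous (fun s => fst (f s)) t /\ continuous (fun s => snd (f s)) t.

Lemma Rcontinuous_eps (f : R -> R) t : continuous f t <->
  forall eps, 0 < eps -> exists d, 0 < d /\ forall s, Rabs (s - t) < d -> Rabs (f s - f t) < eps.
Proof.
split.
- intros H eps He. apply continuity_pt_filterlim in H.
  destruct (H eps He) as (d & Hd & H1). exists d; split; auto.
  intros s Hs. destruct (Req_dec s t) as [->|E].
  + rewrite Rminus_diag_eq, Rabs_R0; auto.
  + apply H1. split; [split; [exact I|auto]|exact Hs].
- intros H. apply continuity_pt_filterlim. intros eps He.
  destruct (H eps He) as (d & Hd & H1). exists d; split; auto.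
  intros s [_ Hs]. apply H1, Hs.
Qed.

Lemma Ccont_eps (f : R -> C) t : Ccont f t <->
  forall eps, 0 < eps -> exists d, 0 < d /\
    forall s, Rabs (s - t) < d -> Cmod (f s - f t) < eps.
Proof.
split.
- intros [H1 H2] eps He. rewrite Rcontinuous_eps in H1, H2.
  destruct (H1 (eps/2)) as (d1 & Hd1 & K1); [lra|].
  destruct (H2 (eps/2)) as (d2 & Hd2 & K2); [lra|].
  exists (Rmin d1 d2); split; [now apply Rmin_pos|]. intros s Hs.
  specialize (K1 s (Rlt_le_trans _ _ _ Hs (Rmin_l _ _))).
  specialize (K2 s (Rlt_le_trans _ _ _ Hs (Rmin_r _ _))).
  eapply Rle_lt_trans; [apply Cmod_le_fst_snd|]. simpl.
  unfold Rminus in K1, K2. lra.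
- intros H. split; apply Rcontinuous_eps; intros eps He;
  destruct (H eps He) as (d & Hd & K); exists d; split; auto; intros s Hs;
  (eapply Rle_lt_trans; [|apply (K s Hs)]).
  + apply (fst_le_Cmod (f s - f t)).
  + apply (snd_le_Cmod (f s - f t)).
Qed.

Lemma Ccont_const c t : Ccont (fun _ => c) t.
Proof. split; apply continuous_const. Qed.

Lemma Ccont_plus f g t : Ccont f t -> Ccont g t -> Ccont (fun s => f s + g s)%C t.
Proof. intros [H1 H2] [H3 H4]; split; simpl; now apply (continuous_plus (V:=R_NormedModule)). Qed.

Lemma Ccont_minus f g t : Ccont f t -> Ccont g t -> Ccont (fun s => f s - g s)%C t.
Proof. intros [H1 H2] [H3 H4]; split; simpl; now apply (continuous_minus (V:=R_NormedModule)). Qed.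

Lemma Ccont_mult f g t : Ccont f t -> Ccont g t -> Ccont (fun s => f s * g s)%C t.
Proof.
intros [H1 H2] [H3 H4]; split; simpl.
- apply (continuous_minus (V:=R_NormedModule)); now apply (continuous_mult (K:=R_AbsRing)).
- apply (continuous_plus (V:=R_NormedModule)); now apply (continuous_mult (K:=R_AbsRing)).
Qed.

Lemma Ccont_shift f c t : Ccont f (t + c) -> Ccont (fun s => f (s + c)) t.
Proof.
rewrite !Ccont_eps. intros H eps He. destruct (H eps He) as (d & Hd & K).
exists d; split; auto. intros s Hs. apply K. replace (s + c - (t + c)) with (s - t) by ring. auto.
Qed.

Lemma Ccont_comp (u : C -> C) (g : R -> C) t L :
  Chasderiv u (g t) L -> Ccont g t -> Ccont (fun s => u (g s)) t.
Proof.
intros Hu. rewrite !Ccont_eps. intros H eps He.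
destruct (Chasderiv_lipschitz _ _ _ Hu) as (d & Hd & K).
pose proof (Cmod_ge_0 L).
set (A := Cmod L + 1) in *. 
destruct (H (Rmin d (eps / A))) as (d' & Hd' & K').
{ apply Rmin_pos; auto. apply Rdiv_lt_0_compat; unfold A; lra. }
exists d'; split; auto. intros s Hs. specialize (K' s Hs).
specialize (K (g s - g t)%C (Rlt_le_trans _ _ _ K' (Rmin_l _ _))).
replace (g t + (g s - g t))%C with (g s) in K by ring.
eapply Rle_lt_trans; [apply K|].
apply Rlt_le_trans with (A * (eps / A)).
- apply Rmult_lt_compat_l; [unfold A; lra|]. eapply Rlt_le_trans; [apply K'|apply Rmin_r].
- right. field. unfold A; lra.
Qed.

Lemma Rderiv_C_cont f t v : Rderiv_C f t v -> Ccont f t.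
Proof.
intros [H1 H2]; split; apply (ex_derive_continuous (V:=R_NormedModule)).
- exists (fst v). now apply is_derive_Reals.
- exists (snd v). now apply is_derive_Reals.
Qed.

Lemma Rderiv_C_const c t : Rderiv_C (fun _ => c) t (RtoC 0).
Proof. split; simpl; apply derivable_pt_lim_const. Qed.

Lemma Rderiv_C_RtoC (f : R -> R) t l : derivable_pt_lim f t l -> Rderiv_C (fun s => RtoC (f s)) t (RtoC l).
Proof. intros H; split; simpl; auto. apply derivable_pt_lim_const. Qed.

Lemma Rderiv_C_plus (f g : R -> C) t (v1 v2 : C) : Rderiv_C f t v1 -> Rderiv_C g t v2 ->
  Rderiv_C (fun s => f s + g s)%C t (v1 + v2)%C.
Proof.
intros [H1 H2] [H3 H4]; split; simpl.
- now apply (derivable_pt_lim_plus (fun s => fst (f s)) (fun s => fst (g s))).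
- now apply (derivable_pt_lim_plus (fun s => snd (f s)) (fun s => snd (g s))).
Qed.

Lemma Rderiv_C_eq f t (v v' : C) : Rderiv_C f t v -> v = v' -> Rderiv_C f t v'.
Proof. now intros H <-. Qed.

Lemma Rderiv_C_mult (f g : R -> C) t (v1 v2 : C) : Rderiv_C f t v1 -> Rderiv_C g t v2 ->
  Rderiv_C (fun s => f s * g s)%C t (v1 * g t + f t * v2)%C.
Proof.
intros [H1 H2] [H3 H4]; split.
- replace (fst (v1 * g t + f t * v2)%C) with
   ((fst v1 * fst (g t) + fst (f t) * fst v2) - (snd v1 * snd (g t) + snd (f t) * snd v2))
   by (simpl; ring).
  apply (derivable_pt_lim_minus (fun s => fst (f s) * fst (g s)) (fun s => snd (f s) * snd (g s)));
  now apply (derivable_pt_lim_mult (fun s => _ (f s)) (fun s => _ (g s))).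
- replace (snd (v1 * g t + f t * v2)%C) with
   ((fst v1 * snd (g t) + fst (f t) * snd v2) + (snd v1 * fst (g t) + snd (f t) * fst v2))
   by (simpl; ring).
  apply (derivable_pt_lim_plus (fun s => fst (f s) * snd (g s)) (fun s => snd (f s) * fst (g s)));
  now apply (derivable_pt_lim_mult (fun s => _ (f s)) (fun s => _ (g s))).
Qed.

Lemma Rderiv_C_scal (c : C) (g : R -> C) t (v : C) : Rderiv_C g t v ->
  Rderiv_C (fun s => c * g s)%C t (c * v)%C.
Proof.
intros H. apply Rderiv_C_eq with (0 * g t + c * v)%C; [|ring].
apply (Rderiv_C_mult (fun _ => c) g); auto. apply Rderiv_C_const.
Qed.

Lemma Rderiv_C_minus (f g : R -> C) t (v1 v2 : C) : Rderiv_C f t v1 -> Rderiv_C g t v2 ->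
  Rderiv_C (fun s => f s - g s)%C t (v1 - v2)%C.
Proof.
intros [H1 H2] [H3 H4]; split; simpl.
- now apply (derivable_pt_lim_minus (fun s => fst (f s)) (fun s => fst (g s))).
- now apply (derivable_pt_lim_minus (fun s => snd (f s)) (fun s => snd (g s))).
Qed.

(** A complex derivative mixes real and imaginary parts, so the chain rule [Rderiv_C_comp] needs the
    increment in modulus rather than componentwise. *)
Lemma Rderiv_C_eps (f : R -> C) t (v : C) : Rderiv_C f t v <->
  forall eps, 0 < eps -> exists d, 0 < d /\ forall h, Rabs h < d ->
    Cmod (f (t + h)%R - f t - v * h)%C <= eps * Rabs h.
Proof.
split.
- intros [H1 H2] eps He.
  destruct (H1 (eps/2)) as [d1 K1]; [lra|].
  destruct (H2 (eps/2)) as [d2 K2]; [lra|].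
  exists (Rmin d1 d2); split; [apply Rmin_pos; apply cond_pos|]. intros h Hh.
  destruct (Req_dec h 0) as [->|Nh].
  { replace (f (t + 0)%R - f t - v * 0)%C with (RtoC 0)
      by (rewrite Rplus_0_r; apply injective_projections; simpl; ring).
    rewrite Cmod_0, Rabs_R0. lra. }
  specialize (K1 h Nh (Rlt_le_trans _ _ _ Hh (Rmin_l _ _))).
  specialize (K2 h Nh (Rlt_le_trans _ _ _ Hh (Rmin_r _ _))).
  assert (Ph : 0 < Rabs h) by now apply Rabs_pos_lt.
  eapply Rle_trans; [apply Cmod_le_fst_snd|].
  replace (fst (f (t + h)%R - f t - v * h)%C) with (((fst (f (t + h)) - fst (f t)) / h - fst v) * h)
    by (simpl; field; auto).
  replace (snd (f (t + h)%R - f t - v * h)%C) with (((snd (f (t + h)) - snd (f t)) / h - snd v) * h)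
    by (simpl; field; auto).
  rewrite !Rabs_mult. nra.
- intros H. split; intros eps He; destruct (H (eps/2)) as (d & Hd & K); try lra;
  exists (mkposreal d Hd); intros h Nh Hh; specialize (K h Hh);
  assert (Ph : 0 < Rabs h) by now apply Rabs_pos_lt.
  + apply (Rmult_lt_reg_r (Rabs h)); auto. rewrite <- Rabs_mult.
    replace (((fst (f (t + h)) - fst (f t)) / h - fst v) * h) with (fst (f (t + h)%R - f t - v * h)%C)
      by (simpl; field; auto).
    pose proof (fst_le_Cmod (f (t + h)%R - f t - v * h)%C). nra.
  + apply (Rmult_lt_reg_r (Rabs h)); auto. rewrite <- Rabs_mult.
    replace (((snd (f (t + h)) - snd (f t)) / h - snd v) * h) with (snd (f (t + h)%R - f t - v * h)%C)
      by (simpl; field; auto).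
    pose proof (snd_le_Cmod (f (t + h)%R - f t - v * h)%C). nra.
Qed.

Lemma Rderiv_C_comp (u : C -> C) (g : R -> C) t (L v : C) :
  Chasderiv u (g t) L -> Rderiv_C g t v -> Rderiv_C (fun s => u (g s)) t (L * v)%C.
Proof.
intros Hu Hg. pose proof (Rderiv_C_cont _ _ _ Hg) as Cg. rewrite Ccont_eps in Cg.
rewrite Rderiv_C_eps in *. intros eps He.
pose proof (Cmod_ge_0 L) as PL. pose proof (Cmod_ge_0 v) as Pv.
set (e1 := eps / (2 * (Cmod v + 1))).
assert (He1 : 0 < e1) by (apply Rdiv_lt_0_compat; lra).
(* The cap 1 bounds the increment [k] of [g] by (|v| + 1) |h|; [e1] and the second entry of [e2]
   then give eps / 2 each. *)
set (e2 := Rmin 1 (eps / (2 * (Cmod L + 1)))).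
assert (He2 : 0 < e2) by (apply Rmin_pos; [lra|apply Rdiv_lt_0_compat; lra]).
destruct (Hu e1 He1) as (d1 & Hd1 & K1).
destruct (Cg d1 Hd1) as (d2 & Hd2 & K2).
destruct (Hg e2 He2) as (d3 & Hd3 & K3).
exists (Rmin d2 d3); split; [now apply Rmin_pos|]. intros h Hh.
specialize (K3 h (Rlt_le_trans _ _ _ Hh (Rmin_r _ _))).
specialize (K2 (t + h)).
replace (t + h - t) with h in K2 by ring.
specialize (K2 (Rlt_le_trans _ _ _ Hh (Rmin_l _ _))).
set (k := (g (t + h)%R - g t)%C) in *.
specialize (K1 k K2).
change (Cmod (u (g t + k) - u (g t) - L * k)%C <= e1 * Cmod k) in K1.
replace (g t + k)%C with (g (t + h)) in K1 by (unfold k; ring).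
replace (u (g (t + h)%R) - u (g t) - L * v * h)%C with
  ((u (g (t + h)%R) - u (g t) - L * k) + L * (k - v * h))%C
  by (apply injective_projections; simpl; ring).
eapply Rle_trans; [apply Cmod_triangle|]. rewrite Cmod_mult.
assert (Bk : Cmod k <= (Cmod v + 1) * Rabs h).
{ replace k with ((k - v * h) + v * h)%C by ring.
  eapply Rle_trans; [apply Cmod_triangle|]. rewrite Cmod_mult, Cmod_R.
  pose proof (Rmin_l 1 (eps / (2 * (Cmod L + 1)))). fold e2 in H.
  pose proof (Rabs_pos h). nra. }
assert (B1 : e1 * Cmod k <= eps / 2 * Rabs h).
{ apply Rle_trans with (e1 * ((Cmod v + 1) * Rabs h)).
  - apply Rmult_le_compat_l; lra.
  - right. unfold e1. field. lra. }
assert (B2 : Cmod L * Cmod (k - v * h) <= eps / 2 * Rabs h).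
{ apply Rle_trans with ((Cmod L + 1) * (eps / (2 * (Cmod L + 1)) * Rabs h)).
  - apply Rmult_le_compat; try lra; try apply Cmod_ge_0.
    eapply Rle_trans; [apply K3|]. apply Rmult_le_compat_r; [apply Rabs_pos|apply Rmin_r].
  - right. field. lra. }
lra.
Qed.

(** * Integrals of complex-valued functions of a real variable *)

Definition CInt (f : R -> C) (a b : R) : C :=
  (RInt (fun t => fst (f t)) a b, RInt (fun t => snd (f t)) a b).

Arguments CInt f (a b)%_R_scope.

Definition Ccont_on (f : R -> C) (a b : R) := forall t, a <= t <= b -> Ccont f t.

Lemma Ccont_on_fst f a b : a <= b -> Ccont_on f a b -> ex_RInt (fun t => fst (f t)) a b.
Proof.
intros H Hf. apply (ex_RInt_continuous (V:=R_CompleteNormedModule)).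
rewrite Rmin_left, Rmax_right; auto. intros z Hz. apply Hf, Hz.
Qed.

Lemma Ccont_on_snd f a b : a <= b -> Ccont_on f a b -> ex_RInt (fun t => snd (f t)) a b.
Proof.
intros H Hf. apply (ex_RInt_continuous (V:=R_CompleteNormedModule)).
rewrite Rmin_left, Rmax_right; auto. intros z Hz. apply Hf, Hz.
Qed.

Lemma CInt_ext f g a b : a <= b -> (forall t, a <= t <= b -> f t = g t) -> CInt f a b = CInt g a b.
Proof.
intros H E. unfold CInt. f_equal; apply RInt_ext; rewrite Rmin_left, Rmax_right; auto;
intros t Ht; rewrite E; auto; lra.
Qed.

Lemma CInt_plus f g a b : a <= b -> Ccont_on f a b -> Ccont_on g a b ->
  CInt (fun t => f t + g t)%C a b = (CInt f a b + CInt g a b)%C.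
Proof.
intros H Hf Hg. apply injective_projections; simpl;
apply (RInt_plus (V:=R_CompleteNormedModule)); auto using Ccont_on_fst, Ccont_on_snd.
Qed.

Lemma CInt_scal (c : C) f a b : a <= b -> Ccont_on f a b ->
  CInt (fun t => c * f t)%C a b = (c * CInt f a b)%C.
Proof.
intros H Hf. pose proof (Ccont_on_fst _ _ _ H Hf) as H1. pose proof (Ccont_on_snd _ _ _ H Hf) as H2.
apply injective_projections; simpl.
- apply is_RInt_unique, (is_RInt_minus (V:=R_NormedModule));
  apply (is_RInt_scal (V:=R_NormedModule)), (RInt_correct (V:=R_CompleteNormedModule)); auto.
- apply is_RInt_unique, (is_RInt_plus (V:=R_NormedModule));
  apply (is_RInt_scal (V:=R_NormedModule)), (RInt_correct (V:=R_CompleteNormedModule)); auto.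
Qed.

Lemma CInt_minus f g a b : a <= b -> Ccont_on f a b -> Ccont_on g a b ->
  CInt (fun t => f t - g t)%C a b = (CInt f a b - CInt g a b)%C.
Proof.
intros H Hf Hg. apply injective_projections; simpl;
apply (RInt_minus (V:=R_CompleteNormedModule)); auto using Ccont_on_fst, Ccont_on_snd.
Qed.

Lemma CInt_const c a b : CInt (fun _ => c) a b = ((b - a)%R * c)%C.
Proof.
apply injective_projections; simpl; rewrite RInt_const; unfold scal; simpl; unfold mult; simpl; ring.
Qed.

Lemma CInt_chasles f a b c : a <= b <= c -> Ccont_on f a c ->
  (CInt f a b + CInt f b c)%C = CInt f a c.
Proof.
intros H Hf.
assert (H1 : Ccont_on f a b) by (intros t Ht; apply Hf; lra).
assert (H2 : Ccont_on f b c) by (intros t Ht; apply Hf; lra).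
assert (L1 : a <= b) by lra. assert (L2 : b <= c) by lra.
apply injective_projections; simpl.
- exact (RInt_Chasles (V:=R_CompleteNormedModule) (fun t => fst (f t)) a b c
    (Ccont_on_fst f a b L1 H1) (Ccont_on_fst f b c L2 H2)).
- exact (RInt_Chasles (V:=R_CompleteNormedModule) (fun t => snd (f t)) a b c
    (Ccont_on_snd f a b L1 H1) (Ccont_on_snd f b c L2 H2)).
Qed.

(* Integrating [Re (conj c * f)] with [c] the integral reduces this to the real bound. *)
Lemma CInt_bound f a b M : a <= b -> Ccont_on f a b ->
  (forall t, a <= t <= b -> Cmod (f t) <= M) -> Cmod (CInt f a b) <= (b - a) * M.
Proof.
intros H Hf HM. set (c := CInt f a b).
pose proof (Cmod_ge_0 c).
assert (K : Cmod c ^ 2 <= (b - a) * (Cmod c * M)).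
{ assert (Hg : Ccont_on (fun t => Cconj c * f t)%C a b).
  { intros t Ht. apply Ccont_mult; [apply Ccont_const|auto]. }
  assert (E : Cmod c ^ 2 = fst (CInt (fun t => Cconj c * f t)%C a b)).
  { rewrite CInt_scal; auto. fold c. rewrite Cmod2_alt. unfold Re, Im. simpl. ring. }
  rewrite E. unfold CInt at 1. cbn [fst].
  replace ((b - a) * (Cmod c * M)) with (RInt (fun _ => Cmod c * M) a b)
    by (rewrite RInt_const; unfold scal; simpl; unfold mult; simpl; ring).
  apply RInt_le; auto.
  - apply (Ccont_on_fst (fun t => Cconj c * f t)%C); auto.
  - apply ex_RInt_const.
  - intros t Ht. eapply Rle_trans; [apply Rle_abs|].
    eapply Rle_trans; [apply fst_le_Cmod|]. rewrite Cmod_mult, Cmod_conj.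
    apply Rmult_le_compat_l; auto. apply HM; lra. }
destruct (Rle_lt_or_eq_dec 0 (Cmod c) H0) as [P|P].
- apply Rmult_le_reg_l with (Cmod c); auto. nra.
- rewrite <- P. apply Rmult_le_pos; [lra|].
  eapply Rle_trans; [apply Cmod_ge_0|apply (HM a)]. lra.
Qed.

Lemma CInt_shift f c a b : a <= b -> Ccont_on f (a + c) (b + c) ->
  CInt (fun t => f (t + c)) a b = CInt f (a + c) (b + c).
Proof.
intros H Hf.
assert (K : forall g : R -> R, ex_RInt g (a + c) (b + c) ->
  RInt (fun t => g (t + c)) a b = RInt g (a + c) (b + c)).
{ intros g Hg. pose proof (RInt_comp_lin g 1 c a b) as E.
  rewrite !Rmult_1_l in E. rewrite <- E; auto.
  apply RInt_ext. intros t _. unfold scal; simpl; unfold mult; simpl. rewrite !Rmult_1_l. auto. }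
apply injective_projections; simpl.
- apply (K (fun t => fst (f t))). apply Ccont_on_fst; auto; lra.
- apply (K (fun t => snd (f t))). apply Ccont_on_snd; auto; lra.
Qed.

Lemma CInt_deriv f a t : (forall s, Ccont f s) ->
  Rderiv_C (fun b => CInt f a b) t (f t).
Proof.
intros H. split; simpl; apply is_derive_Reals.
- apply (is_derive_RInt (V:=R_NormedModule) (fun t => fst (f t)) _ a); [|apply H].
  exists (mkposreal 1 Rlt_0_1). intros b _. apply (RInt_correct (V:=R_CompleteNormedModule)).
  apply (ex_RInt_continuous (V:=R_CompleteNormedModule)). intros; apply H.
- apply (is_derive_RInt (V:=R_NormedModule) (fun t => snd (f t)) _ a); [|apply H].
  exists (mkposreal 1 Rlt_0_1). intros b _. apply (RInt_correct (V:=R_CompleteNormedModule)).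
  apply (ex_RInt_continuous (V:=R_CompleteNormedModule)). intros; apply H.
Qed.

Lemma CInt_FTC F f a b : a <= b -> (forall t, a <= t <= b -> Rderiv_C F t (f t)) ->
  Ccont_on f a b -> CInt f a b = (F b - F a)%C.
Proof.
intros H HF Hf. apply injective_projections; simpl;
apply is_RInt_unique.
- apply (is_RInt_derive (V:=R_CompleteNormedModule) (fun t => fst (F t)) (fun t => fst (f t)));
  rewrite Rmin_left, Rmax_right; auto; intros t Ht.
  + apply is_derive_Reals, HF, Ht.
  + apply Hf, Ht.
- apply (is_RInt_derive (V:=R_CompleteNormedModule) (fun t => snd (F t)) (fun t => snd (f t)));
  rewrite Rmin_left, Rmax_right; auto; intros t Ht.
  + apply is_derive_Reals, HF, Ht.
  + apply Hf, Ht.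
Qed.

(** * Goursat's theorem on rectangles *)

Lemma nested_intervals (a b : nat -> R) :
  (forall n, a n <= a (S n)) -> (forall n, b (S n) <= b n) -> (forall n, a n <= b n) ->
  exists x, forall n, a n <= x <= b n.
Proof.
intros Ha Hb Hab.
assert (Ma : forall n k, a n <= a (n + k)%nat).
{ intros n k; induction k; [rewrite Nat.add_0_r; lra|].
  rewrite Nat.add_succ_r. specialize (Ha (n + k)%nat). lra. }
assert (Mb : forall n k, b (n + k)%nat <= b n).
{ intros n k; induction k; [rewrite Nat.add_0_r; lra|].
  rewrite Nat.add_succ_r. specialize (Hb (n + k)%nat). lra. }
assert (Mab : forall n m, a n <= b m).
{ intros n m. specialize (Ma n m). specialize (Mb m n). rewrite Nat.add_comm in Mb.
  specialize (Hab (n + m)%nat). lra. }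
destruct (completeness (fun x => exists n, x = a n)) as [x [H1 H2]].
- exists (b 0%nat). intros y [n ->]. apply Mab.
- exists (a 0%nat). now exists 0%nat.
- exists x. intros n; split.
  + apply H1. now exists n.
  + apply H2. intros y [m ->]. apply Mab.
Qed.

Lemma pow_half_small C d : 0 < d -> exists n, C / 2 ^ n < d.
Proof.
intros Hd. destruct (Rle_or_lt C 0) as [H|H].
{ exists 0%nat. simpl. lra. }
destruct (pow_lt_1_zero (/2)) with (y := d / C) as [N HN].
- rewrite Rabs_pos_eq; lra.
- now apply Rdiv_lt_0_compat.
- exists N. specialize (HN N (le_n _)). rewrite Rabs_pos_eq in HN.
  + rewrite pow_inv in HN. apply Rmult_lt_compat_l with (r := C) in HN; auto.
    replace (C * (d / C)) with d in HN by (field; lra). exact HN.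
  + apply pow_le; lra.
Qed.

(** * Bisection of rectangles *)

Section Bisection.

Variable Q : R * R * (R * R) -> Prop.

Definition quarter (k : nat) (s : R * R * (R * R)) : R * R * (R * R) :=
  let '((a, b), (c, d)) := s in
  let m := (a + b) / 2 in let n := (c + d) / 2 in
  match k with
  | 0%nat => ((a, m), (c, n)) | 1%nat => ((m, b), (c, n))
  | 2%nat => ((a, m), (n, d)) | _ => ((m, b), (n, d))
  end.

(** The fourth quarter needs no test: if the whole is bad and the first three are good, [Q_quarters]
    makes it bad. *)
Definition bad_quarter (s : R * R * (R * R)) : R * R * (R * R) :=
  if excluded_middle_informative (Q (quarter 0 s)) then
  if excluded_middle_informative (Q (quarter 1 s)) then
  if excluded_middle_informative (Q (quarter 2 s)) then quarter 3 s
  else quarter 2 s else quarter 1 s else quarter 0 s.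

Hypothesis Q_quarters : forall a b c d, a <= b -> c <= d ->
  (forall k, Q (quarter k ((a, b), (c, d)))) -> Q ((a, b), (c, d)).

(** If the conclusion failed, bad quarters would shrink to a point, and the local hypothesis there
    would apply to a late one. That hypothesis speaks only of rectangles containing the point,
    because differentiability at a single point gives nothing more. *)
Lemma bisection a b c d : a <= b -> c <= d ->
  (forall x y, a <= x <= b -> c <= y <= d -> exists e, 0 < e /\
     forall a' b' c' d', a <= a' <= x -> x <= b' <= b -> c <= c' <= y -> y <= d' <= d ->
       b' - a' < e -> d' - c' < e -> Q ((a', b'), (c', d'))) ->
  Q ((a, b), (c, d)).
Proof.
intros Hab Hcd Hloc. apply NNPP; intros HQ.
set (s := fix s n := match n with O => ((a, b), (c, d)) | S n => bad_quarter (s n) end).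
assert (Hs : forall n, exists a' b' c' d', s n = ((a', b'), (c', d')) /\
   ~ Q (s n) /\ a <= a' <= b' /\ b' <= b /\ c <= c' <= d' /\ d' <= d /\
   b' - a' = (b - a) / 2 ^ n /\ d' - c' = (d - c) / 2 ^ n /\
   exists k, s (S n) = quarter k (s n)).
{ intros n.
  assert (Hk : forall s, exists k, bad_quarter s = quarter k s).
  { intros t. unfold bad_quarter. repeat destruct excluded_middle_informative; eauto. }
  induction n as [|n (a' & b' & c' & d' & E & NQ & H1 & H2 & H3 & H4 & H5 & H6 & _)].
  - exists a, b, c, d. repeat split; auto; try lra; simpl; try field. apply Hk.
  - assert (NQ' : ~ Q (s (S n))).
    { change (s (S n)) with (bad_quarter (s n)). unfold bad_quarter.
      destruct excluded_middle_informative as [K0|K0]; auto.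
      destruct excluded_middle_informative as [K1|K1]; auto.
      destruct excluded_middle_informative as [K2|K2]; auto.
      intros K3. apply NQ. rewrite E. apply Q_quarters; try lra.
      rewrite E in *. intros [|[|[|k]]]; auto. }
    assert (P2 : 0 < 2 ^ n) by (apply pow_lt; lra).
    assert (F1 : (b - a) / 2 ^ S n = (b' - a') / 2) by (rewrite H5; simpl; field; lra).
    assert (F2 : (d - c) / 2 ^ S n = (d' - c') / 2) by (rewrite H6; simpl; field; lra).
    destruct (Hk (s n)) as [k Ek].
    assert (Es : s (S n) = quarter k (s n)) by exact Ek.
    destruct (Hk (s (S n))) as [k' Ek'].
    assert (Es' : exists k, s (S (S n)) = quarter k (s (S n))) by (exists k'; exact Ek').
    rewrite F1, F2. rewrite E in Es.
    destruct k as [|[|[|k]]]; simpl in Es;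
    eexists _, _, _, _; (split; [exact Es|]); repeat split; auto; lra. }
set (A n := fst (fst (s n))). set (B n := snd (fst (s n))).
set (C' n := fst (snd (s n))). set (D n := snd (snd (s n))).
assert (HA : exists x, forall n, A n <= x <= B n).
{ apply nested_intervals; intros n;
  destruct (Hs n) as (a' & b' & c' & d' & E & NQ & H1 & H2 & H3 & H4 & H5 & H6 & k & Ek);
  unfold A, B; rewrite ?Ek, E; destruct k as [|[|[|k]]]; simpl; lra. }
assert (HC : exists x, forall n, C' n <= x <= D n).
{ apply nested_intervals; intros n;
  destruct (Hs n) as (a' & b' & c' & d' & E & NQ & H1 & H2 & H3 & H4 & H5 & H6 & k & Ek);
  unfold C', D; rewrite ?Ek, E; destruct k as [|[|[|k]]]; simpl; lra. }
destruct HA as [x Hx]. destruct HC as [y Hy].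
assert (H0x := Hx 0%nat). assert (H0y := Hy 0%nat). simpl in H0x, H0y.
destruct (Hloc x y H0x H0y) as (e & He & HQe).
destruct (pow_half_small ((b - a) + (d - c)) e He) as [n Hn].
destruct (Hs n) as (a' & b' & c' & d' & E & NQ & H1 & H2 & H3 & H4 & H5 & H6 & _).
apply NQ. specialize (Hx n). specialize (Hy n). unfold A, B, C', D in Hx, Hy.
rewrite E in Hx, Hy |- *. simpl in Hx, Hy.
assert (P2 : 0 < 2 ^ n) by (apply pow_lt; lra).
replace ((b - a + (d - c)) / 2 ^ n) with ((b' - a') + (d' - c')) in Hn
  by (rewrite H5, H6; field; lra).
apply HQe; lra.
Qed.

End Bisection.

Section Goursat.

Variables (F : R -> R -> C) (beta : C).

(* [F (x, y)] stands for [g (x + beta * y)] with [g] holomorphic; a general slope [beta] lets the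
   second coordinate be the time along a rotation of angular speed [w]. *)
Definition Fdiff x y := exists L : C, forall eps, 0 < eps -> exists d, 0 < d /\
  forall x' y', Rabs (x' - x) < d -> Rabs (y' - y) < d ->
   Cmod (F x' y' - F x y - L * ((x' - x)%R + beta * (y' - y)%R)) <=
   eps * (Rabs (x' - x) + Rabs (y' - y)).

Lemma Fdiff_cont x y : Fdiff x y -> Ccont (fun t => F t y) x /\ Ccont (fun t => F x t) y.
Proof.
intros [L H]. pose proof (Cmod_ge_0 L). pose proof (Cmod_ge_0 beta).
destruct (H 1 Rlt_0_1) as (d & Hd & K).
split; apply Ccont_eps; intros eps He.
- exists (Rmin d (eps / (Cmod L + 2))). split.
  { apply Rmin_pos; auto. apply Rdiv_lt_0_compat; lra. }
  intros s Hs. specialize (K s y (Rlt_le_trans _ _ _ Hs (Rmin_l _ _))).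
  rewrite Rminus_diag_eq, Rabs_R0 in K; auto. specialize (K Hd).
  pose proof (Rlt_le_trans _ _ _ Hs (Rmin_r _ _)) as Hs2.
  replace (F s y - F x y)%C with ((F s y - F x y - L * ((s - x)%R + beta * 0%R)) + L * (s - x)%R)%C by ring.
  eapply Rle_lt_trans; [apply Cmod_triangle|]. rewrite Cmod_mult, Cmod_R.
  apply Rmult_lt_compat_r with (r := Cmod L + 2) in Hs2; [|lra].
  replace (eps / (Cmod L + 2) * (Cmod L + 2)) with eps in Hs2 by (field; lra).
  pose proof (Rabs_pos (s - x)). lra.
- assert (0 <= Cmod L * Cmod beta) by now apply Rmult_le_pos.
  exists (Rmin d (eps / (Cmod L * Cmod beta + 2))). split.
  { apply Rmin_pos; auto. apply Rdiv_lt_0_compat; lra. }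
  intros s Hs. specialize (K x s).
  rewrite (Rminus_diag_eq x x), Rabs_R0 in K; auto. specialize (K Hd (Rlt_le_trans _ _ _ Hs (Rmin_l _ _))).
  pose proof (Rlt_le_trans _ _ _ Hs (Rmin_r _ _)) as Hs2.
  replace (F x s - F x y)%C with ((F x s - F x y - L * (0%R + beta * (s - y)%R)) + (L * beta) * (s - y)%R)%C by ring.
  eapply Rle_lt_trans; [apply Cmod_triangle|]. rewrite !Cmod_mult, Cmod_R.
  apply Rmult_lt_compat_r with (r := Cmod L * Cmod beta + 2) in Hs2; [|lra].
  replace (eps / (Cmod L * Cmod beta + 2) * (Cmod L * Cmod beta + 2)) with eps in Hs2 by (field; lra).
  pose proof (Rabs_pos (s - y)). lra.
Qed.

(** The integral of g(z) dz around the rectangle, counterclockwise in the coordinates of z = x +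
    beta y: dz is dx on the sides parallel to the first axis and beta dy on the others. *)
Definition bdry_int a b c d : C :=
  (CInt (fun x => F x c - F x d) a b + beta * CInt (fun y => F b y - F a y) c d)%C.

Definition Fdiff_on a b c d := forall x y, a <= x <= b -> c <= y <= d -> Fdiff x y.

Lemma bdry_int_quarters a b c d m n : a <= m <= b -> c <= n <= d -> Fdiff_on a b c d ->
  bdry_int a b c d =
   (bdry_int a m c n + bdry_int m b c n + bdry_int a m n d + bdry_int m b n d)%C.
Proof.
intros Hm Hn HF.
assert (H1 : forall y, c <= y <= d -> Ccont_on (fun x => F x y) a b).
{ intros y Hy x Hx. apply Fdiff_cont. now apply HF. }
assert (H2 : forall x, a <= x <= b -> Ccont_on (fun y => F x y) c d).
{ intros x Hx y Hy. apply Fdiff_cont. now apply HF. }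
assert (S1 : forall y a' b', c <= y <= d -> a <= a' <= b -> a <= b' <= b -> Ccont_on (fun x => F x y) a' b').
{ intros y a' b' Hy Ha Hb x Hx. apply (H1 y Hy). lra. }
assert (S2 : forall x a' b', a <= x <= b -> c <= a' <= d -> c <= b' <= d -> Ccont_on (fun y => F x y) a' b').
{ intros x a' b' Hx Ha Hb y Hy. apply (H2 x Hx). lra. }
unfold bdry_int.
rewrite !CInt_minus; try (apply S1 || apply S2); try lra.
rewrite <- (CInt_chasles (fun x => F x c) a m b), <- (CInt_chasles (fun x => F x d) a m b),
  <- (CInt_chasles (F a) c n d), <- (CInt_chasles (F b) c n d);
  try apply S1; try apply S2; try lra.
ring.
Qed.

(** The scale is the square of half the perimeter: it is divided by exactly 4 under quartering, so
    the bound eps times this scale passes from the quarters to the whole. For small rectangles it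
    follows from differentiability, since the affine part integrates to zero. *)
Lemma goursat a b c d : a <= b -> c <= d -> Fdiff_on a b c d -> bdry_int a b c d = 0.
Proof.
intros Hab Hcd HF.
cut (forall eps, 0 < eps -> Cmod (bdry_int a b c d) <= eps * ((b - a) + (d - c)) ^ 2).
{ intros H. apply Cmod_eq_0. apply Rle_antisym; [|apply Cmod_ge_0].
  apply le_epsilon. intros eps He. rewrite Rplus_0_l.
  set (K := ((b - a) + (d - c)) ^ 2) in *. assert (0 <= K) by apply pow2_ge_0.
  eapply Rle_trans; [apply (H (eps / (K + 1)))|].
  - apply Rdiv_lt_0_compat; lra.
  - apply Rmult_le_reg_r with (K + 1); [lra|].
    replace (eps / (K + 1) * K * (K + 1)) with (eps * K) by (field; lra). nra. }
intros eps He.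
set (Q := fun s : R * R * (R * R) => let '((a', b'), (c', d')) := s in
  a <= a' -> b' <= b -> c <= c' -> d' <= d ->
  Cmod (bdry_int a' b' c' d') <= eps * ((b' - a') + (d' - c')) ^ 2).
cut (Q ((a, b), (c, d))).
{ intros H. apply H; lra. }
apply bisection; auto.
- intros a' b' c' d' Hab' Hcd' Hk. intros L1 L2 L3 L4.
  rewrite (bdry_int_quarters a' b' c' d' ((a' + b') / 2) ((c' + d') / 2)); try lra.
  2:{ intros x y Hx Hy. apply HF; lra. }
  pose proof (Hk 0%nat) as K0. pose proof (Hk 1%nat) as K1.
  pose proof (Hk 2%nat) as K2. pose proof (Hk 3%nat) as K3. simpl in K0, K1, K2, K3.
  specialize (K0 ltac:(lra) ltac:(lra) ltac:(lra) ltac:(lra)).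
  specialize (K1 ltac:(lra) ltac:(lra) ltac:(lra) ltac:(lra)).
  specialize (K2 ltac:(lra) ltac:(lra) ltac:(lra) ltac:(lra)).
  specialize (K3 ltac:(lra) ltac:(lra) ltac:(lra) ltac:(lra)).
  eapply Rle_trans; [apply Cmod_triangle|].
  eapply Rle_trans; [apply Rplus_le_compat_r, Cmod_triangle|].
  eapply Rle_trans; [apply Rplus_le_compat_r, Rplus_le_compat_r, Cmod_triangle|].
  eapply Rle_trans; [apply Rplus_le_compat; [apply Rplus_le_compat; [apply Rplus_le_compat|]|]|].
  apply K0. apply K1. apply K2. apply K3.
  right. field.
- intros x y Hx Hy. destruct (HF x y Hx Hy) as [L HL].
  pose proof (Cmod_ge_0 beta) as Pb.
  (* Opposite sides differ from their affine model by at most 2 e W; the two pairs of sides have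
     length at most W and weights 1 and |beta|. *)
  set (e := eps / (2 * (1 + Cmod beta))).
  assert (0 < e) by (apply Rdiv_lt_0_compat; lra).
  destruct (HL e H) as (r & Hr & K). exists r; split; auto.
  intros a' b' c' d' Ha Hb Hc Hd Wr Hr'. intros _ _ _ _.
  set (W := (b' - a') + (d' - c')).
  set (E := fun x' y' => (F x' y' - F x y - L * ((x' - x)%R + beta * (y' - y)%R))%C).
  assert (BE : forall x' y', a' <= x' <= b' -> c' <= y' <= d' -> Cmod (E x' y') <= e * W).
  { intros x' y' Hx' Hy'. unfold E. eapply Rle_trans; [apply K|].
    - apply Rabs_def1; lra.
    - apply Rabs_def1; lra.
    - apply Rmult_le_compat_l; [lra|]. unfold W. apply Rplus_le_compat; apply Rabs_le; lra. }
  assert (S1 : forall y', c' <= y' <= d' -> Ccont_on (fun t => F t y') a' b').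
  { intros y' Hy' t Ht. apply Fdiff_cont, HF; lra. }
  assert (S2 : forall x', a' <= x' <= b' -> Ccont_on (fun t => F x' t) c' d').
  { intros x' Hx' t Ht. apply Fdiff_cont, HF; lra. }
  (* The differences of the affine part between opposite sides. They are constant along the sides,
     and their contributions to the boundary integral cancel. *)
  set (k1 := (- L * beta * (d' - c')%R)%C). set (k2 := (L * (b' - a')%R)%C).
  assert (E1 : CInt (fun t => F t c' - F t d')%C a' b' =
     (CInt (fun t => F t c' - F t d' - k1)%C a' b' + (b' - a')%R * k1)%C).
  { rewrite (CInt_minus (fun t => F t c' - F t d')%C (fun _ => k1)); try lra.
    - rewrite CInt_const. ring.
    - intros t Ht. apply Ccont_minus; apply S1; lra.
    - intros t Ht. apply Ccont_const. }
  assert (E2 : CInt (fun t => F b' t - F a' t)%C c' d' =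
     (CInt (fun t => F b' t - F a' t - k2)%C c' d' + (d' - c')%R * k2)%C).
  { rewrite (CInt_minus (fun t => F b' t - F a' t)%C (fun _ => k2)); try lra.
    - rewrite CInt_const. ring.
    - intros t Ht. apply Ccont_minus; apply S2; lra.
    - intros t Ht. apply Ccont_const. }
  unfold bdry_int. rewrite E1, E2.
  match goal with |- Cmod (?u + _ + _ * (?v + _)) <= _ =>
    replace (u + (b' - a')%R * k1 + beta * (v + (d' - c')%R * k2))%C with (u + beta * v)%C
     by (unfold k1, k2; ring);
    assert (B1 : Cmod u <= (b' - a') * (2 * (e * W)));
    [|assert (B2 : Cmod v <= (d' - c') * (2 * (e * W)))] end.
  + apply CInt_bound; try lra.
    * intros t Ht. apply Ccont_minus; [apply Ccont_minus; apply S1; lra|apply Ccont_const].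
    * intros t Ht. replace (F t c' - F t d' - k1)%C with (E t c' - E t d')%C
        by (unfold E, k1; rewrite !RtoC_minus; ring).
      eapply Rle_trans; [apply Cmod_minus_le|].
      pose proof (BE t c' Ht ltac:(lra)). pose proof (BE t d' Ht ltac:(lra)). lra.
  + apply CInt_bound; try lra.
    * intros t Ht. apply Ccont_minus; [apply Ccont_minus; apply S2; lra|apply Ccont_const].
    * intros t Ht. replace (F b' t - F a' t - k2)%C with (E b' t - E a' t)%C
        by (unfold E, k2; rewrite !RtoC_minus; ring).
      eapply Rle_trans; [apply Cmod_minus_le|].
      pose proof (BE b' t ltac:(lra) Ht). pose proof (BE a' t ltac:(lra) Ht). lra.
  + eapply Rle_trans; [apply Cmod_triangle|]. rewrite Cmod_mult.
    apply Rle_trans with (W * (2 * (e * W)) + Cmod beta * (W * (2 * (e * W)))).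
    * assert (0 <= 2 * (e * W)). { assert (0 <= e * W); [apply Rmult_le_pos; unfold W; lra|lra]. }
      apply Rplus_le_compat.
      -- eapply Rle_trans; [apply B1|]. apply Rmult_le_compat_r; auto. unfold W; lra.
      -- apply Rmult_le_compat_l; auto.
         eapply Rle_trans; [apply B2|]. apply Rmult_le_compat_r; auto. unfold W; lra.
    * right. fold W. unfold e. field. lra.
Qed.

End Goursat.

(** * Cauchy's formula and estimates *)

Definition cexp (z : C) : C := (exp (fst z) * cos (snd z), exp (fst z) * sin (snd z)).
Definition cis (x : R) : C := (cos x, sin x).
Arguments cis x%_R_scope.

Lemma cexp_cis (p q : R) : cexp (p, q) = (exp p * cis q)%C.
Proof. unfold cexp, cis. Ceq. Qed.

Lemma cexp_plus (z w : C) : cexp (z + w) = (cexp z * cexp w)%C.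
Proof.
unfold cexp. simpl. rewrite exp_plus, cos_plus, sin_plus. Ceq.
Qed.

Lemma cexp_0 : cexp 0 = 1.
Proof. unfold cexp. simpl. rewrite exp_0, cos_0, sin_0. Ceq. Qed.

Lemma cis_plus x y : cis (x + y) = (cis x * cis y)%C.
Proof. unfold cis. rewrite cos_plus, sin_plus. Ceq. Qed.

Lemma cis_0 : cis 0 = 1.
Proof. unfold cis. rewrite cos_0, sin_0. auto. Qed.

Lemma Cmod_cis x : Cmod (cis x) = 1.
Proof.
unfold Cmod, cis. simpl. replace (_ + _) with 1; [apply sqrt_1|].
pose proof (sin2_cos2 x). unfold Rsqr in H. lra.
Qed.

Lemma cis_deriv (w t : R) : Rderiv_C (fun t => cis (w * t)) t ((0, w) * cis (w * t))%C.
Proof.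
split; unfold cis; simpl; apply is_derive_Reals; auto_derive; auto; ring.
Qed.

Lemma Cmod_cexp z : Cmod (cexp z) = exp (fst z).
Proof.
destruct z as [p q]. rewrite cexp_cis, Cmod_mult, Cmod_cis, Cmod_R, Rabs_pos_eq; simpl; try ring.
left; apply exp_pos.
Qed.

Lemma cexp_deriv_0 : Chasderiv cexp (RtoC 0) (RtoC 1).
Proof.
(* The cap 1 keeps exp p below 3. The remainder is then at most e (3 |p| + 6 |q|), so the factor 16
   leaves room. *)
intros eps He. set (e := Rmin 1 (eps / 16)).
assert (Pe : 0 < e) by (apply Rmin_pos; lra).
assert (e1 : e <= 1) by apply Rmin_l. assert (e2 : e <= eps / 16) by apply Rmin_r.
destruct (derivable_pt_lim_exp 0 e Pe) as [d1 K1].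
destruct (derivable_pt_lim_cos 0 e Pe) as [d2 K2].
destruct (derivable_pt_lim_sin 0 e Pe) as [d3 K3].
exists (Rmin e (Rmin d1 (Rmin d2 d3))). split.
{ apply Rmin_pos; [exact Pe|]. apply Rmin_pos; [|apply Rmin_pos]; apply cond_pos. }
intros [p q] Hh. change (Cabs (p, q)) with (Cmod (p, q)) in *.
pose proof (fst_le_Cmod (p, q)) as Hp. pose proof (snd_le_Cmod (p, q)) as Hq. simpl in Hp, Hq.
pose proof (Rmin_l e (Rmin d1 (Rmin d2 d3))). pose proof (Rmin_r e (Rmin d1 (Rmin d2 d3))).
pose proof (Rmin_l d1 (Rmin d2 d3)). pose proof (Rmin_r d1 (Rmin d2 d3)).
pose proof (Rmin_l d2 d3). pose proof (Rmin_r d2 d3).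
assert (A1 : Rabs (exp p - 1 - p) <= e * Rabs p).
{ destruct (Req_dec p 0) as [->|N]; [rewrite exp_0, Rabs_R0, Rminus_diag, Rminus_0_l, Ropp_0, Rabs_R0; lra|].
  specialize (K1 p N ltac:(lra)). rewrite Rplus_0_l, exp_0 in K1.
  replace (exp p - 1 - p) with (((exp p - 1) / p - 1) * p) by (field; auto).
  rewrite Rabs_mult. apply Rmult_le_compat_r; [apply Rabs_pos|lra]. }
assert (A2 : Rabs (cos q - 1) <= e * Rabs q).
{ destruct (Req_dec q 0) as [->|N]; [rewrite cos_0, Rabs_R0, Rminus_diag, Rabs_R0; lra|].
  specialize (K2 q N ltac:(lra)). rewrite Rplus_0_l, cos_0, sin_0 in K2.
  replace (cos q - 1) with (((cos q - 1) / q - - 0) * q) by (field; auto).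
  rewrite Rabs_mult. apply Rmult_le_compat_r; [apply Rabs_pos|lra]. }
assert (A3 : Rabs (sin q - q) <= e * Rabs q).
{ destruct (Req_dec q 0) as [->|N]; [rewrite sin_0, Rabs_R0, Rminus_diag, Rabs_R0; lra|].
  specialize (K3 q N ltac:(lra)). rewrite Rplus_0_l, cos_0, sin_0 in K3.
  replace (sin q - q) with (((sin q - 0) / q - 1) * q) by (field; auto).
  rewrite Rabs_mult. apply Rmult_le_compat_r; [apply Rabs_pos|lra]. }
change (Cmod (cexp (0 + (p, q)) - cexp 0 - 1 * (p, q))%C <= eps * Cmod (p, q)).
rewrite cexp_0, Cplus_0_l.
assert (Bp := Rabs_pos p). assert (Bq := Rabs_pos q).
assert (A4 : Rabs (exp p - 1) <= 2 * Rabs p).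
{ replace (exp p - 1) with ((exp p - 1 - p) + p) by ring.
  eapply Rle_trans; [apply Rabs_triang|]. nra. }
assert (A5 : Rabs (exp p) <= 3).
{ replace (exp p) with ((exp p - 1) + 1) by ring.
  eapply Rle_trans; [apply Rabs_triang|]. rewrite Rabs_R1. lra. }
eapply Rle_trans; [apply Cmod_le_fst_snd|].
replace (fst (cexp (p, q) - 1 - 1 * (p, q))%C) with ((exp p - 1 - p) + exp p * (cos q - 1))
  by (simpl; ring).
replace (snd (cexp (p, q) - 1 - 1 * (p, q))%C) with (exp p * (sin q - q) + q * (exp p - 1))
  by (simpl; ring).
assert (B1 : Rabs (exp p - 1 - p + exp p * (cos q - 1)) <= e * Rabs p + 3 * (e * Rabs q)).
{ eapply Rle_trans; [apply Rabs_triang|]. rewrite Rabs_mult.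
  apply Rplus_le_compat; auto. apply Rmult_le_compat; auto; apply Rabs_pos. }
assert (B2 : Rabs (exp p * (sin q - q) + q * (exp p - 1)) <= 3 * (e * Rabs q) + e * (2 * Rabs p)).
{ eapply Rle_trans; [apply Rabs_triang|]. rewrite !Rabs_mult.
  apply Rplus_le_compat; apply Rmult_le_compat; auto; try apply Rabs_pos. lra. }
assert (0 <= Cmod (p, q)) by apply Cmod_ge_0.
apply Rle_trans with (e * (16 * Cmod (p, q))); nra.
Qed.

Lemma cexp_deriv z : Chasderiv cexp z (cexp z).
Proof.
apply (Chasderiv_ext (fun x => cexp z * cexp (- z + x))%C).
{ intros x. rewrite <- cexp_plus. f_equal. ring. }
apply Chasderiv_eq with (cexp z * (1 * (0 + 1)))%C; [|ring].
apply Chasderiv_scal, Chasderiv_comp.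
- replace (- z + z)%C with (RtoC 0) by ring. apply cexp_deriv_0.
- apply Chasderiv_plus; [apply Chasderiv_const|apply Chasderiv_id].
Qed.

Lemma Fdiff_Chasderiv (g : C -> C) (beta : C) (x y : R) L :
  Chasderiv g (x + beta * y)%C L -> Fdiff (fun x y : R => g (x + beta * y)%C) beta x y.
Proof.
intros H. exists L. intros eps He. pose proof (Cmod_ge_0 beta) as Pb.
destruct (H (eps / (1 + Cmod beta))) as (d & Hd & K); [apply Rdiv_lt_0_compat; lra|].
exists (d / (2 * (1 + Cmod beta))). split; [apply Rdiv_lt_0_compat; lra|].
intros x' y' Hx Hy. set (h := ((x' - x)%R + beta * (y' - y)%R)%C).
assert (Hh : Cmod h <= (1 + Cmod beta) * (Rabs (x' - x) + Rabs (y' - y))).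
{ unfold h. eapply Rle_trans; [apply Cmod_triangle|]. rewrite Cmod_mult, !Cmod_R.
  pose proof (Rabs_pos (x' - x)). pose proof (Rabs_pos (y' - y)). nra. }
assert (Hh2 : Cmod h < d).
{ eapply Rle_lt_trans; [apply Hh|].
  apply Rlt_le_trans with ((1 + Cmod beta) * (d / (2 * (1 + Cmod beta)) + d / (2 * (1 + Cmod beta)))).
  - apply Rmult_lt_compat_l; lra.
  - right. field. lra. }
specialize (K h Hh2).
change (Cmod (g (x + beta * y + h) - g (x + beta * y) - L * h)%C <= eps / (1 + Cmod beta) * Cmod h) in K.
replace (x + beta * y + h)%C with (x' + beta * y')%C in K
  by (unfold h; rewrite !RtoC_minus; ring).
eapply Rle_trans; [apply K|].
apply Rle_trans with (eps / (1 + Cmod beta) * ((1 + Cmod beta) * (Rabs (x' - x) + Rabs (y' - y)))).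
- apply Rmult_le_compat_l; auto. left. apply Rdiv_lt_0_compat; lra.
- right. field. lra.
Qed.

Definition period (w : R) := 2 * PI / Rabs w.

Lemma period_pos w : w <> 0 -> 0 < period w.
Proof.
intros H. apply Rdiv_lt_0_compat; [|now apply Rabs_pos_lt]. pose proof PI_RGT_0; lra.
Qed.

Lemma cis_period w t : w <> 0 -> cis (w * (t + period w)) = cis (w * t).
Proof.
intros H. unfold period, cis.
assert (E : w * (t + 2 * PI / Rabs w) = w * t + 2 * PI \/ w * t = w * (t + 2 * PI / Rabs w) + 2 * PI).
{ unfold Rabs. destruct (Rcase_abs w); [right|left]; field; auto. }
destruct E as [E|E].
- rewrite E. f_equal; [rewrite cos_plus, cos_2PI, sin_2PI|rewrite sin_plus, cos_2PI, sin_2PI]; ring.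
- rewrite E. f_equal; [rewrite cos_plus, cos_2PI, sin_2PI|rewrite sin_plus, cos_2PI, sin_2PI]; ring.
Qed.

Lemma cexp_iw (p w t : R) : cexp (p + (0, w) * t)%C = (exp p * cis (w * t))%C.
Proof.
rewrite <- cexp_cis. f_equal. Ceq.
Qed.

(* In the coordinate [z = s * exp (p + i w t)], Goursat's theorem on the rectangle
   [p, 0] x [0, period w] and periodicity in [t] show that the mean over the circle of radius
   [|s| * exp p] does not depend on [p]; then [p] tends to minus infinity. *)
Lemma cauchy_mean u r L (s : C) w : w <> 0 -> Hol r u -> u (RtoC 0) = 0 -> Chasderiv u (RtoC 0) L ->
  Cmod s < r ->
  CInt (fun t => u (s * cis (w * t)) * cis (- (w * t)))%C 0 (period w) = (period w * (s * L))%C.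
Proof.
intros Hw Hu U0 HL Hs. pose proof (period_pos w Hw) as PT. set (T := period w) in *.
destruct (Ceq_dec s 0) as [->|Ns].
{ rewrite (CInt_ext _ (fun _ => 0%C)); try lra.
  - rewrite CInt_const. ring.
  - intros t _. rewrite Cmult_0_l, U0. ring. }
assert (Ps : 0 < Cmod s) by now apply Cmod_gt_0.
set (g := fun z => (u (s * cexp z) * cexp (- z))%C).
set (F := fun (x y : R) => g (x + (0, w) * y)%C).
assert (FE : forall p t : R, F p t = (u (s * (exp p * cis (w * t))) * cexp (- (p + (0, w) * t)))%C).
{ intros p t. unfold F, g. rewrite cexp_iw. reflexivity. }
assert (FD : forall p t, p <= 0 -> Fdiff F (0, w) p t).
{ intros p t Hp. destruct (Hu (s * cexp (p + (0, w) * t))%C) as [L' HL'].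
  - rewrite Cmod_mult, Cmod_cexp. simpl.
    assert (exp (p + (0 * t - w * 0)) <= 1).
    { rewrite <- exp_0. destruct (Rle_lt_or_eq_dec _ _ Hp) as [Q| ->].
      - left; apply exp_increasing. lra.
      - right. f_equal. ring. }
    nra.
  - set (z0 := (p + (0, w) * t)%C) in *.
    apply Fdiff_Chasderiv with ((L' * (s * cexp z0)) * cexp (- z0) + u (s * cexp z0) * (cexp (- z0) * (-(1) * 1)))%C.
    apply (Chasderiv_mult (fun z => u (s * cexp z)%C) (fun z => cexp (- z)%C)).
    + apply (Chasderiv_comp u (fun z => s * cexp z)%C); auto.
      apply Chasderiv_scal, cexp_deriv.
    + apply (Chasderiv_comp cexp (fun z => - z)%C); [apply cexp_deriv|].
      apply (Chasderiv_ext (fun x => - (1) * x)%C); [intros; ring|].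
      apply Chasderiv_scal, Chasderiv_id. }
assert (FC : forall p, p <= 0 -> Ccont_on (fun t => F p t) 0 T).
{ intros p Hp t _. now apply (Fdiff_cont F (0, w)), FD. }
assert (J : forall p, p <= 0 -> CInt (fun t => F 0 t) 0 T = CInt (fun t => F p t) 0 T).
{ intros p Hp.
  assert (G : bdry_int F (0, w) p 0 0 T = 0).
  { apply goursat; try lra. intros x y Hx Hy. apply FD; lra. }
  unfold bdry_int in G.
  (* The sides t = 0 and t = T cancel by periodicity; what remains of Goursat's theorem is the
     equality of the means at p and at 0. *)
  rewrite (CInt_ext (fun x => F x 0 - F x T)%C (fun _ => 0%C)) in G; auto.
  - rewrite CInt_const, CInt_minus in G; auto; try lra; try (apply FC; lra).
    assert (W0 : ((0, w) : C) <> 0). { intros E; apply Hw. now injection E. }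
    assert (Z : forall a x y : C, (a * 0 + (0, w) * (x - y))%C = 0 -> x = y).
    { intros a x y E. replace x with ((a * 0 + (0, w) * (x - y)) / (0, w) + y)%C by (field; auto).
      rewrite E. field; auto. }
    exact (Z _ _ _ G).
  - intros t Ht. unfold F, g.
    replace (-(t + (0, w) * T))%C with (((- t)%R + (0, (- w)%R) * T))%C by Ceq.
    replace (-(t + (0, w) * 0%R))%C with (((- t)%R + (0, (- w)%R) * 0%R))%C by Ceq.
    rewrite !cexp_iw. pose proof (cis_period w 0 Hw) as E1.
    assert (Nw : - w <> 0) by lra.
    pose proof (cis_period (- w) 0 Nw) as E2. unfold period in E2. rewrite Rabs_Ropp in E2.
    change (2 * PI / Rabs w) with T in E2. change (period w) with T in E1.
    rewrite Rplus_0_l in E1, E2. rewrite E1, E2. ring. }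
assert (E0 : CInt (fun t => u (s * cis (w * t)) * cis (- (w * t)))%C 0 T = CInt (fun t => F 0 t) 0 T).
{ apply CInt_ext; try lra. intros t _. rewrite FE, exp_0.
  replace (-(0%R + (0, w) * t))%C with (0%R + (0, (- w)%R) * t)%C by Ceq.
  rewrite cexp_iw, exp_0. rewrite !Cmult_1_l.
  replace (- w * t) with (- (w * t)) by ring. reflexivity. }
rewrite E0.
cut (forall eps, 0 < eps -> Cmod (CInt (fun t => F 0 t) 0 T - T * (s * L)) <= (T * Cmod s) * eps).
{ intros H.
  assert (Z : (CInt (fun t => F 0%R t) 0 T - T * (s * L))%C = 0).
  { apply Cmod_eq_0. apply Rle_antisym; [|apply Cmod_ge_0]. apply le_epsilon. intros eps He.
    assert (0 < T * Cmod s) by now apply Rmult_lt_0_compat.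
    eapply Rle_trans; [apply (H (eps / (T * Cmod s)))|].
    - now apply Rdiv_lt_0_compat.
    - right. field. split; lra. }
  replace (CInt (fun t => F 0 t) 0 T) with
    ((CInt (fun t => F 0%R t) 0 T - T * (s * L)) + T * (s * L))%C by ring.
  rewrite Z. ring. }
intros eps He. destruct (HL eps He) as (d & Hd & K).
(* This brings the radius |s| exp p down to d / 2 at most, inside the disc where the differential at
   0 approximates [u] within eps. The kernel divides by the same rotation and dilation, so the
   relative error eps |z| becomes eps |s|. *)
set (p := Rmin 0 (ln (d / (2 * Cmod s)))).
assert (Hp : p <= 0) by apply Rmin_l.
assert (Hp2 : Cmod s * exp p < d).
{ apply Rle_lt_trans with (Cmod s * (d / (2 * Cmod s))).
  - apply Rmult_le_compat_l; [lra|].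
    rewrite <- (exp_ln (d / (2 * Cmod s))) by (apply Rdiv_lt_0_compat; lra).
    pose proof (Rmin_r 0 (ln (d / (2 * Cmod s)))). fold p in H.
    destruct H as [H|H]; [left; now apply exp_increasing|right; now rewrite H].
  - replace (Cmod s * (d / (2 * Cmod s))) with (d / 2) by (field; lra). lra. }
rewrite (J p Hp).
replace (T * (s * L))%C with (CInt (fun _ => s * L)%C 0 T)
  by (rewrite CInt_const; f_equal; f_equal; ring).
rewrite <- CInt_minus; try lra; [|now apply FC|intros t _; apply Ccont_const].
replace (T * Cmod s * eps) with ((T - 0) * (eps * Cmod s)) by ring.
apply CInt_bound; try lra.
- intros t Ht. apply Ccont_minus; [now apply (FC p Hp)|apply Ccont_const].
- intros t _. rewrite FE.
  set (z := (s * (exp p * cis (w * t)))%C).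
  assert (Mz : Cmod z = Cmod s * exp p).
  { unfold z. rewrite !Cmod_mult, Cmod_cis, Cmod_R, Rabs_pos_eq; [ring|]. left; apply exp_pos. }
  specialize (K z). change (Cmod z < d -> Cmod (u (0 + z) - u 0 - L * z)%C <= eps * Cmod z) in K.
  rewrite Mz, Cplus_0_l, U0 in K. specialize (K Hp2).
  set (k := cexp (- (p + (0, w) * t))).
  assert (Ek : (z * k = s)%C).
  { unfold z, k. rewrite <- cexp_iw. rewrite <- Cmult_assoc, <- cexp_plus.
    replace (p + (0, w) * t + - (p + (0, w) * t))%C with (RtoC 0) by ring. rewrite cexp_0. ring. }
  rewrite <- Ek. replace (u z * k - z * k * L)%C with ((u z - 0 - L * z) * k)%C by ring.
  rewrite !Cmod_mult, Mz.
  apply Rmult_le_compat_r with (r := Cmod k) in K; [|apply Cmod_ge_0]. lra.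
Qed.

Definition Hol_at (a : C) (r : R) (u : C -> C) :=
  forall h, Cmod h < r -> exists L, Chasderiv u (a + h)%C L.

Lemma Hol_Hol_at r d a u : Hol r u -> Cmod a + d <= r -> Hol_at a d u.
Proof.
intros H Hr h Hh. apply H. eapply Rle_lt_trans; [apply Cmod_triangle|]. lra.
Qed.

(** The mean value formula for u - u(a) on the circle of radius r / 2, half the radius because
    everything is known on the open disc only: |L| r / 2 is at most 2 M, whence the factor 4. *)
Lemma cauchy_est u a L r M : 0 < r -> Hol_at a r u ->
  (forall h, Cmod h < r -> Cmod (u (a + h)%C) <= M) -> Chasderiv u a L ->
  Cmod L * r <= 4 * M.
Proof.
intros Hr Hu HM HL.
set (v := fun z => (u (a + z) - u a)%C).
assert (DL : forall z L', Chasderiv u (a + z)%C L' -> Chasderiv v z L').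
{ intros z L' H. unfold v. replace (L' : C) with (L' * (0 + 1) - 0)%C by ring.
  apply Chasderiv_minus; [|apply Chasderiv_const].
  apply (Chasderiv_comp u (fun z => a + z)%C); auto.
  apply Chasderiv_plus; [apply Chasderiv_const|apply Chasderiv_id]. }
assert (Ms : Cmod (RtoC (r / 2)) = r / 2) by (rewrite Cmod_R, Rabs_pos_eq; lra).
assert (Hv : Hol r v).
{ intros z Hz. destruct (Hu z Hz) as [L' HL']. exists L'. now apply DL. }
pose proof (period_pos 1 R1_neq_R0) as PT.
pose proof (cauchy_mean v r L (RtoC (r / 2)) 1 R1_neq_R0 Hv) as H.
rewrite Ms in H.
assert (V0 : v (RtoC 0) = 0) by (unfold v; rewrite Cplus_0_r; ring).
assert (HL0 : Chasderiv v (RtoC 0) L) by (apply DL; rewrite Cplus_0_r; auto).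
specialize (H V0 HL0 ltac:(lra)).
assert (B : Cmod (period 1 * ((r / 2)%R * L))%C <= (period 1 - 0) * (2 * M)).
{ rewrite <- H. 
  assert (Hz : forall t, Cmod ((r / 2)%R * cis (1 * t))%C < r)
    by (intros t; rewrite Cmod_mult, Cmod_cis, Ms; lra).
  apply CInt_bound; try lra.
  - intros t _. apply Ccont_mult.
    + destruct (Hv _ (Hz t)) as [L' HL']. eapply Ccont_comp; [apply HL'|].
      apply Ccont_mult; [apply Ccont_const|]. eapply Rderiv_C_cont, cis_deriv.
    + apply (Rderiv_C_cont _ _ ((0, -1) * cis (-1 * t))%C).
      pose proof (cis_deriv (-1) t) as D.
      destruct D as [D1 D2]; split; unfold cis in *; simpl in *; 
      apply is_derive_Reals; apply is_derive_Reals in D1, D2.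
      * eapply is_derive_ext; [|apply D1]. intros; simpl; f_equal; ring.
      * eapply is_derive_ext; [|apply D2]. intros; simpl; f_equal; ring.
  - intros t _. rewrite Cmod_mult, Cmod_cis, Rmult_1_r. unfold v.
    eapply Rle_trans; [apply Cmod_minus_le|].
    pose proof (HM _ (Hz t)). pose proof (HM 0%C) as H2. rewrite Cmod_0, Cplus_0_r in H2.
    specialize (H2 Hr). lra. }
rewrite !Cmod_mult, Ms, Cmod_R, Rabs_pos_eq in B by lra.
apply Rmult_le_reg_l with (period 1); auto. lra.
Qed.

(* The real mean value theorem is applied to [Re (conj c * u)] on the segment, with [c] the increment. *)
Lemma mvt_C u (a h : C) B :
  (forall t, 0 <= t <= 1 -> exists L, Chasderiv u (a + t * h)%C L /\ Cmod L <= B) ->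
  Cmod (u (a + h) - u a)%C <= B * Cmod h.
Proof.
intros H. set (c := (u (a + h) - u a)%C).
assert (Hg : forall t, Rderiv_C (fun t => a + t * h)%C t h).
{ intros t. apply Rderiv_C_eq with (0 + (1 * h + t * 0))%C; [|ring].
  apply Rderiv_C_plus; [apply Rderiv_C_const|].
  apply (Rderiv_C_mult (fun t => RtoC t) (fun _ => h)); [|apply Rderiv_C_const].
  apply (Rderiv_C_RtoC (fun t => t)), derivable_pt_lim_id. }
assert (HF : forall t, exists L : C, 0 <= t <= 1 ->
   Rderiv_C (fun t => Cconj c * u (a + t * h))%C t (Cconj c * (L * h))%C /\ Cmod L <= B).
{ intros t. destruct (classic (0 <= t <= 1)) as [Ht|Ht].
  - destruct (H t Ht) as (L & H1 & H2). exists L. intros _. split; auto.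
    apply Rderiv_C_scal. apply (Rderiv_C_comp u (fun t => a + t * h)%C); auto.
  - exists 0%C. intros; contradiction. }
apply choice in HF. destruct HF as [L HL].
destruct (MVT_cor2 (fun t => fst (Cconj c * u (a + t * h))%C) (fun t => fst (Cconj c * (L t * h))%C) 0 1)
  as (t & E & Ht).
- lra.
- intros t Ht. now apply HL.
- rewrite Rminus_0_r, Rmult_1_r in E.
  assert (Ec : Cmod c ^ 2 = fst (Cconj c * u (a + 1%R * h))%C - fst (Cconj c * u (a + 0%R * h))%C).
  { rewrite Cmod2_alt, Cmult_0_l, Cmult_1_l, Cplus_0_r. unfold Re, Im.
    replace (u (a + h)%C) with (c + u a)%C by (unfold c; ring). simpl. ring. }
  pose proof (fst_le_Cmod (Cconj c * (L t * h))%C) as K. rewrite <- E, <- Ec, !Cmod_mult, Cmod_conj in K.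
  rewrite Rabs_pos_eq in K by apply pow2_ge_0.
  destruct (HL t ltac:(lra)) as [_ BL].
  pose proof (Cmod_ge_0 c). pose proof (Cmod_ge_0 h).
  assert (K2 : Cmod c * (Cmod c) <= Cmod c * (B * Cmod h)).
  { replace (Cmod c * Cmod c) with (Cmod c ^ 2) by ring. eapply Rle_trans; [apply K|].
    apply Rmult_le_compat_l; auto. apply Rmult_le_compat_r; auto. }
  destruct H0 as [P|P].
  + now apply Rmult_le_reg_l with (Cmod c).
  + rewrite <- P. apply Rmult_le_pos; auto. eapply Rle_trans; [apply Cmod_ge_0|apply BL].
Qed.

Lemma Chasderiv_shift_r u (z k L : C) :
  Chasderiv u (z + k)%C L -> Chasderiv (fun x => u (x + k)%C) z L.
Proof.
intros H. apply Chasderiv_eq with (L * (1 + 0))%C; [|ring].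
apply (Chasderiv_comp u (fun x => x + k)%C); auto.
apply Chasderiv_plus; [apply Chasderiv_id|apply Chasderiv_const].
Qed.

(** * Taylor expansion with uniform remainder *)

Section Taylor.

Variables (u : C -> C) (a : C) (d M : R).
Hypothesis Hd : 0 < d.
Hypothesis Hu : Hol_at a (3 * d) u.
Hypothesis HM : forall h, Cmod h < 3 * d -> Cmod (u (a + h)%C) <= M.

(** The radius 3 d is used up in layers of width d: one for Cauchy's estimate here, one for an
    increment [k], and one for Cauchy's estimate on the increment function in [deriv_lipschitz]. *)
Lemma deriv_bound k L : Cmod k < 2 * d -> Chasderiv u (a + k)%C L -> Cmod L <= 4 * M / d.
Proof.
intros Hk HL. apply Rmult_le_reg_r with d; auto.
replace (4 * M / d * d) with (4 * M) by (field; lra).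
apply cauchy_est with u (a + k)%C; auto.
- intros h Hh. rewrite <- Cplus_assoc. apply Hu.
  eapply Rle_lt_trans; [apply Cmod_triangle|]. lra.
- intros h Hh. rewrite <- Cplus_assoc. apply HM.
  eapply Rle_lt_trans; [apply Cmod_triangle|]. lra.
Qed.

Lemma lipschitz_of_bound k h : Cmod k < d -> Cmod h < d ->
  Cmod (u (a + h + k) - u (a + h))%C <= 4 * M / d * Cmod k.
Proof.
intros Hk Hh. apply mvt_C. intros t Ht.
assert (B : Cmod (h + t * k)%C < 2 * d).
{ eapply Rle_lt_trans; [apply Cmod_triangle|]. rewrite Cmod_mult, Cmod_R, Rabs_pos_eq; [|lra].
  pose proof (Cmod_ge_0 k). nra. }
rewrite <- Cplus_assoc.
destruct (Hu (h + t * k)%C) as [L HL]; [lra|].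
exists L; split; auto. apply deriv_bound with (h + t * k)%C; auto.
Qed.

(** L1 - L0 is the derivative at [a] of u(z + k) - u(z), which is O(|k|) by [lipschitz_of_bound], so
    Cauchy's estimate replaces a bound on a second derivative. The constant 16 is 4 times 4. *)
Lemma deriv_lipschitz k L0 L1 : Cmod k < d ->
  Chasderiv u a L0 -> Chasderiv u (a + k)%C L1 ->
  Cmod (L1 - L0)%C <= 16 * M / d ^ 2 * Cmod k.
Proof.
intros Hk H0 H1. apply Rmult_le_reg_r with d; auto.
replace (16 * M / d ^ 2 * Cmod k * d) with (4 * (4 * M / d * Cmod k)) by (field; lra).
apply cauchy_est with (fun z => u (z + k) - u z)%C a; auto.
- intros h Hh. destruct (Hu h) as [l Hl]; [lra|].
  destruct (Hu (h + k)%C) as [l' Hl'].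
  { eapply Rle_lt_trans; [apply Cmod_triangle|]. lra. }
  exists (l' - l)%C. apply Chasderiv_minus; auto. apply (Chasderiv_shift_r u).
  rewrite <- Cplus_assoc. auto.
- intros h Hh. now apply lipschitz_of_bound.
- apply Chasderiv_minus; auto. now apply Chasderiv_shift_r.
Qed.

(** The mean value inequality for u(z) - L z: its derivative vanishes at [a] and grows at most
    linearly from there. *)
Lemma taylor2 h L : Cmod h < d -> Chasderiv u a L ->
  Cmod (u (a + h) - u a - L * h)%C <= 16 * M / d ^ 2 * Cmod h ^ 2.
Proof.
intros Hh HL.
replace (u (a + h) - u a - L * h)%C with ((u (a + h) - L * (a + h)) - (u a - L * a))%C
  by (apply injective_projections; simpl; ring).
replace (16 * M / d ^ 2 * Cmod h ^ 2) with (16 * M / d ^ 2 * Cmod h * Cmod h) by ring.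
apply (mvt_C (fun z => u z - L * z)%C). intros t Ht.
assert (B : Cmod (t * h)%C <= Cmod h).
{ rewrite Cmod_mult, Cmod_R, Rabs_pos_eq; [|lra]. pose proof (Cmod_ge_0 h). nra. }
destruct (Hu (t * h)%C) as [l Hl]; [lra|].
exists (l - L)%C. split.
- apply Chasderiv_minus; auto. apply Chasderiv_eq with (L * 1)%C; [|ring].
  apply Chasderiv_scal, Chasderiv_id.
- eapply Rle_trans; [apply (deriv_lipschitz (t * h)%C); auto; lra|].
  apply Rmult_le_compat_l; auto.
  assert (0 <= M). { eapply Rle_trans; [apply Cmod_ge_0|apply (HM 0%C)]. rewrite Cmod_0. lra. }
  apply Rmult_le_pos; [lra|]. left. apply Rinv_0_lt_compat. apply pow_lt; auto.
Qed.

End Taylor.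

(* Complex differentiability with quadratic remainder, phrased without mentioning the derivative:
   in this form it passes to pointwise limits and to averages. *)
Definition three_point (K d : R) (a : C) (u : C -> C) := forall h h', Cmod h < d -> Cmod h' < d ->
  Cmod ((u (a + h) - u a) * h' - (u (a + h') - u a) * h)%C
   <= K * (Cmod h * Cmod h' * (Cmod h + Cmod h')).

Lemma three_point_of_Hol u r a d M : Hol r u -> (forall z, Cmod z < r -> Cmod (u z) <= M) ->
  0 < d -> Cmod a + 3 * d <= r -> three_point (16 * M / d ^ 2) d a u.
Proof.
intros Hu HM Hd Ha h h' Hh Hh'.
assert (Hu' : Hol_at a (3 * d) u) by now apply Hol_Hol_at with r.
assert (HM' : forall h, Cmod h < 3 * d -> Cmod (u (a + h)%C) <= M).
{ intros k Hk. apply HM. eapply Rle_lt_trans; [apply Cmod_triangle|]. lra. }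
destruct (Hu a ltac:(lra)) as [L HL].
pose proof (taylor2 u a d M Hd Hu' HM' h L Hh HL) as T1.
pose proof (taylor2 u a d M Hd Hu' HM' h' L Hh' HL) as T2.
replace ((u (a + h) - u a) * h' - (u (a + h') - u a) * h)%C with
 ((u (a + h) - u a - L * h) * h' - (u (a + h') - u a - L * h') * h)%C
  by (apply injective_projections; simpl; ring).
eapply Rle_trans; [apply Cmod_minus_le|]. rewrite !Cmod_mult.
apply Rmult_le_compat_r with (r := Cmod h') in T1; [|apply Cmod_ge_0].
apply Rmult_le_compat_r with (r := Cmod h) in T2; [|apply Cmod_ge_0].
nra.
Qed.

(** * Holomorphy of limits *)

Lemma geometric_limit (c : nat -> C) D :
  (forall n, Cmod (c (S n) - c n) <= D / 2 ^ n) ->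
  exists l : C, forall n, Cmod (c n - l) <= 4 * D / 2 ^ n.
Proof.
intros H.
assert (P : forall n, 0 < 2 ^ n) by (intros; apply pow_lt; lra).
assert (E : forall n, 2 * D / 2 ^ n = 2 * (2 * D / 2 ^ S n)).
{ intros n; specialize (P n). simpl. field. lra. }
assert (E' : forall n, D / 2 ^ n = 2 * D / 2 ^ S n).
{ intros n; specialize (P n). simpl. field. lra. }
assert (PD : forall n, 0 <= 2 * D / 2 ^ n).
{ intros n. specialize (H n). pose proof (Cmod_ge_0 (c (S n) - c n)).
  replace (2 * D / 2 ^ n) with (2 * (D / 2 ^ n)) by (unfold Rdiv; ring). lra. }
(* The radius 2 D / 2 ^ n is the sum of all later steps, which makes the intervals nested; the two
   coordinates together give the factor 4. *)
assert (K : forall x : nat -> R, (forall n, Rabs (x (S n) - x n) <= D / 2 ^ n) ->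
   exists l, forall n, x n - 2 * D / 2 ^ n <= l <= x n + 2 * D / 2 ^ n).
{ intros x Hx. apply nested_intervals; intros n; specialize (Hx n);
  apply Rabs_le_between in Hx; rewrite E' in Hx; specialize (E n); specialize (PD n); lra. }
destruct (K (fun n => fst (c n))) as [l1 H1].
{ intros n. eapply Rle_trans; [|apply (H n)]. apply (fst_le_Cmod (c (S n) - c n)). }
destruct (K (fun n => snd (c n))) as [l2 H2].
{ intros n. eapply Rle_trans; [|apply (H n)]. apply (snd_le_Cmod (c (S n) - c n)). }
exists (l1, l2). intros n. eapply Rle_trans; [apply Cmod_le_fst_snd|]. simpl.
specialize (H1 n). specialize (H2 n).
replace (4 * D / 2 ^ n) with (2 * D / 2 ^ n + 2 * D / 2 ^ n) by (unfold Rdiv; ring).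
apply Rplus_le_compat; apply Rabs_le; lra.
Qed.

(** Divided by h h', the three-point inequality bounds the difference of two difference quotients by
    K (|h| + |h'|). Along the real increments d / 2 ^ (n + 1) the quotients are therefore Cauchy;
    comparing an arbitrary complex [h] with these increments shows that their limit is the
    derivative in every direction. *)
Lemma deriv_of_three_point K d a u : 0 < d -> three_point K d a u -> exists L, Chasderiv u a L.
Proof.
intros Hd H.
set (e := fun n => d / 2 / 2 ^ n).
assert (P : forall n, 0 < 2 ^ n) by (intros; apply pow_lt; lra).
assert (Pe : forall n, 0 < e n) by (intros; apply Rdiv_lt_0_compat; auto; lra).
assert (P1 : forall n, 1 <= 2 ^ n).
{ intros n; induction n; simpl; [lra|]. specialize (P n). lra. }
assert (Be : forall n, e n < d).
{ intros n. unfold e. apply Rmult_lt_reg_r with (2 ^ n); auto.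
  replace (d / 2 / 2 ^ n * 2 ^ n) with (d / 2) by (field; specialize (P n); lra).
  specialize (P1 n). nra. }
assert (Me : forall n, Cmod (e n) = e n) by (intros n; rewrite Cmod_R, Rabs_pos_eq; auto; left; auto).
assert (Ne : forall n, RtoC (e n) <> 0).
{ intros n. apply Cmod_gt_0. rewrite Me. auto. }
assert (PK : 0 <= K).
{ specialize (H (RtoC (e 0%nat)) (RtoC (e 0%nat))). rewrite !Me in H. specialize (H (Be _) (Be _)).
  pose proof (Cmod_ge_0 ((u (a + e 0%nat) - u a) * e 0%nat - (u (a + e 0%nat) - u a) * e 0%nat)%C).
  specialize (Pe 0%nat). assert (Q : 0 < e 0%nat * e 0%nat * (e 0%nat + e 0%nat)).
  { repeat apply Rmult_lt_0_compat; lra. }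
  nra. }
set (q := fun n => ((u (a + e n) - u a) / e n)%C).
destruct (geometric_limit q (K * d)) as [L HL].
{ intros n.
  assert (E : (q (S n) - q n)%C = (((u (a + e (S n)) - u a) * e n - (u (a + e n) - u a) * e (S n)) / (e n * e (S n)))%C).
  { unfold q. field. split; apply Ne. }
  rewrite E, Cmod_div; [|apply Cmult_neq_0; apply Ne].
  specialize (H (RtoC (e (S n))) (RtoC (e n))). rewrite !Me in H. specialize (H (Be _) (Be _)).
  rewrite Cmod_mult, !Me.
  apply Rmult_le_reg_r with (e n * e (S n)); [apply Rmult_lt_0_compat; auto|].
  unfold Rdiv at 1. rewrite Rmult_assoc, Rinv_l, Rmult_1_r.
  - eapply Rle_trans; [apply H|].
    replace (K * (e (S n) * e n * (e (S n) + e n))) with (K * (e n * e (S n)) * (e (S n) + e n)) by ring.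
    replace (K * d / 2 ^ n * (e n * e (S n))) with (K * (e n * e (S n)) * (d / 2 ^ n)) by (unfold Rdiv; ring).
    apply Rmult_le_compat_l.
    + apply Rmult_le_pos; auto. left; apply Rmult_lt_0_compat; auto.
    + unfold e. simpl. specialize (P n).
      replace (d / 2 / (2 * 2 ^ n)) with (d / 2 ^ n / 4) by (field; lra).
      replace (d / 2 / 2 ^ n) with (d / 2 ^ n / 2) by (field; lra).
      assert (0 < d / 2 ^ n) by (apply Rdiv_lt_0_compat; lra). lra.
  - specialize (Pe n) as A. specialize (Pe (S n)) as B. nra. }
exists L.
assert (T : forall h, Cmod h < d -> Cmod (u (a + h) - u a - L * h)%C <= K * Cmod h ^ 2).
{ intros h Hh. apply le_epsilon. intros eps He.
  pose proof (Cmod_ge_0 h) as Ph.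
  set (A := (K * Cmod h) * d + (4 * (K * d)) * Cmod h).
  destruct (pow_half_small A eps He) as [n Hn].
  assert (B : Cmod (u (a + h) - u a - q n * h)%C <= K * Cmod h * (Cmod h + e n)).
  { specialize (H h (RtoC (e n)) Hh). rewrite Me in H. specialize (H (Be n)).
    apply Rmult_le_reg_r with (e n); auto. rewrite <- (Me n) at 1. rewrite <- Cmod_mult.
    replace ((u (a + h) - u a - q n * h) * e n)%C with ((u (a + h) - u a) * e n - (u (a + e n) - u a) * h)%C
      by (unfold q; field; apply Ne).
    eapply Rle_trans; [apply H|]. right; ring. }
  replace (u (a + h) - u a - L * h)%C with ((u (a + h) - u a - q n * h) + (q n - L) * h)%C
    by (apply injective_projections; simpl; ring).
  eapply Rle_trans; [apply Cmod_triangle|]. rewrite Cmod_mult.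
  specialize (HL n). apply Rmult_le_compat_r with (r := Cmod h) in HL; auto.
  assert (E1 : K * Cmod h * e n <= K * Cmod h * d / 2 ^ n).
  { unfold Rdiv. rewrite (Rmult_assoc (K * Cmod h)). apply Rmult_le_compat_l; [now apply Rmult_le_pos|].
    unfold e. replace (d / 2 / 2 ^ n) with (d * / 2 ^ n / 2) by (field; specialize (P n); lra).
    assert (0 < d * / 2 ^ n) by (apply Rdiv_lt_0_compat; auto). lra. }
  replace (A / 2 ^ n) with (K * Cmod h * d / 2 ^ n + 4 * (K * d) / 2 ^ n * Cmod h) in Hn
    by (unfold A; field; specialize (P n); lra).
  lra. }
intros eps He. exists (Rmin d (eps / (K + 1))). split.
{ apply Rmin_pos; auto. apply Rdiv_lt_0_compat; lra. }
intros h Hh. change (Cabs h) with (Cmod h) in *.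
change (Cmod (u (a + h) - u a - L * h)%C <= eps * Cmod h).
eapply Rle_trans; [apply T; eapply Rlt_le_trans; [apply Hh|apply Rmin_l]|].
assert (Hh2 : Cmod h <= eps / (K + 1)).
{ left. eapply Rlt_le_trans; [apply Hh|apply Rmin_r]. }
pose proof (Cmod_ge_0 h) as Ph.
assert (Q : (K + 1) * Cmod h <= eps).
{ apply Rmult_le_compat_l with (r := K + 1) in Hh2; [|lra].
  replace ((K + 1) * (eps / (K + 1))) with eps in Hh2 by (field; lra). auto. }
nra.
Qed.

(** Pointwise convergence suffices because the common bound [M] gives all the [u n] the same
    three-point constant. *)
Lemma Hol_limit r M (u : nat -> C -> C) v :
  (forall n, Hol r (u n)) -> (forall n z, Cmod z < r -> Cmod (u n z) <= M) ->
  (forall z, Cmod z < r -> forall eps, 0 < eps -> exists n, Cmod (u n z - v z)%C < eps /\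
     forall m, (n <= m)%nat -> Cmod (u m z - v z)%C < eps) ->
  Hol r v.
Proof.
intros Hu HM Hv a Ha.
set (d := (r - Cmod a) / 3).
assert (Hd : 0 < d) by (unfold d; lra).
apply deriv_of_three_point with (16 * M / d ^ 2) d; auto.
intros h h' Hh Hh'. apply le_epsilon. intros eps He.
pose proof (Cmod_ge_0 h) as Ph. pose proof (Cmod_ge_0 h') as Ph'.
set (e := eps / (2 * (Cmod h + Cmod h' + 1))).
assert (Pe : 0 < e) by (apply Rdiv_lt_0_compat; lra).
assert (D : forall k, Cmod k < d -> Cmod (a + k)%C < r).
{ intros k Hk. eapply Rle_lt_trans; [apply Cmod_triangle|]. unfold d in *. lra. }
destruct (Hv a Ha e Pe) as (n1 & _ & K1).
destruct (Hv (a + h)%C (D h Hh) e Pe) as (n2 & _ & K2).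
destruct (Hv (a + h')%C (D h' Hh') e Pe) as (n3 & _ & K3).
set (n := (n1 + n2 + n3)%nat).
specialize (K1 n ltac:(unfold n; lia)). specialize (K2 n ltac:(unfold n; lia)).
specialize (K3 n ltac:(unfold n; lia)).
pose proof (three_point_of_Hol (u n) r a d M (Hu n) (HM n) Hd ltac:(unfold d; lra) h h' Hh Hh') as T.
set (w := fun z => (u n z - v z)%C) in *.
replace ((v (a + h) - v a) * h' - (v (a + h') - v a) * h)%C with
 (((u n (a + h) - u n a) * h' - (u n (a + h') - u n a) * h) -
   ((w (a + h) - w a) * h' - (w (a + h') - w a) * h))%C
   by (unfold w; apply injective_projections; simpl; ring).
eapply Rle_trans; [apply Cmod_minus_le|].
apply Rplus_le_compat; [exact T|].
eapply Rle_trans; [apply Cmod_minus_le|]. rewrite !Cmod_mult.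
assert (B1 : Cmod (w (a + h) - w a)%C <= 2 * e).
{ eapply Rle_trans; [apply Cmod_minus_le|]. unfold w. lra. }
assert (B2 : Cmod (w (a + h') - w a)%C <= 2 * e).
{ eapply Rle_trans; [apply Cmod_minus_le|]. unfold w. lra. }
apply Rle_trans with (2 * e * Cmod h' + 2 * e * Cmod h).
- apply Rplus_le_compat; apply Rmult_le_compat_r; auto.
- replace eps with (2 * e * (Cmod h + Cmod h' + 1)) by (unfold e; field; lra). nra.
Qed.

Lemma Cmod_mult_cis_lt r z w t : Cmod z < r -> Cmod (z * cis (w * t))%C < r.
Proof. intros H. now rewrite Cmod_mult, Cmod_cis, Rmult_1_r. Qed.

Lemma Ccont_circle r u s w t : Hol r u -> Cmod s < r -> Ccont (fun t => u (s * cis (w * t))%C) t.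
Proof.
intros Hu Hs. destruct (Hu (s * cis (w * t))%C) as [L HL]; [now apply Cmod_mult_cis_lt|].
apply Ccont_comp with L; auto. apply Ccont_mult; [apply Ccont_const|].
eapply Rderiv_C_cont, cis_deriv.
Qed.

(** * Averages over the circle action *)

Definition average (w : R) (k : R -> C) (G : C -> C) (s : C) : C :=
  CInt (fun t => k t * G (s * cis (w * t)))%C 0 (period w).

Section Average.

Variables (w : R) (k : R -> C) (B : R).
Hypothesis Hw : w <> 0.
Hypothesis k_cont : forall t, Ccont k t.
Hypothesis k_bound : forall t, 0 <= t <= period w -> Cmod (k t) <= B.

Lemma average_cont r G s : Hol r G -> Cmod s < r ->
  Ccont_on (fun t => k t * G (s * cis (w * t)))%C 0 (period w).
Proof. intros HG Hs t _. apply Ccont_mult; auto. now apply Ccont_circle with r. Qed.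

Lemma average_bound r G s M : Hol r G -> Cmod s < r ->
  (forall z, Cmod z = Cmod s -> Cmod (G z) <= M) ->
  Cmod (average w k G s) <= period w * (B * M).
Proof.
intros HG Hs HM. pose proof (period_pos w Hw) as PT.
rewrite <- (Rminus_0_r (period w)). apply CInt_bound; try lra.
- now apply average_cont with r.
- intros t Ht. rewrite Cmod_mult.
  apply Rmult_le_compat; try apply Cmod_ge_0; auto.
  apply HM. rewrite Cmod_mult, Cmod_cis. ring.
Qed.

Lemma average_minus r G1 G2 s : Hol r G1 -> Hol r G2 -> Cmod s < r ->
  (average w k G1 s - average w k G2 s)%C = average w k (fun z => G1 z - G2 z)%C s.
Proof.
intros H1 H2 Hs. pose proof (period_pos w Hw) as PT. unfold average.
rewrite <- CInt_minus; try lra; try now apply average_cont with r.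
apply CInt_ext; try lra. intros; ring.
Qed.

(** The three-point inequality for [G] holds with one constant at all points of the circle through
    [a] and can be integrated against [k], so no differentiation under the integral sign is
    required. *)
Lemma Hol_average r G M : Hol r G -> (forall z, Cmod z < r -> Cmod (G z) <= M) ->
  Hol r (average w k G).
Proof.
intros HG HM a Ha. pose proof (period_pos w Hw) as PT.
set (d := (r - Cmod a) / 3).
assert (Hd : 0 < d) by (unfold d; lra).
apply deriv_of_three_point with (period w * (B * (16 * M / d ^ 2))) d; auto.
intros h h' Hh Hh'.
assert (D : forall k, Cmod k < d -> Cmod (a + k)%C < r).
{ intros x Hx. eapply Rle_lt_trans; [apply Cmod_triangle|]. unfold d in *. lra. }
set (c := fun x t => (k t * G (x * cis (w * t)))%C).
assert (Cc : forall x, Cmod x < r -> Ccont_on (c x) 0 (period w)).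
{ intros x Hx. now apply average_cont with r. }
assert (E : ((average w k G (a + h) - average w k G a) * h' - (average w k G (a + h') - average w k G a) * h)%C
  = CInt (fun t => h' * (c (a + h)%C t - c a t) - h * (c (a + h')%C t - c a t))%C 0 (period w)).
{ assert (Cd : forall x, Cmod x < d -> Ccont_on (fun t => c (a + x)%C t - c a t)%C 0 (period w)).
  { intros x Hx t Ht. apply Ccont_minus; apply Cc; auto. }
  rewrite CInt_minus; try lra.
  2,3: intros t Ht; apply Ccont_mult; [apply Ccont_const|apply Cd; auto].
  rewrite !CInt_scal; try lra; try (apply Cd; auto).
  rewrite !CInt_minus; try lra; try (apply Cc; auto).
  unfold average. fold c. fold (c a). fold (c (a + h)%C). fold (c (a + h')%C). ring. }
rewrite E.
replace (period w * (B * (16 * M / d ^ 2)) * (Cmod h * Cmod h' * (Cmod h + Cmod h'))) with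
  ((period w - 0) * (B * (16 * M / d ^ 2 * (Cmod h * Cmod h' * (Cmod h + Cmod h'))))) by ring.
apply CInt_bound; try lra.
- intros t Ht. apply Ccont_minus; apply Ccont_mult; try apply Ccont_const; apply Ccont_minus; apply Cc; auto.
- intros t Ht. unfold c. set (z := cis (w * t)).
  assert (Mz : Cmod z = 1) by apply Cmod_cis.
  assert (TPG : three_point (16 * M / d ^ 2) d (a * z)%C G).
  { apply three_point_of_Hol with r; auto. rewrite Cmod_mult, Mz. unfold d; lra. }
  specialize (TPG (h * z)%C (h' * z)%C). rewrite !Cmod_mult, Mz, !Rmult_1_r in TPG.
  specialize (TPG Hh Hh').
  replace (h' * (k t * G ((a + h) * z) - k t * G (a * z)) - h * (k t * G ((a + h') * z) - k t * G (a * z)))%C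
   with (k t * (h' * (G (a * z + h * z) - G (a * z)) - h * (G (a * z + h' * z) - G (a * z))))%C.
  2:{ replace ((a + h) * z)%C with (a * z + h * z)%C by ring.
      replace ((a + h') * z)%C with (a * z + h' * z)%C by ring. ring. }
  rewrite Cmod_mult. apply Rmult_le_compat; try apply Cmod_ge_0; auto.
  (* The rotation multiplies both increments by z, so the inequality for [G] carries one extra
     factor z, of modulus 1. *)
  rewrite <- (Rmult_1_r (Cmod (_ - _))), <- Mz, <- Cmod_mult.
  eapply Rle_trans; [|apply TPG]. right. f_equal. ring.
Qed.

End Average.

(** * Separately holomorphic functions vanishing to order two *)

Definition C3 : Type := (C * C * C)%type.
Definition p1 (p : C3) : C := fst (fst p).
Definition p2 (p : C3) : C := snd (fst p).
Definition p3 (p : C3) : C := snd p.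
Definition N3 (p : C3) : R := Cmod (p1 p) + Cmod (p2 p) + Cmod (p3 p).
Definition sub3 (p q : C3) : C3 := (p1 p - p1 q, p2 p - p2 q, p3 p - p3 q)%C.
Definition dot3 (p q : C3) : C := (p1 p * p1 q + p2 p * p2 q + p3 p * p3 q)%C.
Definition app3 (F : C -> C -> C -> C) (p : C3) : C := F (p1 p) (p2 p) (p3 p).

Lemma N3_ge0 p : 0 <= N3 p.
Proof.
unfold N3. pose proof (Cmod_ge_0 (p1 p)). pose proof (Cmod_ge_0 (p2 p)).
pose proof (Cmod_ge_0 (p3 p)). lra.
Qed.

Lemma N3_sub_le p q : N3 (sub3 p q) <= N3 p + N3 q.
Proof.
unfold N3, sub3, p1, p2, p3; simpl.
pose proof (Cmod_minus_le (fst (fst p)) (fst (fst q))).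
pose proof (Cmod_minus_le (snd (fst p)) (snd (fst q))).
pose proof (Cmod_minus_le (snd p) (snd q)). lra.
Qed.

Lemma N3_triangle p q : N3 p <= N3 q + N3 (sub3 p q).
Proof.
unfold N3, sub3, p1, p2, p3; simpl.
pose proof (Cmod_triangle_rev (fst (fst p)) (fst (fst q))).
pose proof (Cmod_triangle_rev (snd (fst p)) (snd (fst q))).
pose proof (Cmod_triangle_rev (snd p) (snd q)). lra.
Qed.

Lemma N3_sub_sym p q : N3 (sub3 p q) = N3 (sub3 q p).
Proof.
unfold N3, sub3, p1, p2, p3; simpl.
rewrite (Cmod_minus_sym (fst (fst p))), (Cmod_minus_sym (snd (fst p))), (Cmod_minus_sym (snd p)).
auto.
Qed.

Lemma dot3_le L v : Cmod (dot3 L v) <= N3 L * N3 v.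
Proof.
unfold dot3, N3.
eapply Rle_trans; [apply Cmod_triangle|].
eapply Rle_trans; [apply Rplus_le_compat_r, Cmod_triangle|].
rewrite !Cmod_mult.
pose proof (Cmod_ge_0 (p1 L)). pose proof (Cmod_ge_0 (p2 L)). pose proof (Cmod_ge_0 (p3 L)).
pose proof (Cmod_ge_0 (p1 v)). pose proof (Cmod_ge_0 (p2 v)). pose proof (Cmod_ge_0 (p3 v)).
nra.
Qed.

(* First-order Taylor expansion at every point, with a uniform quadratic remainder and a
   differential of size O(|p|). *)
Definition quadratic_germ (d K : R) (F : C -> C -> C -> C) : Prop :=
  0 < d /\ 0 <= K /\ F (RtoC 0) (RtoC 0) (RtoC 0) = 0 /\
  forall p, N3 p < d -> exists L, N3 L <= K * N3 p /\
    forall q, N3 q < d ->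
      Cmod (app3 F q - app3 F p - dot3 L (sub3 q p))%C <= K * N3 (sub3 q p) ^ 2.

(** The bound 1 comes from continuity at 0 with [eps := 1]. The condition is symmetric in the
    variables, so estimates proved for the first variable transfer to the others by swapping. *)
Definition SepBounded (D : R) (F : C -> C -> C -> C) :=
  forall x y z, Cmod x < D -> Cmod y < D -> Cmod z < D ->
    Cmod (F x y z) <= 1 /\
    (exists L, Chasderiv (fun t => F t y z) x L) /\
    (exists L, Chasderiv (fun t => F x t z) y L) /\
    (exists L, Chasderiv (fun t => F x y t) z L).

Lemma SepBounded_swap12 D F : SepBounded D F -> SepBounded D (fun y x z => F x y z).
Proof. intros H y x z Hy Hx Hz. destruct (H x y z) as (? & ? & ? & ?); auto. Qed.

Lemma SepBounded_swap13 D F : SepBounded D F -> SepBounded D (fun z y x => F x y z).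
Proof. intros H z y x Hz Hy Hx. destruct (H x y z) as (? & ? & ? & ?); auto. Qed.

Section Separate.

Variables (e : R).
Hypothesis He : 0 < e.

Lemma sep_Hol_at F x y z : SepBounded (6 * e) F ->
  Cmod x <= 3 * e -> Cmod y < 6 * e -> Cmod z < 6 * e ->
  Hol_at x (3 * e) (fun t => F t y z) /\
  (forall h, Cmod h < 3 * e -> Cmod (F (x + h)%C y z) <= 1).
Proof.
intros HF Hx Hy Hz.
split; intros h Hh; destruct (HF (x + h)%C y z) as (? & ? & ? & ?); auto;
(eapply Rle_lt_trans; [apply Cmod_triangle|]; lra).
Qed.

Lemma sep_taylor F x y z L h : SepBounded (6 * e) F ->
  Cmod x <= 3 * e -> Cmod y < 6 * e -> Cmod z < 6 * e -> Cmod h < e ->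
  Chasderiv (fun t => F t y z) x L ->
  Cmod (F (x + h)%C y z - F x y z - L * h)%C <= 16 / e ^ 2 * Cmod h ^ 2.
Proof.
intros HF Hx Hy Hz Hh HL.
destruct (sep_Hol_at F x y z HF Hx Hy Hz) as [H1 H2].
replace 16 with (16 * 1) by ring.
now apply (taylor2 (fun t => F t y z)).
Qed.

Lemma sep_lip F x x' y z : SepBounded (6 * e) F ->
  Cmod x < e -> Cmod x' < e -> Cmod y < 6 * e -> Cmod z < 6 * e ->
  Cmod (F x' y z - F x y z)%C <= 4 / e * Cmod (x' - x).
Proof.
intros HF Hx Hx' Hy Hz.
assert (H0 : Cmod 0 <= 3 * e) by (rewrite Cmod_0; lra).
destruct (sep_Hol_at F 0 y z HF H0 Hy Hz) as [H1 H2].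
replace x' with (x + (x' - x))%C at 1 by ring.
apply (mvt_C (fun t => F t y z)). intros t Ht.
assert (B : Cmod (x + t * (x' - x))%C < 2 * e).
{ replace (x + t * (x' - x))%C with ((1 - t)%R * x + t * x')%C by (rewrite RtoC_minus; ring).
  eapply Rle_lt_trans; [apply Cmod_triangle|]. rewrite !Cmod_mult, !Cmod_R, !Rabs_pos_eq by lra.
  pose proof (Cmod_ge_0 x). pose proof (Cmod_ge_0 x'). nra. }
destruct (HF (x + t * (x' - x))%C y z) as (_ & (L & HL) & _); auto; [lra|].
exists L. split; auto. replace 4 with (4 * 1) by ring.
apply (deriv_bound (fun t => F t y z) 0 e 1 He H1 H2 (x + t * (x' - x))%C); auto.
rewrite Cplus_0_l. auto.
Qed.

(** The dependence on the other two variables is Cauchy's estimate applied in the first variable to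
    F(t, y', z') - F(t, y, z), which is small by [sep_lip] in the swapped variables. *)
Lemma sep_deriv_lip F x y z x' y' z' L L' : SepBounded (6 * e) F ->
  Cmod x < e / 2 -> Cmod y < e / 2 -> Cmod z < e / 2 ->
  Cmod x' < e / 2 -> Cmod y' < e / 2 -> Cmod z' < e / 2 ->
  Chasderiv (fun t => F t y z) x L -> Chasderiv (fun t => F t y' z') x' L' ->
  Cmod (L' - L)%C <= 16 / e ^ 2 * (Cmod (x' - x) + Cmod (y' - y) + Cmod (z' - z)).
Proof.
intros HF Hx Hy Hz Hx' Hy' Hz' HL HL'.
destruct (HF x' y z) as (_ & (L0 & H0) & _); try lra.
replace (L' - L)%C with ((L' - L0) + (L0 - L))%C by (apply injective_projections; simpl; ring).
assert (B1 : Cmod (L0 - L)%C <= 16 / e ^ 2 * Cmod (x' - x)).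
{ destruct (sep_Hol_at F x y z HF) as [H1 H2]; try lra.
  replace 16 with (16 * 1) by ring.
  apply (deriv_lipschitz (fun t => F t y z) x e 1 He H1 H2); auto.
  - eapply Rle_lt_trans; [apply Cmod_minus_le|]. lra.
  - replace (x + (x' - x))%C with x' by ring. auto. }
assert (B2 : Cmod (L' - L0)%C <= 16 / e ^ 2 * (Cmod (y' - y) + Cmod (z' - z))).
{ destruct (sep_Hol_at F x' y z HF) as [H1 H2]; try lra.
  destruct (sep_Hol_at F x' y' z' HF) as [H3 H4]; try lra.
  apply Rmult_le_reg_r with e; [lra|].
  replace (16 / e ^ 2 * (Cmod (y' - y) + Cmod (z' - z)) * e) with
    (4 * (4 / e * (Cmod (y' - y) + Cmod (z' - z)))) by (field; lra).
  apply (cauchy_est (fun t => F t y' z' - F t y z)%C x'); auto.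
  - intros h Hh. destruct (H1 h) as [l1 Hl1]; [lra|]. destruct (H3 h) as [l2 Hl2]; [lra|].
    exists (l2 - l1)%C. now apply Chasderiv_minus.
  - intros h Hh. set (w := (x' + h)%C).
    assert (Hw : Cmod w < 6 * e).
    { unfold w. eapply Rle_lt_trans; [apply Cmod_triangle|]. lra. }
    replace (F w y' z' - F w y z)%C with ((F w y' z' - F w y z') + (F w y z' - F w y z))%C by ring.
    eapply Rle_trans; [apply Cmod_triangle|]. rewrite Rmult_plus_distr_l.
    apply Rplus_le_compat.
    + apply (sep_lip (fun y x z => F x y z)); try lra. now apply SepBounded_swap12.
    + apply (sep_lip (fun z y x => F x y z)); try lra. now apply SepBounded_swap13.
  - now apply Chasderiv_minus. }
eapply Rle_trans; [apply Cmod_triangle|]. lra.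
Qed.

(** The variables are moved one at a time, from [p] to [q] through (x, y, z') and (x, y', z').
    Replacing the partial derivatives at the intermediate points by those at [p] costs only products
    of two increments. As the partial derivatives vanish at 0, their Lipschitz bound makes the
    differential O(|p|). *)
Lemma quadratic_germ_of_SepBounded F : SepBounded (6 * e) F -> F (RtoC 0) (RtoC 0) (RtoC 0) = 0 ->
  vanish_order2 F -> quadratic_germ (e / 2) (48 / e ^ 2) F.
Proof.
intros HF F0 (_ & V1 & V2 & V3).
set (c := 16 / e ^ 2).
assert (Pc : 0 < c) by (apply Rdiv_lt_0_compat; [lra|apply pow_lt; auto]).
replace (48 / e ^ 2) with (3 * c) by (unfold c; field; lra).
split; [lra|]. split; [lra|]. split; auto.
intros p Hp. set (x := p1 p). set (y := p2 p). set (z := p3 p).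
assert (HF2 := SepBounded_swap12 _ _ HF). assert (HF3 := SepBounded_swap13 _ _ HF).
assert (Bp : forall q, N3 q < e / 2 -> Cmod (p1 q) < e / 2 /\ Cmod (p2 q) < e / 2 /\ Cmod (p3 q) < e / 2).
{ intros q Hq. unfold N3 in Hq. pose proof (Cmod_ge_0 (p1 q)). pose proof (Cmod_ge_0 (p2 q)).
  pose proof (Cmod_ge_0 (p3 q)). lra. }
destruct (Bp p Hp) as (Hx & Hy & Hz). fold x in Hx. fold y in Hy. fold z in Hz.
destruct (HF x y z) as (_ & (L1 & H1) & (L2 & H2) & (L3 & H3)); try lra.
assert (Z0 : Cmod 0 < e / 2) by (rewrite Cmod_0; lra).
exists (L1, L2, L3). split.
- pose proof (sep_deriv_lip F 0 0 0 x y z _ _ HF Z0 Z0 Z0 Hx Hy Hz V1 H1) as B1.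
  pose proof (sep_deriv_lip _ 0 0 0 y x z _ _ HF2 Z0 Z0 Z0 Hy Hx Hz V2 H2) as B2.
  pose proof (sep_deriv_lip _ 0 0 0 z y x _ _ HF3 Z0 Z0 Z0 Hz Hy Hx V3 H3) as B3.
  assert (S0 : forall t : C, (t - C0)%C = t) by (intros t; apply injective_projections; simpl; ring).
  assert (S1 : forall t : C, (t - 0)%C = t) by (intros t; ring).
  rewrite S0, !S1 in B1, B2, B3. fold c in B1, B2, B3.
  unfold N3 at 1. unfold p1 at 1, p2 at 1, p3 at 1. simpl.
  unfold N3. fold x y z. lra.
- intros q Hq. destruct (Bp q Hq) as (Hx' & Hy' & Hz').
  unfold app3. fold x y z. set (x' := p1 q) in *. set (y' := p2 q) in *. set (z' := p3 q) in *.
  destruct (HF x y' z') as (_ & (M1 & K1) & _); try lra.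
  destruct (HF x y z') as (_ & _ & (M2 & K2) & _); try lra.
  set (a := (x' - x)%C). set (b := (y' - y)%C). set (k := (z' - z)%C).
  assert (Ha : Cmod a < e) by (eapply Rle_lt_trans; [apply Cmod_minus_le|]; lra).
  assert (Hb : Cmod b < e) by (eapply Rle_lt_trans; [apply Cmod_minus_le|]; lra).
  assert (Hk : Cmod k < e) by (eapply Rle_lt_trans; [apply Cmod_minus_le|]; lra).
  pose proof (sep_taylor F x y' z' M1 a HF ltac:(lra) ltac:(lra) ltac:(lra) Ha K1) as T1.
  pose proof (sep_taylor _ y x z' M2 b HF2 ltac:(lra) ltac:(lra) ltac:(lra) Hb K2) as T2.
  pose proof (sep_taylor _ z y x L3 k HF3 ltac:(lra) ltac:(lra) ltac:(lra) Hk H3) as T3.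
  cbv beta in T2, T3.
  replace (x + a)%C with x' in T1 by (unfold a; ring).
  replace (y + b)%C with y' in T2 by (unfold b; ring).
  replace (z + k)%C with z' in T3 by (unfold k; ring).
  pose proof (sep_deriv_lip F x y z x y' z' _ _ HF Hx Hy Hz Hx Hy' Hz' H1 K1) as D1.
  pose proof (sep_deriv_lip _ y x z y x z' _ _ HF2 Hy Hx Hz Hy Hx Hz' H2 K2) as D2.
  replace (x - x)%C with (RtoC 0) in D1, D2 by ring.
  replace (y - y)%C with (RtoC 0) in D2 by ring.
  rewrite !Cmod_0 in D1, D2. fold b k c in D1, D2. fold c in T1, T2, T3.
  assert (EN : N3 (sub3 q p) = Cmod a + Cmod b + Cmod k) by reflexivity.
  rewrite EN.
  replace (F x' y' z' - F x y z - dot3 (L1, L2, L3) (sub3 q p))%C with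
   ((F x' y' z' - F x y' z' - M1 * a) + (F x y' z' - F x y z' - M2 * b) +
    (F x y z' - F x y z - L3 * k) + (M1 - L1) * a + (M2 - L2) * b)%C.
  2:{ unfold dot3, sub3. fold x y z x' y' z'. unfold p1, p2, p3. cbn [fst snd]. fold a b k.
      apply injective_projections; simpl; ring. }
  pose proof (Cmod_ge_0 a). pose proof (Cmod_ge_0 b). pose proof (Cmod_ge_0 k).
  eapply Rle_trans; [apply Cmod_triangle|].
  eapply Rle_trans; [apply Rplus_le_compat_r, Cmod_triangle|].
  eapply Rle_trans; [apply Rplus_le_compat_r, Rplus_le_compat_r, Cmod_triangle|].
  eapply Rle_trans; [apply Rplus_le_compat_r, Rplus_le_compat_r, Rplus_le_compat_r, Cmod_triangle|].
  rewrite !Cmod_mult.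
  apply Rmult_le_compat_r with (r := Cmod a) in D1; auto.
  apply Rmult_le_compat_r with (r := Cmod b) in D2; auto.
  apply Rle_trans with (c * (Cmod a ^ 2 + Cmod b ^ 2 + Cmod k ^ 2 + (Cmod b + Cmod k) * Cmod a + Cmod k * Cmod b)).
  + lra.
  + rewrite (Rmult_comm 3), Rmult_assoc. apply Rmult_le_compat_l; [lra|]. nra.
Qed.

End Separate.

Lemma quadratic_germ_of_Holo3 F : holo_near0 F -> vanish_order2 F -> exists d K, quadratic_germ d K F.
Proof.
intros (r & Hr & Hc & Hd) V. assert (V' := V). destruct V' as (F0 & _).
destruct (Hc C0 C0 C0) with (eps := 1) as (e & He & K); try lra.
{ unfold in_polydisc. rewrite Cabs_Cmod. change C0 with (RtoC 0). rewrite Cmod_0. auto. }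
set (D := Rmin r e).
assert (HD : 0 < D) by now apply Rmin_pos.
assert (D1 : D <= r) by apply Rmin_l. assert (D2 : D <= e) by apply Rmin_r.
exists (D / 6 / 2), (48 / (D / 6) ^ 2). apply quadratic_germ_of_SepBounded; auto; [lra|].
replace (6 * (D / 6)) with D by field.
intros x y z Hx Hy Hz. split.
- specialize (K x y z).
  assert (S : forall t, Cabs (Csub t C0) = Cmod t).
  { intros t. rewrite Cabs_Cmod. f_equal. apply injective_projections; simpl; ring. }
  rewrite !S in K. specialize (K ltac:(lra) ltac:(lra) ltac:(lra)). rewrite F0, S in K. lra.
- apply Hd. repeat split; rewrite Cabs_Cmod; lra.
Qed.

(** The factor N3 p + N3 q is what will make the iteration contract on small discs. *)
Lemma quadratic_germ_lip d K F p q : quadratic_germ d K F -> N3 p < d -> N3 q < d ->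
  Cmod (app3 F q - app3 F p)%C <= 2 * K * (N3 p + N3 q) * N3 (sub3 q p).
Proof.
intros (Hd & HK & F0 & H) Hp Hq. destruct (H p Hp) as (L & HL & HT).
specialize (HT q Hq).
replace (app3 F q - app3 F p)%C with ((app3 F q - app3 F p - dot3 L (sub3 q p)) + dot3 L (sub3 q p))%C by ring.
eapply Rle_trans; [apply Cmod_triangle|].
pose proof (dot3_le L (sub3 q p)). pose proof (N3_ge0 (sub3 q p)). pose proof (N3_ge0 p).
pose proof (N3_ge0 q). pose proof (N3_sub_le q p).
apply Rmult_le_compat_r with (r := N3 (sub3 q p)) in HL; auto.
assert (0 <= K * N3 (sub3 q p)) by now apply Rmult_le_pos.
nra.
Qed.

Lemma quadratic_germ_bound d K F p : quadratic_germ d K F -> N3 p < d -> Cmod (app3 F p) <= 2 * K * N3 p ^ 2.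
Proof.
intros HN Hp. assert (HN' := HN). destruct HN' as (Hd & HK & F0 & H).
set (o := (RtoC 0, RtoC 0, RtoC 0) : C3).
assert (No : N3 o = 0) by (unfold o, N3, p1, p2, p3; simpl; rewrite Cmod_0; ring).
pose proof (quadratic_germ_lip d K F o p HN ltac:(lra) Hp) as L.
assert (E : sub3 p o = p).
{ unfold sub3, o. destruct p as [[x y] z]. unfold p1, p2, p3; simpl.
  assert (S : forall t : C, (t - 0)%C = t) by (intros t; ring). now rewrite !S. }
rewrite E, No in L. replace (app3 F p - app3 F o)%C with (app3 F p) in L.
- eapply Rle_trans; [apply L|]. right; ring.
- unfold o, app3, p1, p2, p3; simpl. rewrite F0. ring.
Qed.

Lemma quadratic_germ_shrink d d' K F : quadratic_germ d K F -> 0 < d' <= d -> quadratic_germ d' K F.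
Proof.
intros (Hd & HK & F0 & H) Hd'. split; [lra|]. split; auto. split; auto.
intros p Hp. destruct (H p) as (L & HL & HT); [lra|]. exists L; split; auto.
intros q Hq. apply HT; lra.
Qed.

Lemma quadratic_germ_increase d K K' F : quadratic_germ d K F -> K <= K' -> quadratic_germ d K' F.
Proof.
intros (Hd & HK & F0 & H) HK'. split; [lra|]. split; [lra|]. split; auto.
intros p Hp. destruct (H p) as (L & HL & HT); [lra|]. exists L; split.
- eapply Rle_trans; [apply HL|]. apply Rmult_le_compat_r; auto. apply N3_ge0.
- intros q Hq. eapply Rle_trans; [apply HT; auto|]. apply Rmult_le_compat_r; auto. apply pow2_ge_0.
Qed.

Lemma quadratic_germ_comp_deriv d K F (P : C -> C3) s (L1 L2 L3 : C) : quadratic_germ d K F ->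
  N3 (P s) < d ->
  Chasderiv (fun t => p1 (P t)) s L1 -> Chasderiv (fun t => p2 (P t)) s L2 ->
  Chasderiv (fun t => p3 (P t)) s L3 ->
  exists L, Chasderiv (fun t => app3 F (P t)) s L.
Proof.
intros (Hd & HK & F0 & HF) HP H1 H2 H3. destruct (HF _ HP) as (A & HA & HT).
exists (dot3 A (L1, L2, L3)).
destruct (Chasderiv_lipschitz _ _ _ H1) as (d1 & Hd1 & B1).
destruct (Chasderiv_lipschitz _ _ _ H2) as (d2 & Hd2 & B2).
destruct (Chasderiv_lipschitz _ _ _ H3) as (d3 & Hd3 & B3).
set (m := (Cmod L1 + 1) + (Cmod L2 + 1) + (Cmod L3 + 1)).
assert (Pm : 0 < m).
{ unfold m. pose proof (Cmod_ge_0 L1). pose proof (Cmod_ge_0 L2). pose proof (Cmod_ge_0 L3). lra. }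
assert (Q : exists e0, 0 < e0 /\ forall h, Cmod h < e0 ->
   N3 (P (s + h)%C) < d /\ N3 (sub3 (P (s + h)%C) (P s)) <= m * Cmod h).
{ exists (Rmin (Rmin d1 (Rmin d2 d3)) ((d - N3 (P s)) / m)). split.
  { apply Rmin_pos; [apply Rmin_pos; auto; now apply Rmin_pos|apply Rdiv_lt_0_compat; lra]. }
  intros h Hh.
  pose proof (Rmin_l (Rmin d1 (Rmin d2 d3)) ((d - N3 (P s)) / m)).
  pose proof (Rmin_r (Rmin d1 (Rmin d2 d3)) ((d - N3 (P s)) / m)).
  pose proof (Rmin_l d1 (Rmin d2 d3)). pose proof (Rmin_r d1 (Rmin d2 d3)).
  pose proof (Rmin_l d2 d3). pose proof (Rmin_r d2 d3).
  assert (B : N3 (sub3 (P (s + h)%C) (P s)) <= m * Cmod h).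
  { specialize (B1 h ltac:(lra)). specialize (B2 h ltac:(lra)). specialize (B3 h ltac:(lra)).
    change (Cmod (p1 (P (s + h)%C) - p1 (P s))%C + Cmod (p2 (P (s + h)%C) - p2 (P s))%C
      + Cmod (p3 (P (s + h)%C) - p3 (P s))%C <= m * Cmod h). unfold m. lra. }
  split; auto.
  eapply Rle_lt_trans; [apply (N3_triangle _ (P s))|].
  assert (m * Cmod h < d - N3 (P s)).
  { apply Rlt_le_trans with (m * ((d - N3 (P s)) / m)).
    - apply Rmult_lt_compat_l; lra.
    - right; field; lra. }
  lra. }
destruct Q as (e0 & He0 & Q).
intros eps He.
set (e1 := eps / (2 * (N3 A + 1))).
pose proof (N3_ge0 A) as PA.
assert (Pe1 : 0 < e1) by (apply Rdiv_lt_0_compat; lra).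
destruct (H1 (e1 / 3)) as (c1 & Hc1 & T1); [lra|].
destruct (H2 (e1 / 3)) as (c2 & Hc2 & T2); [lra|].
destruct (H3 (e1 / 3)) as (c3 & Hc3 & T3); [lra|].
set (e2 := eps / (2 * (K * m ^ 2 + 1))).
assert (PK : 0 <= K * m ^ 2) by (apply Rmult_le_pos; auto; apply pow2_ge_0).
assert (Pe2 : 0 < e2) by (apply Rdiv_lt_0_compat; lra).
exists (Rmin (Rmin e0 e2) (Rmin c1 (Rmin c2 c3))). split.
{ repeat (apply Rmin_pos; auto). }
intros h Hh. change (Cabs h) with (Cmod h) in *.
pose proof (Rmin_l (Rmin e0 e2) (Rmin c1 (Rmin c2 c3))).
pose proof (Rmin_r (Rmin e0 e2) (Rmin c1 (Rmin c2 c3))).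
pose proof (Rmin_l e0 e2). pose proof (Rmin_r e0 e2).
pose proof (Rmin_l c1 (Rmin c2 c3)). pose proof (Rmin_r c1 (Rmin c2 c3)).
pose proof (Rmin_l c2 c3). pose proof (Rmin_r c2 c3).
specialize (T1 h). specialize (T2 h). specialize (T3 h). change (Cabs h) with (Cmod h) in *.
specialize (T1 ltac:(lra)). specialize (T2 ltac:(lra)). specialize (T3 ltac:(lra)).
change (Cmod (p1 (P (s + h)%C) - p1 (P s) - L1 * h)%C <= e1 / 3 * Cmod h) in T1.
change (Cmod (p2 (P (s + h)%C) - p2 (P s) - L2 * h)%C <= e1 / 3 * Cmod h) in T2.
change (Cmod (p3 (P (s + h)%C) - p3 (P s) - L3 * h)%C <= e1 / 3 * Cmod h) in T3.
destruct (Q h ltac:(lra)) as [Q1 Q2]. specialize (HT _ Q1).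
change (Cmod (app3 F (P (s + h)%C) - app3 F (P s) - dot3 A (L1, L2, L3) * h)%C <= eps * Cmod h).
set (v := (p1 (P (s + h)%C) - p1 (P s) - L1 * h, p2 (P (s + h)%C) - p2 (P s) - L2 * h,
  p3 (P (s + h)%C) - p3 (P s) - L3 * h)%C : C3).
assert (Nv : N3 v <= e1 * Cmod h).
{ change (N3 v) with (Cmod (p1 (P (s + h)%C) - p1 (P s) - L1 * h)%C
    + Cmod (p2 (P (s + h)%C) - p2 (P s) - L2 * h)%C + Cmod (p3 (P (s + h)%C) - p3 (P s) - L3 * h)%C).
  lra. }
replace (app3 F (P (s + h)%C) - app3 F (P s) - dot3 A (L1, L2, L3) * h)%C with
 ((app3 F (P (s + h)%C) - app3 F (P s) - dot3 A (sub3 (P (s + h)%C) (P s))) + dot3 A v)%C.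
2:{ unfold dot3, sub3, v, p1, p2, p3. cbn [fst snd]. apply injective_projections; simpl; ring. }
eapply Rle_trans; [apply Cmod_triangle|].
pose proof (Cmod_ge_0 h) as Ph.
assert (B1' : K * N3 (sub3 (P (s + h)%C) (P s)) ^ 2 <= eps / 2 * Cmod h).
{ apply Rle_trans with (K * (m * Cmod h) ^ 2).
  - apply Rmult_le_compat_l; auto. apply pow_incr. split; [apply N3_ge0|auto].
  - replace (K * (m * Cmod h) ^ 2) with ((K * m ^ 2) * Cmod h * Cmod h) by ring.
    apply Rmult_le_compat_r; auto.
    apply Rle_trans with ((K * m ^ 2 + 1) * e2).
    + apply Rmult_le_compat; lra.
    + right. unfold e2. field. lra. }
assert (B2' : Cmod (dot3 A v) <= eps / 2 * Cmod h).
{ eapply Rle_trans; [apply dot3_le|].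
  apply Rle_trans with ((N3 A + 1) * (e1 * Cmod h)).
  - apply Rmult_le_compat; auto; try lra. apply N3_ge0.
  - right. unfold e1. field. lra. }
lra.
Qed.

(** * Periodic solutions of the linear equations *)

Lemma Rderiv_C_ext (f g : R -> C) t v : (forall t, f t = g t) -> Rderiv_C f t v -> Rderiv_C g t v.
Proof.
intros E [H1 H2]; split; apply is_derive_Reals; apply is_derive_Reals in H1, H2.
- eapply is_derive_ext; [|apply H1]. intros; simpl. now rewrite E.
- eapply is_derive_ext; [|apply H2]. intros; simpl. now rewrite E.
Qed.

Lemma Rderiv_C_shift (f : R -> C) c t v : Rderiv_C f (c + t) v -> Rderiv_C (fun t => f (c + t)) t v.
Proof.
rewrite !Rderiv_C_eps. intros H eps He. destruct (H eps He) as (d & Hd & K).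
exists d; split; auto. intros h Hh. rewrite <- Rplus_assoc. auto.
Qed.

Lemma CInt_chasles_cont f a b c : (forall t, Ccont f t) ->
  (CInt f a b + CInt f b c)%C = CInt f a c.
Proof.
intros H.
assert (E1 : forall a b, ex_RInt (fun t => fst (f t)) a b).
{ intros. apply (ex_RInt_continuous (V:=R_CompleteNormedModule)). intros; apply H. }
assert (E2 : forall a b, ex_RInt (fun t => snd (f t)) a b).
{ intros. apply (ex_RInt_continuous (V:=R_CompleteNormedModule)). intros; apply H. }
apply injective_projections; simpl.
- exact (RInt_Chasles (V:=R_CompleteNormedModule) (fun t => fst (f t)) a b c (E1 _ _) (E1 _ _)).
- exact (RInt_Chasles (V:=R_CompleteNormedModule) (fun t => snd (f t)) a b c (E2 _ _) (E2 _ _)).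
Qed.

(** Rotating [s] for a time t translates the integrand, so averages followed along a circle become
    integrals over a sliding window, and only the end points contribute to the derivative. *)
Lemma CInt_window_deriv f T t : (forall t, Ccont f t) ->
  Rderiv_C (fun t => CInt f (0 + t) (T + t)) t (f (T + t)%R - f t)%C.
Proof.
intros H.
apply (Rderiv_C_ext (fun t => CInt f 0 (T + t) - CInt f 0 t)%C).
{ intros s. rewrite Rplus_0_l, <- (CInt_chasles_cont f 0 s (T + s)); auto. ring. }
apply Rderiv_C_minus; [apply (Rderiv_C_shift (fun t => CInt f 0 t))|]; now apply CInt_deriv.
Qed.

Lemma cis_neg_deriv (w t : R) : Rderiv_C (fun t => cis (- (w * t))) t (- (0, w) * cis (- (w * t)))%C.
Proof.
apply (Rderiv_C_ext (fun t => cis (- w * t))).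
{ intros s. f_equal; ring. }
eapply Rderiv_C_eq; [apply cis_deriv|]. replace (- w * t) with (- (w * t)) by ring. Ceq.
Qed.

Lemma cexp_lin_deriv (c : C) (t : R) : Rderiv_C (fun t => cexp (c * t)) t (c * cexp (c * t))%C.
Proof.
apply Rderiv_C_eq with (cexp (c * t) * (c * 1))%C; [|ring].
apply (Rderiv_C_comp cexp (fun t => c * t)%C); [apply cexp_deriv|].
apply Rderiv_C_scal, (Rderiv_C_RtoC (fun t => t)), derivable_pt_lim_id.
Qed.

Lemma cis_neg x : (cis x * cis (- x))%C = 1.
Proof. rewrite <- cis_plus, Rplus_opp_r. apply cis_0. Qed.

Lemma cexp_neg z : (cexp z * cexp (- z))%C = 1.
Proof. rewrite <- cexp_plus. replace (z + - z)%C with (RtoC 0) by ring. apply cexp_0. Qed.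

Lemma RtoC_neq_0 (x : R) : x <> 0 -> RtoC x <> 0.
Proof. intros H E. apply H. now injection E. Qed.

Section Operators.

Variables (w : R) (lam : C).
Hypothesis Hw : w <> 0.
Hypothesis Hlam : Cre lam <> 0.

Notation T := (period w).

(* Averaging [G] against these kernels gives the periodic solution along each circle of
   [y' = i w y + G] without component on [s], respectively of [z' = lam z + G]: on [G s = s ^ n],
   n >= 2, they act as division by [i w (n - 1)] and by [i w n - lam]. *)
Definition center_kernel (t : R) : C := (t / T * cis (- (w * t)))%C.
Definition hyperbolic_kernel (t : R) : C := (cexp (- lam * t) / (cexp (- lam * T) - 1))%C.

Let PT : 0 < T := period_pos w Hw.
Let NT : RtoC T <> 0.
Proof. apply RtoC_neq_0. lra. Qed.

(** The modulus of e^{-lam T} is e^{-T Re lam}, which differs from 1 as Re lam is nonzero. *)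
Lemma hyperbolic_kernel_den : (cexp (- lam * T) - 1)%C <> 0.
Proof.
intros E.
assert (M : Cmod (cexp (- lam * T)) = 1).
{ replace (cexp (- lam * T)) with ((cexp (- lam * T) - 1) + 1)%C by ring.
  rewrite E, Cplus_0_l. apply Cmod_1. }
rewrite Cmod_cexp, <- exp_0 in M. apply exp_inv in M. simpl in M.
change (Cre lam) with (fst lam) in Hlam. nra.
Qed.

Lemma center_kernel_cont t : Ccont center_kernel t.
Proof.
unfold center_kernel. apply Ccont_mult.
- apply (Rderiv_C_cont _ _ (1 * / T + t * 0)%C). unfold Cdiv.
  apply (Rderiv_C_mult (fun t => RtoC t) (fun _ => / T)%C); [|apply Rderiv_C_const].
  apply (Rderiv_C_RtoC (fun t => t)), derivable_pt_lim_id.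
- eapply Rderiv_C_cont, cis_neg_deriv.
Qed.

Lemma hyperbolic_kernel_cont t : Ccont hyperbolic_kernel t.
Proof.
unfold hyperbolic_kernel. apply Ccont_mult; [|apply Ccont_const]. eapply Rderiv_C_cont, cexp_lin_deriv.
Qed.

Lemma kernels_bounded : exists B, 0 <= B /\ forall t, 0 <= t <= T -> Cmod (center_kernel t) <= B /\ Cmod (hyperbolic_kernel t) <= B.
Proof.
set (M := exp (Rabs (fst lam) * T) / Cmod (cexp (- lam * T) - 1)).
assert (0 < Cmod (cexp (- lam * T) - 1)) by apply Cmod_gt_0, hyperbolic_kernel_den.
assert (0 < M) by (apply Rdiv_lt_0_compat; auto; apply exp_pos).
exists (1 + M). split; [lra|]. intros t Ht. split.
- unfold center_kernel. rewrite Cmod_mult, Cmod_cis, Rmult_1_r, Cmod_div, !Cmod_R, !Rabs_pos_eq; auto; try lra.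
  apply Rle_trans with 1; [|lra]. apply Rmult_le_reg_r with T; auto.
  unfold Rdiv. rewrite Rmult_assoc, Rinv_l; lra.
- unfold hyperbolic_kernel. rewrite Cmod_div; [|apply hyperbolic_kernel_den].
  apply Rle_trans with M; [|lra]. unfold M. apply Rmult_le_compat_r.
  + left. now apply Rinv_0_lt_compat.
  + rewrite Cmod_cexp. simpl.
    assert (- fst lam * t - - snd lam * 0 <= Rabs (fst lam) * T).
    { pose proof (Rabs_pos (fst lam)). pose proof (Rle_abs (- fst lam)). rewrite Rabs_Ropp in H2. nra. }
    destruct H1 as [H1|H1]; [left; now apply exp_increasing|right; now rewrite H1].
Qed.

Lemma circle_shift (s : C) (t u : R) : (s * cis (w * t) * cis (w * u) = s * cis (w * (u + t)))%C.
Proof. rewrite Rmult_plus_distr_l, cis_plus. ring. Qed.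

Lemma cis_T : cis (w * T) = 1.
Proof.
pose proof (cis_period w 0 Hw) as E. rewrite Rplus_0_l, Rmult_0_r, cis_0 in E. exact E.
Qed.

(** In the rotating frame the average is an integral over the window [t, t + T] of the forcing [k]
    with weight u - t. Replacing this weight by u costs t times the mean of [k], which is zero by
    Cauchy's formula because G'(0) = 0. The end points then contribute (T + t) k - t k = T k, which
    is the forcing. *)
Lemma center_average_ode r G s t : Hol r G -> G (RtoC 0) = 0 -> Chasderiv G (RtoC 0) (RtoC 0) -> Cmod s < r ->
  Rderiv_C (fun t => average w center_kernel G (s * cis (w * t)))%C t
    ((0, w) * average w center_kernel G (s * cis (w * t)) + G (s * cis (w * t)))%C.
Proof.
intros HG G0 G1 Hs.
set (k := fun u : R => (cis (- (w * u)) * G (s * cis (w * u)))%C).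
assert (kc : forall u, Ccont k u).
{ intros u. apply Ccont_mult; [eapply Rderiv_C_cont, cis_neg_deriv|now apply Ccont_circle with r]. }
set (l := fun u : R => (u * k u)%C).
assert (lc : forall u, Ccont l u).
{ intros u. apply Ccont_mult; auto. eapply Rderiv_C_cont.
  apply (Rderiv_C_RtoC (fun t => t)), derivable_pt_lim_id. }
assert (kcs : forall c, Ccont_on (fun u => k (u + c)) 0 T).
{ intros c u _. now apply Ccont_shift. }
assert (lcs : forall c, Ccont_on (fun u => l (u + c)) 0 T).
{ intros c u _. now apply Ccont_shift. }
assert (E : forall t, average w center_kernel G (s * cis (w * t)) = (cis (w * t) / T * CInt l (0 + t) (T + t))%C).
{ clear t. intros t.
  assert (Z : CInt (fun u => k (u + t)) 0 T = 0).
  { pose proof (cauchy_mean G r _ (s * cis (w * t))%C w Hw HG G0 G1 (Cmod_mult_cis_lt _ _ _ _ Hs)) as C.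
    rewrite !Cmult_0_r in C. 
    rewrite (CInt_ext _ (fun u => cis (- (w * t)) * (G (s * cis (w * t) * cis (w * u)) * cis (- (w * u))))%C);
      try lra.
    - rewrite CInt_scal; try lra; [rewrite C; ring|].
      intros u _. apply Ccont_mult; [|eapply Rderiv_C_cont, cis_neg_deriv].
      apply Ccont_circle with r; auto. now apply Cmod_mult_cis_lt.
    - intros u _. unfold k. rewrite circle_shift.
      replace (- (w * (u + t))) with (- (w * t) + - (w * u)) by ring. rewrite cis_plus. ring. }
  rewrite <- CInt_shift; try lra; [|intros u _; apply lc].
  unfold average.
  rewrite (CInt_ext _ (fun u => cis (w * t) / T * (l (u + t)%R - t * k (u + t)%R))%C); try lra.
  - rewrite CInt_scal, CInt_minus, CInt_scal, Z; auto; try lra.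
    + ring.
    + intros u Hu. apply Ccont_mult; [apply Ccont_const|now apply (kcs t u)].
    + intros u Hu. apply Ccont_minus; [now apply (lcs t u)|].
      apply Ccont_mult; [apply Ccont_const|now apply (kcs t u)].
  - intros u _. rewrite circle_shift. unfold center_kernel, l, k.
    replace (- (w * u)) with (w * t + - (w * (u + t))) by ring. rewrite cis_plus, RtoC_plus.
    field. auto. }
apply (Rderiv_C_ext (fun t => cis (w * t) / T * CInt l (0 + t) (T + t))%C); [intros; now rewrite E|].
rewrite E. unfold Cdiv.
apply Rderiv_C_eq with (((0, w) * cis (w * t) * / T) * CInt l (0 + t) (T + t) +
  (cis (w * t) * / T) * (l (T + t)%R - l t))%C.
- apply (Rderiv_C_mult (fun t => cis (w * t) * / T)%C (fun t => CInt l (0 + t) (T + t))); [|now apply CInt_window_deriv].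
  apply (Rderiv_C_ext (fun t => / T * cis (w * t))%C); [intros; ring|].
  apply Rderiv_C_eq with (/ T * ((0, w) * cis (w * t)))%C; [|ring].
  apply Rderiv_C_scal, cis_deriv.
- assert (kT : k (T + t) = k t).
  { unfold k. rewrite (Rplus_comm T t), cis_period; auto. f_equal.
    replace (- (w * (t + T))) with (- w * (t + period (- w))) by (unfold period; rewrite Rabs_Ropp; ring).
    rewrite cis_period; [|lra]. f_equal; ring. }
  unfold l. rewrite kT, RtoC_plus.
  replace (G (s * cis (w * t))%C) with (cis (w * t) * k t)%C.
  + field. auto.
  + unfold k. rewrite Cmult_assoc, cis_neg. ring.
Qed.

(** The integrand [q] is multiplied by e^{-lam T} over one period, so the end points of the window
    contribute (e^{-lam T} - 1) q t, and the denominator of the kernel cancels. *)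
Lemma hyperbolic_average_ode r G s t : Hol r G -> Cmod s < r ->
  Rderiv_C (fun t => average w hyperbolic_kernel G (s * cis (w * t)))%C t
    (lam * average w hyperbolic_kernel G (s * cis (w * t)) + G (s * cis (w * t)))%C.
Proof.
intros HG Hs. pose proof hyperbolic_kernel_den as ND.
set (q := fun u : R => (cexp (- lam * u) * G (s * cis (w * u)))%C).
assert (qc : forall u, Ccont q u).
{ intros u. apply Ccont_mult; [eapply Rderiv_C_cont, cexp_lin_deriv|now apply Ccont_circle with r]. }
set (den := (cexp (- lam * T) - 1)%C) in *.
assert (E : forall t, average w hyperbolic_kernel G (s * cis (w * t)) = (cexp (lam * t) / den * CInt q (0 + t) (T + t))%C).
{ clear t. intros t. rewrite <- CInt_shift; try lra; [|intros u _; apply qc].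
  rewrite <- CInt_scal; try lra; [|intros u _; now apply Ccont_shift].
  unfold average. apply CInt_ext; try lra. intros u _.
  rewrite circle_shift. unfold hyperbolic_kernel, q. fold den. 
  replace (- lam * u)%C with (lam * t + - lam * (u + t)%R)%C by (rewrite RtoC_plus; ring).
  rewrite cexp_plus. field. auto. }
apply (Rderiv_C_ext (fun t => cexp (lam * t) / den * CInt q (0 + t) (T + t))%C); [intros; now rewrite E|].
rewrite E. unfold Cdiv.
apply Rderiv_C_eq with ((lam * cexp (lam * t) * / den) * CInt q (0 + t) (T + t) +
  (cexp (lam * t) * / den) * (q (T + t)%R - q t))%C.
- apply (Rderiv_C_mult (fun t => cexp (lam * t) * / den)%C (fun t => CInt q (0 + t) (T + t))); [|now apply CInt_window_deriv].
  apply (Rderiv_C_ext (fun t => / den * cexp (lam * t))%C); [intros; ring|].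
  apply Rderiv_C_eq with (/ den * (lam * cexp (lam * t)))%C; [|ring].
  apply Rderiv_C_scal, cexp_lin_deriv.
- assert (qT : q (T + t) = (cexp (- lam * T) * q t)%C).
  { unfold q. rewrite (Rplus_comm T t), cis_period; auto.
    replace (- lam * (t + T)%R)%C with (- lam * T + - lam * t)%C by (rewrite RtoC_plus; ring).
    rewrite cexp_plus. ring. }
  rewrite qT.
  replace (cexp (- lam * T) * q t - q t)%C with (den * q t)%C by (unfold den; ring).
  replace (G (s * cis (w * t))%C) with (cexp (lam * t) * q t)%C.
  + field. auto.
  + unfold q. replace (- lam * t)%C with (- (lam * t))%C by ring.
    rewrite Cmult_assoc, cexp_neg. ring.
Qed.

(* With [v t = Y (s * cis (w t)) * cis (- w t)] the forcing term is [v'], and [v] has mean zero, so the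
   claim is integration by parts of [t * v' t]. *)
Lemma center_average_inv r Y G s : Hol r Y -> Hol r G -> Y (RtoC 0) = 0 -> Chasderiv Y (RtoC 0) (RtoC 0) ->
  Cmod s < r ->
  (forall t, Rderiv_C (fun t => Y (s * cis (w * t))%C) t
    ((0, w) * Y (s * cis (w * t)) + G (s * cis (w * t)))%C) ->
  Y s = average w center_kernel G s.
Proof.
intros HY HG Y0 Y1 Hs HD.
set (g := fun t => (cis (- (w * t)) * G (s * cis (w * t)))%C).
set (v := fun t => (Y (s * cis (w * t)) * cis (- (w * t)))%C).
assert (gc : forall t, Ccont g t).
{ intros u. apply Ccont_mult; [eapply Rderiv_C_cont, cis_neg_deriv|now apply Ccont_circle with r]. }
assert (vd : forall t, Rderiv_C v t (g t)).
{ intros t. eapply Rderiv_C_eq; [apply Rderiv_C_mult; [apply HD|apply cis_neg_deriv]|].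
  unfold g. ring. }
assert (vc : forall t, Ccont v t) by (intros t; eapply Rderiv_C_cont, vd).
assert (tc : forall t, Rderiv_C (fun t => RtoC t) t (RtoC 1)).
{ intros t. apply (Rderiv_C_RtoC (fun t => t)), derivable_pt_lim_id. }
assert (Z : CInt v 0 T = 0).
{ pose proof (cauchy_mean Y r _ s w Hw HY Y0 Y1 Hs) as C. rewrite !Cmult_0_r in C. exact C. }
assert (F : CInt (fun t => v t + t * g t)%C 0 T = (T * v T - 0 * v 0%R)%C).
{ apply (CInt_FTC (fun t => t * v t)%C); try lra.
  - intros t _. apply Rderiv_C_eq with (1 * v t + t * g t)%C; [|ring]. now apply Rderiv_C_mult.
  - intros t _. apply Ccont_plus; auto. apply Ccont_mult; auto. eapply Rderiv_C_cont, tc. }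
assert (tgc : Ccont_on (fun t => t * g t)%C 0 T).
{ intros t _. apply Ccont_mult; auto. eapply Rderiv_C_cont, tc. }
rewrite CInt_plus, Z in F; auto; try lra; [|intros t _; auto].
assert (vT : v T = Y s).
{ unfold v. rewrite cis_T. replace (- (w * T)) with (0 - w * T) by ring.
  pose proof (cis_neg (w * T)) as E. rewrite cis_T, Cmult_1_l in E. unfold Rminus. rewrite Rplus_0_l, E.
  rewrite !Cmult_1_r. auto. }
rewrite vT in F.
unfold average. rewrite (CInt_ext _ (fun t => / T * (t * g t))%C); try lra.
- rewrite CInt_scal; auto; try lra.
  replace (CInt (fun t => t * g t)%C 0 T) with (T * Y s)%C.
  + field. auto.
  + rewrite Cplus_0_l in F. rewrite F. ring.
- intros t _. unfold center_kernel, g. field. auto.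
Qed.

(** Variation of constants over one period: e^{-lam t} Y has derivative [g], and by periodicity of Y
    along the circle its total variation is (e^{-lam T} - 1) Y(s). *)
Lemma hyperbolic_average_inv r Y G s : Hol r Y -> Hol r G -> Cmod s < r ->
  (forall t, Rderiv_C (fun t => Y (s * cis (w * t))%C) t
    (lam * Y (s * cis (w * t)) + G (s * cis (w * t)))%C) ->
  Y s = average w hyperbolic_kernel G s.
Proof.
intros HY HG Hs HD. pose proof hyperbolic_kernel_den as ND. set (den := (cexp (- lam * T) - 1)%C) in *.
set (g := fun t : R => (cexp (- lam * t) * G (s * cis (w * t)))%C).
set (v := fun t : R => (Y (s * cis (w * t)) * cexp (- lam * t))%C).
assert (gc : forall t, Ccont g t).
{ intros u. apply Ccont_mult; [eapply Rderiv_C_cont, cexp_lin_deriv|now apply Ccont_circle with r]. }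
assert (vd : forall t, Rderiv_C v t (g t)).
{ intros t. eapply Rderiv_C_eq; [apply Rderiv_C_mult; [apply HD|apply cexp_lin_deriv]|].
  unfold g. ring. }
assert (F : CInt g 0 T = (v T - v 0)%C).
{ apply CInt_FTC; try lra; [intros t _; apply vd|intros t _; apply gc]. }
assert (F' : (v T - v 0)%C = (den * Y s)%C).
{ unfold v, den. rewrite cis_T, Rmult_0_r, cis_0, !Cmult_1_r, !Cmult_0_r, cexp_0. ring. }
unfold average. rewrite (CInt_ext _ (fun t => / den * g t)%C); try lra.
- rewrite CInt_scal; try lra; [|intros t _; apply gc]. rewrite F, F'. field. auto.
- intros t _. unfold hyperbolic_kernel, g. fold den. field. auto.
Qed.

End Operators.

(** * Holomorphic parametrization of the center manifold *)

Definition Hol3 (r : R) (P : C -> C3) :=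
  Hol r (fun s => p1 (P s)) /\ Hol r (fun s => p2 (P s)) /\ Hol r (fun s => p3 (P s)).

Definition axis (s : C) : C3 := (s, RtoC 0, RtoC 0).

Definition circle_trajectories (w : R) (lam : C) (f g h : C -> C -> C -> C) (r : R) (P : C -> C3) :=
  forall s, Cmod s < r -> trajectory w lam f g h
    (fun t => p1 (P (s * cis (w * t))%C)) (fun t => p2 (P (s * cis (w * t))%C))
    (fun t => p3 (P (s * cis (w * t))%C)).

(** The quadratic bound encodes at once the passage through 0, the tangency to the x-axis and the
    normalization of the parameter, without naming a derivative. *)
Definition parametrization w lam f g h (r : R) (P : C -> C3) :=
  Hol3 r P /\ circle_trajectories w lam f g h r P /\
  exists K, 0 <= K /\ forall s, Cmod s < r -> N3 (sub3 (P s) (axis s)) <= K * Cmod s ^ 2.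

Lemma N3_axis s : N3 (axis s) = Cmod s.
Proof. unfold N3, axis, p1, p2, p3; simpl. rewrite Cmod_0. ring. Qed.

Lemma N3_comp p : Cmod (p1 p) <= N3 p /\ Cmod (p2 p) <= N3 p /\ Cmod (p3 p) <= N3 p.
Proof.
unfold N3. pose proof (Cmod_ge_0 (p1 p)). pose proof (Cmod_ge_0 (p2 p)).
pose proof (Cmod_ge_0 (p3 p)). lra.
Qed.

Lemma N3_sub_eq p q : N3 (sub3 p q) <= 0 -> p = q.
Proof.
intros H. destruct (N3_comp (sub3 p q)) as (H1 & H2 & H3).
assert (K : forall a b : C, Cmod (a - b) <= 0 -> a = b).
{ intros a b Hab. replace a with ((a - b) + b)%C by ring.
  rewrite (Cmod_eq_0 (a - b)); [ring|]. apply Rle_antisym; auto. apply Cmod_ge_0. }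
pose proof (Rle_trans _ _ _ H1 H) as J1. pose proof (Rle_trans _ _ _ H2 H) as J2.
pose proof (Rle_trans _ _ _ H3 H) as J3. clear H H1 H2 H3.
destruct p as [[x y] z], q as [[x' y'] z'].
unfold sub3, p1, p2, p3 in J1, J2, J3; simpl in J1, J2, J3.
repeat f_equal; now apply K.
Qed.

Lemma N3_sub_triangle p q r : N3 (sub3 p r) <= N3 (sub3 p q) + N3 (sub3 q r).
Proof.
pose proof (N3_triangle (sub3 p r) (sub3 p q)).
replace (N3 (sub3 q r)) with (N3 (sub3 (sub3 p r) (sub3 p q))); [lra|].
assert (S : forall a b c : C, ((a - c) - (a - b) = b - c)%C) by (intros; ring).
unfold N3, sub3, p1, p2, p3; simpl. now rewrite !S.
Qed.

Lemma quadratic_zero (u : C -> C) r K : 0 < r -> 0 <= K ->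
  (forall z, Cmod z < r -> Cmod (u z) <= K * Cmod z ^ 2) ->
  u (RtoC 0) = 0 /\ Chasderiv u (RtoC 0) (RtoC 0).
Proof.
intros Hr HK H.
assert (U0 : u (RtoC 0) = 0).
{ apply Cmod_eq_0. apply Rle_antisym; [|apply Cmod_ge_0].
  eapply Rle_trans; [apply H|]; rewrite Cmod_0; [auto|simpl; lra]. }
split; auto. intros eps He.
exists (Rmin r (eps / (K + 1))). split.
{ apply Rmin_pos; auto. apply Rdiv_lt_0_compat; lra. }
intros h Hh. change (Cmod (u (0 + h) - u 0 - 0 * h)%C <= eps * Cmod h).
change (Cabs h) with (Cmod h) in Hh.
rewrite U0, Cplus_0_l. replace (u h - 0 - 0 * h)%C with (u h) by (apply injective_projections; simpl; ring).
eapply Rle_trans; [apply H; eapply Rlt_le_trans; [apply Hh|apply Rmin_l]|].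
assert (Hh2 : Cmod h < eps / (K + 1)) by (eapply Rlt_le_trans; [apply Hh|apply Rmin_r]).
pose proof (Cmod_ge_0 h).
apply Rmult_lt_compat_l with (r := K + 1) in Hh2; [|lra].
replace ((K + 1) * (eps / (K + 1))) with eps in Hh2 by (field; lra).
nra.
Qed.

(** * The contraction on curves close to the axis *)

Section Parametrization.

Variables (w : R) (lam : C) (f g h : C -> C -> C -> C) (d K B : R).
Hypothesis Hw : w <> 0.
Hypothesis Hlam : Cre lam <> 0.
Hypotheses (Nf : quadratic_germ d K f) (Ng : quadratic_germ d K g) (Nh : quadratic_germ d K h).
Hypothesis HB : 0 <= B.
Hypothesis HkA : forall t, 0 <= t <= period w -> Cmod (center_kernel w t) <= B.
Hypothesis HkB : forall t, 0 <= t <= period w -> Cmod (hyperbolic_kernel w lam t) <= B.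

Let kap := period w * B.
(** On an admissible curve each nonlinearity is at most 8 K |s|^2. One average costs a factor [kap],
    so [y] and [z] contribute kap each; [x], driven by [f] and by the new [y], contributes kap (kap
    + 1). *)
Definition contraction_const := 8 * K * (3 * kap + kap ^ 2).
Notation E := contraction_const.

Variable r : R.
Hypothesis Hr : 0 < r.
Hypothesis Hrd : 2 * r <= d.
Hypothesis HrE : E * r <= 1 / 2.

Let HK : 0 <= K := proj1 (proj2 Nf).

Let Pkap : 0 <= kap.
Proof. apply Rmult_le_pos; auto. left; now apply period_pos. Qed.

Definition step_y (P : C -> C3) := average w (center_kernel w) (fun s => app3 g (P s)).
(* The updated [y] is used here: the term [y] in the first equation has no small Lipschitz constant,
   so the map would not contract with the old one. *)
Definition force_x (P : C -> C3) := (fun s => step_y P s + app3 f (P s))%C.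
Definition step_z (P : C -> C3) := average w (hyperbolic_kernel w lam) (fun s => app3 h (P s)).
Definition step (P : C -> C3) (s : C) : C3 :=
  ((s + average w (center_kernel w) (force_x P) s)%C, step_y P s, step_z P s).

(** The unit ball around the axis for the distance divided by |s|. Its curves satisfy N3 (P s) <= 2
    |s|, so [Hrd] keeps them in the domain of the germs. *)
Definition admissible (P : C -> C3) :=
  Hol3 r P /\ forall s, Cmod s < r -> N3 (sub3 (P s) (axis s)) <= Cmod s.

Lemma admissible_N3 P s : admissible P -> Cmod s < r -> N3 (P s) <= 2 * Cmod s.
Proof.
intros [_ H] Hs. pose proof (N3_triangle (P s) (axis s)). rewrite N3_axis in H0.
specialize (H s Hs). lra.
Qed.

Lemma admissible_small P s : admissible P -> Cmod s < r -> N3 (P s) < d.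
Proof. intros H Hs. pose proof (admissible_N3 P s H Hs). lra. Qed.

Lemma Hol_app F P : quadratic_germ d K F -> admissible P -> Hol r (fun s => app3 F (P s)).
Proof.
intros HF HP s Hs. pose proof (admissible_small P s HP Hs) as Sm.
destruct HP as [(H1 & H2 & H3) _].
destruct (H1 s Hs) as [L1 D1]. destruct (H2 s Hs) as [L2 D2]. destruct (H3 s Hs) as [L3 D3].
now apply (quadratic_germ_comp_deriv d K F P s L1 L2 L3).
Qed.

Lemma app_bound F P s : quadratic_germ d K F -> admissible P -> Cmod s < r ->
  Cmod (app3 F (P s)) <= 8 * K * Cmod s ^ 2.
Proof.
intros HF HP Hs. eapply Rle_trans; [apply (quadratic_germ_bound d K); auto; now apply admissible_small|].
pose proof (admissible_N3 P s HP Hs). pose proof (N3_ge0 (P s)).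
assert (N3 (P s) ^ 2 <= (2 * Cmod s) ^ 2) by (apply pow_incr; lra).
nra.
Qed.

Lemma app_diff F P Q D s : quadratic_germ d K F -> admissible P -> admissible Q ->
  (forall z, Cmod z < r -> N3 (sub3 (P z) (Q z)) <= D * Cmod z) ->
  Cmod s < r -> Cmod (app3 F (P s) - app3 F (Q s))%C <= 8 * K * D * Cmod s ^ 2.
Proof.
intros HF HP HQ HD Hs.
eapply Rle_trans; [apply (quadratic_germ_lip d K); auto; now apply admissible_small|].
pose proof (admissible_N3 P s HP Hs). pose proof (N3_ge0 (P s)).
pose proof (admissible_N3 Q s HQ Hs). pose proof (N3_ge0 (Q s)).
specialize (HD s Hs). pose proof (N3_ge0 (sub3 (P s) (Q s))).
apply Rle_trans with (2 * K * (4 * Cmod s) * (D * Cmod s)); [|right; ring].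
apply Rmult_le_compat; auto.
- apply Rmult_le_pos; lra.
- apply Rmult_le_compat_l; lra.
Qed.

Lemma pow2_lt_r s : Cmod s < r -> Cmod s ^ 2 <= r ^ 2.
Proof. intros Hs. apply pow_incr. pose proof (Cmod_ge_0 s). lra. Qed.

Lemma app_bound_r F P : quadratic_germ d K F -> admissible P ->
  forall z, Cmod z < r -> Cmod (app3 F (P z)) <= 8 * K * r ^ 2.
Proof.
intros HF HP z Hz. eapply Rle_trans; [now apply app_bound|].
apply Rmult_le_compat_l; [lra|now apply pow2_lt_r].
Qed.

Let cA := center_kernel_cont w.
Let cB := hyperbolic_kernel_cont w lam.

Lemma step_y_hol P : admissible P -> Hol r (step_y P).
Proof.
intros HP. apply (Hol_average w (center_kernel w) B Hw cA HkA r _ (8 * K * r ^ 2)).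
- now apply Hol_app.
- now apply app_bound_r.
Qed.

Lemma step_y_bound P s : admissible P -> Cmod s < r -> Cmod (step_y P s) <= 8 * K * kap * Cmod s ^ 2.
Proof.
intros HP Hs. replace (8 * K * kap * Cmod s ^ 2) with (period w * (B * (8 * K * Cmod s ^ 2)))
  by (unfold kap; ring).
apply (average_bound w (center_kernel w) B Hw cA HkA r); auto.
- now apply Hol_app.
- intros z Hz. rewrite <- Hz. apply app_bound; auto. lra.
Qed.

Lemma step_z_bound P s : admissible P -> Cmod s < r -> Cmod (step_z P s) <= 8 * K * kap * Cmod s ^ 2.
Proof.
intros HP Hs. replace (8 * K * kap * Cmod s ^ 2) with (period w * (B * (8 * K * Cmod s ^ 2)))
  by (unfold kap; ring).
apply (average_bound w (hyperbolic_kernel w lam) B Hw cB HkB r); auto.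
- now apply Hol_app.
- intros z Hz. rewrite <- Hz. apply app_bound; auto. lra.
Qed.

Lemma force_x_hol P : admissible P -> Hol r (force_x P).
Proof.
intros HP s Hs. destruct (step_y_hol P HP s Hs) as [L1 H1].
destruct (Hol_app f P Nf HP s Hs) as [L2 H2]. exists (L1 + L2)%C. now apply Chasderiv_plus.
Qed.

Lemma force_x_bound P s : admissible P -> Cmod s < r ->
  Cmod (force_x P s) <= 8 * K * (kap + 1) * Cmod s ^ 2.
Proof.
intros HP Hs. eapply Rle_trans; [apply Cmod_triangle|].
pose proof (step_y_bound P s HP Hs). pose proof (app_bound f P s Nf HP Hs). lra.
Qed.

Lemma step_quadratic P s : admissible P -> Cmod s < r ->
  N3 (sub3 (step P s) (axis s)) <= E * Cmod s ^ 2.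
Proof.
intros HP Hs.
pose proof (step_y_bound P s HP Hs). pose proof (step_z_bound P s HP Hs).
assert (Cmod (average w (center_kernel w) (force_x P) s) <= 8 * K * (kap * (kap + 1)) * Cmod s ^ 2).
{ replace (8 * K * (kap * (kap + 1)) * Cmod s ^ 2) with
   (period w * (B * (8 * K * (kap + 1) * Cmod s ^ 2))) by (unfold kap; ring).
  apply (average_bound w (center_kernel w) B Hw cA HkA r); auto.
  - now apply force_x_hol.
  - intros z Hz. rewrite <- Hz. apply force_x_bound; auto. lra. }
unfold N3, sub3, step, axis, p1, p2, p3; simpl fst; simpl snd.
replace (s + average w (center_kernel w) (force_x P) s - s)%C with (average w (center_kernel w) (force_x P) s) by ring.
replace (step_y P s - 0)%C with (step_y P s) by ring.
replace (step_z P s - 0)%C with (step_z P s) by ring.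
unfold contraction_const. lra.
Qed.

Lemma step_admissible P : admissible P -> admissible (step P).
Proof.
intros HP. split.
- split; [|split].
  + intros s Hs. unfold step, p1; simpl.
    destruct (Hol_average w (center_kernel w) B Hw cA HkA r (force_x P) (8 * K * (kap + 1) * r ^ 2)) with (z := s) as [L HL]; auto.
    * now apply force_x_hol.
    * intros z Hz. eapply Rle_trans; [now apply force_x_bound|].
      apply Rmult_le_compat_l; [|now apply pow2_lt_r]. apply Rmult_le_pos; lra.
    * exists (1 + L)%C. apply (Chasderiv_plus (fun s => s)); auto. apply Chasderiv_id.
  + now apply step_y_hol.
  + apply (Hol_average w (hyperbolic_kernel w lam) B Hw cB HkB r _ (8 * K * r ^ 2)).
    * now apply Hol_app.
    * now apply app_bound_r.
- intros s Hs. eapply Rle_trans; [now apply step_quadratic|].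
  pose proof (Cmod_ge_0 s).
  assert (0 <= E). { unfold contraction_const. apply Rmult_le_pos; [lra|]. pose proof (pow2_ge_0 kap). lra. }
  assert (E * Cmod s <= 1). { apply Rle_trans with (E * r); [apply Rmult_le_compat_l; lra|lra]. }
  nra.
Qed.

(** The nonlinearities turn a distance D |s| into O(D |s|^2); by [HrE] the surplus factor |s|
    absorbs the constant and leaves 1 / 2. *)
Lemma step_contracts P Q D : admissible P -> admissible Q -> 0 <= D ->
  (forall z, Cmod z < r -> N3 (sub3 (P z) (Q z)) <= D * Cmod z) ->
  forall s, Cmod s < r -> N3 (sub3 (step P s) (step Q s)) <= D / 2 * Cmod s.
Proof.
intros HP HQ PD HD s Hs.
(* Needed on the whole disc and not only at [s]: [step_y] enters the force on [x], which is averaged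
   over the circle through [s]. *)
assert (By : forall z, Cmod z < r -> Cmod (step_y P z - step_y Q z)%C <= 8 * K * kap * D * Cmod z ^ 2).
{ intros z Hz. unfold step_y. rewrite (average_minus w (center_kernel w) Hw cA r); auto; try now apply Hol_app.
  replace (8 * K * kap * D * Cmod z ^ 2) with (period w * (B * (8 * K * D * Cmod z ^ 2)))
    by (unfold kap; ring).
  apply (average_bound w (center_kernel w) B Hw cA HkA r); auto.
  - intros u Hu. destruct (Hol_app g P Ng HP u Hu) as [L1 H1].
    destruct (Hol_app g Q Ng HQ u Hu) as [L2 H2]. exists (L1 - L2)%C. now apply Chasderiv_minus.
  - intros u Hu. rewrite <- Hu. apply app_diff; auto. lra. }
assert (Bz : Cmod (step_z P s - step_z Q s)%C <= 8 * K * kap * D * Cmod s ^ 2).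
{ unfold step_z. rewrite (average_minus w (hyperbolic_kernel w lam) Hw cB r); auto; try now apply Hol_app.
  replace (8 * K * kap * D * Cmod s ^ 2) with (period w * (B * (8 * K * D * Cmod s ^ 2)))
    by (unfold kap; ring).
  apply (average_bound w (hyperbolic_kernel w lam) B Hw cB HkB r); auto.
  - intros u Hu. destruct (Hol_app h P Nh HP u Hu) as [L1 H1].
    destruct (Hol_app h Q Nh HQ u Hu) as [L2 H2]. exists (L1 - L2)%C. now apply Chasderiv_minus.
  - intros u Hu. rewrite <- Hu. apply app_diff; auto. lra. }
assert (Bx : Cmod (average w (center_kernel w) (force_x P) s - average w (center_kernel w) (force_x Q) s)%C
  <= 8 * K * (kap * (kap + 1)) * D * Cmod s ^ 2).
{ rewrite (average_minus w (center_kernel w) Hw cA r); auto; try now apply force_x_hol.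
  replace (8 * K * (kap * (kap + 1)) * D * Cmod s ^ 2) with (period w * (B * (8 * K * (kap + 1) * D * Cmod s ^ 2)))
    by (unfold kap; ring).
  apply (average_bound w (center_kernel w) B Hw cA HkA r); auto.
  - intros u Hu. destruct (force_x_hol P HP u Hu) as [L1 H1].
    destruct (force_x_hol Q HQ u Hu) as [L2 H2]. exists (L1 - L2)%C. now apply Chasderiv_minus.
  - intros u Hu. rewrite <- Hu. unfold force_x.
    replace (step_y P u + app3 f (P u) - (step_y Q u + app3 f (Q u)))%C with
      ((step_y P u - step_y Q u) + (app3 f (P u) - app3 f (Q u)))%C by ring.
    eapply Rle_trans; [apply Cmod_triangle|].
    assert (Hur : Cmod u < r) by lra.
    pose proof (By u Hur). pose proof (app_diff f P Q D u Nf HP HQ HD Hur). lra. }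
specialize (By s Hs).
unfold N3, sub3, step, p1, p2, p3; simpl fst; simpl snd.
replace (s + average w (center_kernel w) (force_x P) s - (s + average w (center_kernel w) (force_x Q) s))%C with
 (average w (center_kernel w) (force_x P) s - average w (center_kernel w) (force_x Q) s)%C by ring.
pose proof (Cmod_ge_0 s).
apply Rle_trans with ((E * Cmod s) * (D * Cmod s)).
- unfold contraction_const. lra.
- assert (0 <= E). { unfold contraction_const. apply Rmult_le_pos; [lra|]. pose proof (pow2_ge_0 kap). lra. }
  assert (E * Cmod s <= 1 / 2). { apply Rle_trans with (E * r); [apply Rmult_le_compat_l; lra|lra]. }
  assert (0 <= D * Cmod s) by now apply Rmult_le_pos.
  nra.
Qed.

Fixpoint picard (n : nat) : C -> C3 :=
  match n with O => axis | S n => step (picard n) end.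

Lemma picard_admissible n : admissible (picard n).
Proof.
induction n; simpl; [|now apply step_admissible].
split.
- split; [|split]; intros s _; unfold axis, p1, p2, p3; simpl.
  + eexists; apply Chasderiv_id.
  + eexists; apply Chasderiv_const.
  + eexists; apply Chasderiv_const.
- intros s _. replace (N3 (sub3 (axis s) (axis s))) with 0; [apply Cmod_ge_0|].
  unfold N3, sub3, axis, p1, p2, p3; simpl.
  replace (s - s)%C with (RtoC 0) by ring. replace (0 - 0)%C with (RtoC 0) by ring.
  rewrite Cmod_0; ring.
Qed.

Lemma picard_cauchy n s : Cmod s < r -> N3 (sub3 (picard (S n) s) (picard n s)) <= Cmod s / 2 ^ n.
Proof.
revert s; induction n; intros s Hs.
- simpl pow. rewrite Rdiv_1_r. apply (picard_admissible 1); auto.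
- simpl picard.
  replace (Cmod s / 2 ^ S n) with (/ 2 ^ n / 2 * Cmod s)
    by (simpl; field; apply pow_nonzero; lra).
  apply step_contracts; auto.
  + apply (picard_admissible (S n)).
  + apply picard_admissible.
  + left. apply Rinv_0_lt_compat, pow_lt; lra.
  + intros z Hz. rewrite Rmult_comm. now apply IHn.
Qed.

Lemma picard_limit : exists P, forall s, Cmod s < r -> forall n,
  N3 (sub3 (picard n s) (P s)) <= 12 * Cmod s / 2 ^ n.
Proof.
apply (choice (fun s p => Cmod s < r -> forall n, N3 (sub3 (picard n s) p) <= 12 * Cmod s / 2 ^ n)).
intros s. destruct (Rlt_or_le (Cmod s) r) as [Hs|Hs]; [|exists (axis s); intros; lra].
assert (L : forall pr : C3 -> C, (forall p q, Cmod (pr p - pr q)%C <= N3 (sub3 p q)) ->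
  exists l, forall n, Cmod (pr (picard n s) - l)%C <= 4 * Cmod s / 2 ^ n).
{ intros pr Hpr. apply geometric_limit. intros n.
  eapply Rle_trans; [apply Hpr|now apply picard_cauchy]. }
destruct (L p1) as [l1 H1]; [intros p q; apply (proj1 (N3_comp (sub3 p q)))|].
destruct (L p2) as [l2 H2]; [intros p q; apply (proj1 (proj2 (N3_comp (sub3 p q))))|].
destruct (L p3) as [l3 H3]; [intros p q; apply (proj2 (proj2 (N3_comp (sub3 p q))))|].
exists (l1, l2, l3). intros _ n.
specialize (H1 n). specialize (H2 n). specialize (H3 n).
change (Cmod (p1 (picard n s) - l1)%C + Cmod (p2 (picard n s) - l2)%C + Cmod (p3 (picard n s) - l3)%C
 <= 12 * Cmod s / 2 ^ n).
unfold Rdiv in *. lra.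
Qed.

Lemma limit_small c s : 0 <= c -> Cmod s < r -> forall eps, 0 < eps ->
  exists n, forall m, (n <= m)%nat -> c * Cmod s / 2 ^ m < eps.
Proof.
intros Hc Hs eps He. destruct (pow_half_small (c * Cmod s) eps He) as [n Hn].
exists n. intros m Hm. eapply Rle_lt_trans; [|apply Hn].
apply Rmult_le_compat_l; [apply Rmult_le_pos; auto; apply Cmod_ge_0|].
apply Rinv_le_contravar; [apply pow_lt; lra|]. apply Rle_pow; auto; lra.
Qed.

Lemma fixed_point_exists : exists P, admissible P /\ forall s, Cmod s < r -> P s = step P s.
Proof.
destruct picard_limit as [P HP]. exists P.
assert (AP : admissible P).
{ split.
  - assert (L : forall pr : C3 -> C, (forall p q, Cmod (pr p - pr q)%C <= N3 (sub3 p q)) ->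
      (forall p, Cmod (pr p) <= N3 p) ->
      (forall n, Hol r (fun s => pr (picard n s))) -> Hol r (fun s => pr (P s))).
    { intros pr H1 H2 H3. apply (Hol_limit r (2 * r) (fun n s => pr (picard n s))); auto.
      - intros n z Hz. eapply Rle_trans; [apply H2|].
        pose proof (admissible_N3 _ z (picard_admissible n) Hz). lra.
      - intros z Hz eps He. destruct (limit_small 12 z ltac:(lra) Hz eps He) as [n Hn].
        exists n. split; [|intros m Hm]; (eapply Rle_lt_trans; [apply H1|]);
        (eapply Rle_lt_trans; [now apply HP|apply Hn; lia]). }
    split; [|split]; apply L; try (intros n; apply (picard_admissible n)); intros;
    try (apply N3_comp).
    + apply (proj1 (N3_comp (sub3 p q))).
    + apply (proj1 (proj2 (N3_comp (sub3 p q)))).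
    + apply (proj2 (proj2 (N3_comp (sub3 p q)))).
  - intros s Hs. apply le_epsilon. intros eps He.
    destruct (limit_small 12 s ltac:(lra) Hs eps He) as [n Hn]. specialize (Hn n (le_n _)).
    pose proof (N3_sub_triangle (P s) (picard n s) (axis s)) as T.
    rewrite (N3_sub_sym (P s) (picard n s)) in T. specialize (HP s Hs n).
    pose proof (proj2 (picard_admissible n) s Hs). lra. }
split; auto. intros s Hs. apply N3_sub_eq. apply le_epsilon. intros eps He.
destruct (limit_small 12 s ltac:(lra) Hs eps He) as [n Hn]. specialize (Hn n (le_n _)).
pose proof (N3_sub_triangle (P s) (picard (S n) s) (step P s)) as T.
rewrite (N3_sub_sym (P s) (picard (S n) s)) in T. pose proof (HP s Hs (S n)) as H1.
assert (P2 : 0 < 2 ^ n) by (apply pow_lt; lra).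
assert (H2 : N3 (sub3 (picard (S n) s) (step P s)) <= 12 / 2 ^ n / 2 * Cmod s).
{ apply step_contracts; auto.
  - apply picard_admissible.
  - left. apply Rdiv_lt_0_compat; lra.
  - intros z Hz. eapply Rle_trans; [now apply HP|]. right. field. lra. }
replace (12 * Cmod s / 2 ^ S n) with (12 * Cmod s / 2 ^ n / 2) in H1 by (simpl; field; lra).
replace (12 / 2 ^ n / 2 * Cmod s) with (12 * Cmod s / 2 ^ n / 2) in H2 by (field; lra).
lra.
Qed.

Lemma fixed_point_unique P Q : admissible P -> admissible Q ->
  (forall s, Cmod s < r -> P s = step P s) -> (forall s, Cmod s < r -> Q s = step Q s) ->
  forall s, Cmod s < r -> P s = Q s.
Proof.
intros HP HQ FP FQ.
(* Both curves are within |s| of the axis, hence the initial factor 2, and each application of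
   [step] halves it. *)
assert (H : forall n s, Cmod s < r -> N3 (sub3 (P s) (Q s)) <= 2 / 2 ^ n * Cmod s).
{ induction n; intros s Hs.
  - pose proof (N3_sub_triangle (P s) (axis s) (Q s)) as T. rewrite (N3_sub_sym (axis s)) in T.
    pose proof (proj2 HP s Hs). pose proof (proj2 HQ s Hs). simpl pow. lra.
  - rewrite FP, FQ; auto.
    assert (0 < 2 ^ n) by (apply pow_lt; lra).
    replace (2 / 2 ^ S n * Cmod s) with (2 / 2 ^ n / 2 * Cmod s) by (simpl; field; lra).
    apply step_contracts; auto. left. apply Rdiv_lt_0_compat; lra. }
intros s Hs. apply N3_sub_eq. apply le_epsilon. intros eps He.
destruct (limit_small 2 s ltac:(lra) Hs eps He) as [n Hn]. specialize (Hn n (le_n _)).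
specialize (H n s Hs). replace (2 / 2 ^ n * Cmod s) with (2 * Cmod s / 2 ^ n) in H by (unfold Rdiv; ring).
lra.
Qed.

Lemma fixed_point_parametrization P : admissible P -> (forall s, Cmod s < r -> P s = step P s) ->
  parametrization w lam f g h r P.
Proof.
intros HP FP. split; [apply HP|]. split.
- intros s Hs t.
  assert (Hc : forall t, Cmod (s * cis (w * t))%C < r) by (intros; now apply Cmod_mult_cis_lt).
  split; [|split].
  + apply (Rderiv_C_ext (fun t => s * cis (w * t) + average w (center_kernel w) (force_x P) (s * cis (w * t)))%C).
    { intros u. rewrite (FP _ (Hc u)). reflexivity. }
    destruct (quadratic_zero (force_x P) r (8 * K * (kap + 1))) as [Z0 Z1]; auto.
    { apply Rmult_le_pos; lra. } { intros; now apply force_x_bound. }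
    pose proof (center_average_ode w Hw r _ s t (force_x_hol P HP) Z0 Z1 Hs) as D.
    eapply Rderiv_C_eq; [apply Rderiv_C_plus; [apply Rderiv_C_scal, cis_deriv|apply D]|].
    unfold Xdot. change (Defs.Ci w) with ((0, w) : C).
    change (s * ((0, w) * cis (w * t)) + ((0, w) * average w (center_kernel w) (force_x P) (s * cis (w * t)) +
       force_x P (s * cis (w * t))) =
     (0, w) * p1 (P (s * cis (w * t))) + p2 (P (s * cis (w * t))) + app3 f (P (s * cis (w * t))))%C.
    rewrite (FP _ (Hc t)) at 1 2.
    unfold force_x at 2. unfold step, p1, p2. cbn [fst snd]. ring.
  + apply (Rderiv_C_ext (fun t => step_y P (s * cis (w * t)))%C).
    { intros u. rewrite (FP _ (Hc u)). reflexivity. }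
    destruct (quadratic_zero (fun s => app3 g (P s)) r (8 * K)) as [Z0 Z1]; auto.
    { lra. } { intros; now apply app_bound. }
    pose proof (center_average_ode w Hw r _ s t (Hol_app g P Ng HP) Z0 Z1 Hs) as D.
    eapply Rderiv_C_eq; [apply D|].
    unfold Ydot. change (Defs.Ci w) with ((0, w) : C).
    change ((0, w) * step_y P (s * cis (w * t)) + app3 g (P (s * cis (w * t))) =
     (0, w) * p2 (P (s * cis (w * t))) + app3 g (P (s * cis (w * t))))%C.
    rewrite (FP _ (Hc t)) at 2. reflexivity.
  + apply (Rderiv_C_ext (fun t => step_z P (s * cis (w * t)))%C).
    { intros u. rewrite (FP _ (Hc u)). reflexivity. }
    pose proof (hyperbolic_average_ode w lam Hw Hlam r _ s t (Hol_app h P Nh HP) Hs) as D.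
    eapply Rderiv_C_eq; [apply D|].
    unfold Zdot.
    change (lam * step_z P (s * cis (w * t)) + app3 h (P (s * cis (w * t))) =
     lam * p3 (P (s * cis (w * t))) + app3 h (P (s * cis (w * t))))%C.
    rewrite (FP _ (Hc t)) at 2. reflexivity.
- exists E. split.
  + unfold contraction_const. apply Rmult_le_pos; [lra|]. pose proof (pow2_ge_0 kap). lra.
  + intros s Hs. rewrite FP; auto. now apply step_quadratic.
Qed.

Lemma parametrization_fixed_point P : parametrization w lam f g h r P -> admissible P ->
  forall s, Cmod s < r -> P s = step P s.
Proof.
intros (_ & HT & K' & HK' & HQ) HP.
(* The second component comes first, because [force_x] is written with [step_y P] and not with the
   second component of [P]. *)
assert (Hy : forall s, Cmod s < r -> p2 (P s) = step_y P s).
{ intros s Hs. apply (center_average_inv w Hw r (fun s => p2 (P s))); auto.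
  - apply HP.
  - now apply Hol_app.
  - apply (quadratic_zero (fun s => p2 (P s)) r K'); auto. intros z Hz.
    eapply Rle_trans; [|now apply HQ].
    replace (p2 (P z)) with (p2 (sub3 (P z) (axis z))); [apply N3_comp|].
    unfold sub3, axis, p2; simpl. ring.
  - apply (quadratic_zero (fun s => p2 (P s)) r K'); auto. intros z Hz.
    eapply Rle_trans; [|now apply HQ].
    replace (p2 (P z)) with (p2 (sub3 (P z) (axis z))); [apply N3_comp|].
    unfold sub3, axis, p2; simpl. ring.
  - intros t. apply (HT s Hs t). }
assert (Hz : forall s, Cmod s < r -> p3 (P s) = step_z P s).
{ intros s Hs. apply (hyperbolic_average_inv w lam Hw Hlam r (fun s => p3 (P s))); auto.
  - apply HP.
  - now apply Hol_app.
  - intros t. apply (HT s Hs t). }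
(* Subtracting [s], which solves the homogeneous equation along circles, leaves a function that is
   O(s^2), as [center_average_inv] demands. *)
assert (Hx : forall s, Cmod s < r -> (p1 (P s) - s)%C = average w (center_kernel w) (force_x P) s).
{ intros s Hs.
  destruct (quadratic_zero (fun s => p1 (P s) - s)%C r K') as [Z0 Z1]; auto.
  { intros z Hz'. eapply Rle_trans; [|now apply HQ].
    apply (proj1 (N3_comp (sub3 (P z) (axis z)))). }
  apply (center_average_inv w Hw r (fun s => p1 (P s) - s)%C); auto.
  - intros z Hz'. destruct (proj1 (proj1 HP) z Hz') as [L HL]. exists (L - 1)%C.
    apply Chasderiv_minus; auto. apply Chasderiv_id.
  - now apply force_x_hol.
  - intros t. pose proof (proj1 (HT s Hs t)) as D.
    pose proof (Rderiv_C_minus _ _ _ _ _ D (Rderiv_C_scal s _ _ _ (cis_deriv w t))) as D2.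
    eapply Rderiv_C_eq; [apply D2|].
    unfold Xdot. change (Defs.Ci w) with ((0, w) : C).
    change ((0, w) * p1 (P (s * cis (w * t))) + p2 (P (s * cis (w * t))) + app3 f (P (s * cis (w * t)))
       - s * ((0, w) * cis (w * t)) = (0, w) * (p1 (P (s * cis (w * t))) - s * cis (w * t)) +
         force_x P (s * cis (w * t)))%C.
    rewrite (Hy (s * cis (w * t))%C) by now apply Cmod_mult_cis_lt. unfold force_x. ring. }
intros s Hs. unfold step. rewrite <- Hx, <- Hy, <- Hz; auto.
replace (s + (p1 (P s) - s))%C with (p1 (P s)) by ring.
destruct (P s) as [[x y] z]. reflexivity.
Qed.

End Parametrization.

Lemma parametrization_shrink w lam f g h r r' P : parametrization w lam f g h r P -> r' <= r -> parametrization w lam f g h r' P.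
Proof.
intros ((H1 & H2 & H3) & HT & K & HK & HQ) Hr. split; [|split].
- repeat split; eapply Hol_le; eauto.
- intros s Hs. apply HT. lra.
- exists K; split; auto. intros s Hs. apply HQ. lra.
Qed.

Lemma quadratic_germ_common d1 K1 f d2 K2 g d3 K3 h : quadratic_germ d1 K1 f -> quadratic_germ d2 K2 g -> quadratic_germ d3 K3 h ->
  exists d K, quadratic_germ d K f /\ quadratic_germ d K g /\ quadratic_germ d K h.
Proof.
intros H1 H2 H3. exists (Rmin d1 (Rmin d2 d3)), (Rmax K1 (Rmax K2 K3)).
pose proof (proj1 H1). pose proof (proj1 H2). pose proof (proj1 H3).
pose proof (Rmin_l d1 (Rmin d2 d3)). pose proof (Rmin_r d1 (Rmin d2 d3)).
pose proof (Rmin_l d2 d3). pose proof (Rmin_r d2 d3).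
pose proof (Rmax_l K1 (Rmax K2 K3)). pose proof (Rmax_r K1 (Rmax K2 K3)).
pose proof (Rmax_l K2 K3). pose proof (Rmax_r K2 K3).
assert (0 < Rmin d1 (Rmin d2 d3)) by (apply Rmin_pos; auto; now apply Rmin_pos).
split; [|split].
- apply quadratic_germ_shrink with d1; [apply quadratic_germ_increase with K1; auto|lra].
- apply quadratic_germ_shrink with d2; [apply quadratic_germ_increase with K2; auto; lra|lra].
- apply quadratic_germ_shrink with d3; [apply quadratic_germ_increase with K3; auto; lra|lra].
Qed.

(** * Existence and uniqueness of the germ of the parametrization *)

Section Main.

Variables (w : R) (lam : C) (f g h : C -> C -> C -> C).
Hypothesis Hw : w <> 0.
Hypothesis Hlam : Cre lam <> 0.
Hypothesis HN : exists d K, quadratic_germ d K f /\ quadratic_germ d K g /\ quadratic_germ d K h.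

Lemma parametrization_exists : exists r P, 0 < r /\ parametrization w lam f g h r P.
Proof.
destruct HN as (d & K & Nf & Ng & Nh).
destruct (kernels_bounded w lam Hw Hlam) as (B & HB & HkB).
set (E := contraction_const w K B).
set (r := Rmin (d / 2) (1 / (2 * (Rabs E + 1)))).
pose proof (Rabs_pos E). pose proof (Rle_abs E). pose proof (proj1 Nf).
assert (Hr : 0 < r) by (apply Rmin_pos; [|apply Rdiv_lt_0_compat]; lra).
assert (R1 : r <= d / 2) by apply Rmin_l.
assert (R2 : E * r <= 1 / 2).
{ apply Rle_trans with ((Rabs E + 1) * (1 / (2 * (Rabs E + 1)))).
  - apply Rle_trans with ((Rabs E + 1) * r); [apply Rmult_le_compat_r; lra|].
    apply Rmult_le_compat_l; [lra|apply Rmin_r].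
  - right. field. lra. }
destruct (fixed_point_exists w lam f g h d K B Hw) with (r := r) as (P & AP & FP); auto; try lra.
1,2: intros t Ht; apply HkB, Ht.
exists r, P. split; auto. apply (fixed_point_parametrization w lam f g h d K B); auto; try lra.
1,2: intros t Ht; apply HkB, Ht.
Qed.

(** The two curves need not be admissible on their own discs, but the quadratic bound makes them so
    on a smaller common disc, where both are fixed points of the same contraction. *)
Lemma parametrization_unique r1 P r2 Q : 0 < r1 -> 0 < r2 ->
  parametrization w lam f g h r1 P -> parametrization w lam f g h r2 Q ->
  exists r, 0 < r /\ forall s, Cmod s < r -> P s = Q s.
Proof.
intros Hr1 Hr2 SP SQ.
destruct HN as (d & K & Nf & Ng & Nh).
destruct (kernels_bounded w lam Hw Hlam) as (B & HB & HkB).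
destruct SP as (A1 & A2 & M1 & HM1 & Q1). destruct SQ as (B1 & B2 & M2 & HM2 & Q2).
(* One bound for the contraction constant and for the two quadratic constants, so that a single
   radius serves all three. *)
set (E := Rabs (contraction_const w K B) + M1 + M2).
set (r := Rmin (Rmin r1 r2) (Rmin (d / 2) (1 / (2 * (E + 1))))).
pose proof (Rabs_pos (contraction_const w K B)). pose proof (Rle_abs (contraction_const w K B)).
pose proof (proj1 Nf).
assert (HE : 0 <= E) by (unfold E; lra).
assert (Hr : 0 < r).
{ repeat apply Rmin_pos; auto; try lra. apply Rdiv_lt_0_compat; lra. }
pose proof (Rmin_l (Rmin r1 r2) (Rmin (d / 2) (1 / (2 * (E + 1))))).
pose proof (Rmin_r (Rmin r1 r2) (Rmin (d / 2) (1 / (2 * (E + 1))))).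
pose proof (Rmin_l r1 r2). pose proof (Rmin_r r1 r2).
pose proof (Rmin_l (d / 2) (1 / (2 * (E + 1)))). pose proof (Rmin_r (d / 2) (1 / (2 * (E + 1)))).
fold r in H2, H3.
assert (RE : (E + 1) * r <= 1 / 2).
{ apply Rle_trans with ((E + 1) * (1 / (2 * (E + 1)))).
  - apply Rmult_le_compat_l; lra.
  - right. field. lra. }
assert (Adm : forall P M, Hol3 r P -> 0 <= M -> M <= E ->
   (forall s, Cmod s < r -> N3 (sub3 (P s) (axis s)) <= M * Cmod s ^ 2) -> admissible r P).
{ clear - RE Hr HE. intros P M HP HM HME HQ. split; auto. intros s Hs.
  eapply Rle_trans; [now apply HQ|]. pose proof (Cmod_ge_0 s).
  assert (M * Cmod s <= 1). { apply Rle_trans with ((E + 1) * r); [|lra].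
    apply Rmult_le_compat; lra. }
  nra. }
assert (SP : parametrization w lam f g h r P).
{ apply parametrization_shrink with r1; [|lra]. split; [|split]; auto. exists M1; auto. }
assert (SQ : parametrization w lam f g h r Q).
{ apply parametrization_shrink with r2; [|lra]. split; [|split]; auto. exists M2; auto. }
assert (AP : admissible r P).
{ apply (Adm P M1); auto; [apply SP|unfold E; lra|]. intros s Hs. apply Q1. lra. }
assert (AQ : admissible r Q).
{ apply (Adm Q M2); auto; [apply SQ|unfold E; lra|]. intros s Hs. apply Q2. lra. }
exists r; split; auto.
assert (R3 : contraction_const w K B * r <= 1 / 2).
{ eapply Rle_trans; [|apply RE]. apply Rmult_le_compat_r; [lra|]. unfold E; lra. }
assert (kb1 : forall t, 0 <= t <= period w -> Cmod (center_kernel w t) <= B) by (intros; now apply HkB).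
assert (kb2 : forall t, 0 <= t <= period w -> Cmod (hyperbolic_kernel w lam t) <= B) by (intros; now apply HkB).
apply (fixed_point_unique w lam f g h d K B); auto; try lra;
apply (parametrization_fixed_point w lam f g h d K B); auto; lra.
Qed.

End Main.

(** * Functions of one variable as quadratic germs *)

Lemma quadratic_germ_of_Hol r u : 0 < r -> Hol r u -> u (RtoC 0) = 0 -> Chasderiv u (RtoC 0) (RtoC 0) ->
  exists d K, quadratic_germ d K (fun x _ _ => u x).
Proof.
intros Hr Hu U0 U1. apply quadratic_germ_of_Holo3.
- exists r. split; auto. split.
  + intros x y z (Hx & _) eps He. destruct (Hu x Hx) as [L HL].
    destruct (Chasderiv_lipschitz _ _ _ HL) as (e & He' & B).
    pose proof (Cmod_ge_0 L).
    exists (Rmin e (eps / (Cmod L + 1))). split.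
    { apply Rmin_pos; auto. apply Rdiv_lt_0_compat; lra. }
    intros x' _ _ Hx' _ _. set (k := (x' - x)%C).
    assert (Hk : Cmod k < Rmin e (eps / (Cmod L + 1))) by exact Hx'.
    specialize (B k (Rlt_le_trans _ _ _ Hk (Rmin_l _ _))).
    assert (Ek : forall a b : C, (a + (b - a) = b)%C) by (intros; ring).
    unfold k in B at 1. rewrite Ek in B.
    pose proof (Rlt_le_trans _ _ _ Hk (Rmin_r _ _)) as Hk2.
    apply Rmult_lt_compat_l with (r := Cmod L + 1) in Hk2; [|lra].
    replace ((Cmod L + 1) * (eps / (Cmod L + 1))) with eps in Hk2 by (field; lra).
    exact (Rle_lt_trans _ _ _ B Hk2).
  + intros x y z (Hx & _). split; [apply Hu, Hx|].
    split; eexists; apply Chasderiv_const.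
- split; [exact U0|]. split; [exact U1|]. split; apply Chasderiv_const.
Qed.

Lemma Hol_lip_near0 r u : 0 < r -> Hol r u -> u (RtoC 0) = 0 -> Chasderiv u (RtoC 0) (RtoC 0) ->
  exists d K, 0 < d /\ 0 <= K /\ (forall x, Cmod x < d -> Cmod (u x) <= K * Cmod x ^ 2) /\
   forall x y, Cmod x < d -> Cmod y < d ->
     Cmod (u y - u x)%C <= K * (Cmod x + Cmod y) * Cmod (y - x).
Proof.
intros Hr Hu U0 U1. destruct (quadratic_germ_of_Hol r u Hr Hu U0 U1) as (d & K & HN).
exists d, (2 * K). pose proof (proj1 HN). pose proof (proj1 (proj2 HN)).
split; auto. split; [lra|]. split.
- intros x Hx. pose proof (quadratic_germ_bound d K _ (axis x) HN) as Q.
  rewrite N3_axis in Q. now apply Q.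
- intros x y Hx Hy. pose proof (quadratic_germ_lip d K _ (axis x) (axis y) HN) as Q.
  rewrite !N3_axis in Q. specialize (Q Hx Hy).
  replace (N3 (sub3 (axis y) (axis x))) with (Cmod (y - x)%C) in Q; [exact Q|].
  unfold N3, sub3, axis, p1, p2, p3; simpl.
  replace (0 - 0)%C with (RtoC 0) by ring. rewrite Cmod_0. ring.
Qed.

(** * Local inverse of a map tangent to the identity *)

Section Inverse.

Variables (X : C -> C) (rho : R).
Hypothesis Hrho : 0 < rho.
Hypothesis HX : Hol rho X.
Hypothesis X0 : X (RtoC 0) = 0.
Hypothesis X_near_id : forall s t, Cmod s < rho -> Cmod t < rho ->
  Cmod ((X t - t) - (X s - s))%C <= / 2 * Cmod (t - s).

Lemma expanding s t : Cmod s < rho -> Cmod t < rho -> Cmod (t - s) <= 2 * Cmod (X t - X s).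
Proof.
intros Hs Ht. pose proof (X_near_id s t Hs Ht).
pose proof (Cmod_triangle_rev (t - s) (X t - X s)) as T.
replace (t - s - (X t - X s))%C with (- ((X t - t) - (X s - s)))%C in T by ring.
rewrite Cmod_opp in T. lra.
Qed.

Lemma X_injective s t : Cmod s < rho -> Cmod t < rho -> X s = X t -> s = t.
Proof.
intros Hs Ht E. pose proof (expanding s t Hs Ht) as B. rewrite E in B.
replace (X t - X t)%C with (RtoC 0) in B by ring. rewrite Cmod_0, Rmult_0_r in B.
assert (Z : (t - s)%C = 0) by (apply Cmod_eq_0, Rle_antisym; auto; apply Cmod_ge_0).
replace t with ((t - s) + s)%C by ring. rewrite Z. ring.
Qed.

Lemma X_bound s : Cmod s < rho -> Cmod (X s) <= 3 / 2 * Cmod s.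
Proof.
intros Hs. assert (H0 : Cmod 0 < rho) by (rewrite Cmod_0; auto).
pose proof (X_near_id 0 s H0 Hs) as B. rewrite X0 in B.
replace (X s - s - (0 - 0))%C with (X s - s)%C in B by ring.
replace (s - 0)%C with s in B by ring.
pose proof (Cmod_triangle_rev (X s) s). lra.
Qed.

Lemma X_surjective x : Cmod x < rho / 2 -> exists s, Cmod s <= 2 * Cmod x /\ X s = x.
Proof.
intros Hx. pose proof (Cmod_ge_0 x) as Px.
set (c := fix c n := match n with O => RtoC 0 | S n => (x - (X (c n) - c n))%C end).
assert (B : forall n, Cmod (c n) <= 2 * Cmod x).
{ induction n; [simpl; rewrite Cmod_0; lra|].
  change (c (S n)) with (x - (X (c n) - c n))%C.
  eapply Rle_trans; [apply Cmod_minus_le|].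
  assert (H0 : Cmod 0 < rho) by (rewrite Cmod_0; auto).
  pose proof (X_near_id 0 (c n) H0 ltac:(lra)) as Q. rewrite X0 in Q.
  replace (X (c n) - c n - (0 - 0))%C with (X (c n) - c n)%C in Q by ring.
  replace (c n - 0)%C with (c n) in Q by ring. lra. }
destruct (geometric_limit c (Cmod x)) as [s Hs].
{ induction n.
  - simpl. rewrite X0. replace (x - (0 - 0) - 0)%C with x by ring. lra.
  - change (c (S (S n))) with (x - (X (c (S n)) - c (S n)))%C.
    change (c (S n)) with (x - (X (c n) - c n))%C at 3.
    replace (x - (X (c (S n)) - c (S n)) - (x - (X (c n) - c n)))%C with
      (- ((X (c (S n)) - c (S n)) - (X (c n) - c n)))%C by ring.
    rewrite Cmod_opp. eapply Rle_trans; [apply X_near_id|].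
    + eapply Rle_lt_trans; [apply B|lra].
    + eapply Rle_lt_trans; [apply B|lra].
    + replace (Cmod x / 2 ^ S n) with (/ 2 * (Cmod x / 2 ^ n))
        by (simpl; field; apply pow_nonzero; lra). lra. }
assert (Bs : Cmod s <= 2 * Cmod x).
{ apply le_epsilon. intros eps He. destruct (pow_half_small (4 * Cmod x) eps He) as [n Hn].
  pose proof (Cmod_triangle_rev s (c n)) as T. rewrite Cmod_minus_sym in T.
  specialize (Hs n). specialize (B n). lra. }
exists s. split; auto.
assert (Z : (X s - x)%C = 0).
{ apply Cmod_eq_0, Rle_antisym; [|apply Cmod_ge_0]. apply le_epsilon. intros eps He.
  destruct (pow_half_small (4 * Cmod x) eps He) as [n Hn].
  assert (Hn1 := Hs (S n)). specialize (Hs n).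
  pose proof (X_near_id s (c n) ltac:(lra) ltac:(eapply Rle_lt_trans; [apply B|lra])) as Q.
  change (c (S n)) with (x - (X (c n) - c n))%C in Hn1.
  replace (X s - x)%C with (- ((X (c n) - c n - (X s - s)) + (x - (X (c n) - c n) - s)))%C by ring.
  rewrite Cmod_opp. eapply Rle_trans; [apply Cmod_triangle|].
  replace (4 * Cmod x / 2 ^ S n) with (4 * Cmod x / 2 ^ n / 2) in Hn1
    by (simpl; field; apply pow_nonzero; lra).
  lra. }
replace x with (x + 0)%C by ring. rewrite <- Z. ring.
Qed.

Lemma inverse_exists : exists S : C -> C,
  (forall x, Cmod x < rho / 2 -> Cmod (S x) <= 2 * Cmod x /\ X (S x) = x) /\ Hol (rho / 2) S.
Proof.
assert (H : forall x, exists s, Cmod x < rho / 2 -> Cmod s <= 2 * Cmod x /\ X s = x).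
{ intros x. destruct (Rlt_or_le (Cmod x) (rho / 2)) as [Hx|Hx].
  - destruct (X_surjective x Hx) as [s Hs]. now exists s.
  - exists 0%C. intros; lra. }
apply choice in H. destruct H as [S HS]. exists S. split; auto.
intros x Hx. destruct (HS x Hx) as [B E].
assert (Hs : Cmod (S x) < rho) by lra.
destruct (HX (S x) Hs) as [L HL].
(* With zero derivative, [X] would shrink small displacements at [S x] by a factor 4, whereas
   [expanding] allows at most 2. *)
assert (PL : 0 < Cmod L).
{ apply Rnot_le_lt. intros HL0.
  destruct (HL (/ 4)) as (e & He & K); [lra|].
  set (t := Rmin e (rho - Cmod (S x)) / 2).
  pose proof (Rmin_l e (rho - Cmod (S x))). pose proof (Rmin_r e (rho - Cmod (S x))).
  assert (0 < Rmin e (rho - Cmod (S x))) by (apply Rmin_pos; lra).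
  assert (Mt : Cmod t = t) by (rewrite Cmod_R, Rabs_pos_eq; unfold t; lra).
  specialize (K (RtoC t)). change (Cabs (RtoC t)) with (Cmod t) in K. rewrite Mt in K.
  specialize (K ltac:(unfold t; lra)).
  change (Cmod (X (S x + t) - X (S x) - L * t)%C <= / 4 * t) in K.
  assert (L0 : (L : C) = 0) by (apply Cmod_eq_0, Rle_antisym; auto; apply Cmod_ge_0).
  rewrite L0 in K. replace (X (S x + t) - X (S x) - 0 * t)%C with (X (S x + t) - X (S x))%C in K by ring.
  pose proof (expanding (S x) (S x + t)%C Hs) as Q.
  replace (S x + t - S x)%C with (RtoC t) in Q by ring. rewrite Mt in Q.
  assert (Cmod (S x + t)%C < rho).
  { eapply Rle_lt_trans; [apply Cmod_triangle|]. rewrite Mt. unfold t. lra. }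
  specialize (Q H2). unfold t in *. lra. }
assert (NL : (L : C) <> 0) by now apply Cmod_gt_0.
exists (/ L)%C. intros eps He.
(* The inverse at most doubles distances, and the remainder is divided by L at the end. *)
destruct (HL (eps * Cmod L / 2)) as (e & He' & K).
{ assert (0 < eps * Cmod L) by now apply Rmult_lt_0_compat. lra. }
exists (Rmin (e / 2) (rho / 2 - Cmod x)). split; [apply Rmin_pos; lra|].
intros h Hh. change Cx with C in h. change (Cmod (S (x + h) - S x - / L * h)%C <= eps * Cmod h).
change (Cabs h) with (Cmod h) in Hh.
pose proof (Rlt_le_trans _ _ _ Hh (Rmin_l _ _)). pose proof (Rlt_le_trans _ _ _ Hh (Rmin_r _ _)).
assert (Hxh : Cmod (x + h) < rho / 2) by (eapply Rle_lt_trans; [apply Cmod_triangle|]; lra).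
destruct (HS _ Hxh) as [B' E'].
set (k := (S (x + h) - S x)%C).
assert (Ek : (S x + k)%C = S (x + h)%C) by (unfold k; ring).
assert (Bk : Cmod k <= 2 * Cmod h).
{ unfold k. eapply Rle_trans; [apply expanding; lra|]. rewrite E, E'.
  replace (x + h - x)%C with h by ring. lra. }
specialize (K k). change (Cabs k) with (Cmod k) in K. specialize (K ltac:(lra)).
change (Cmod (X (S x + k) - X (S x) - L * k)%C <= eps * Cmod L / 2 * Cmod k) in K.
rewrite Ek, E, E' in K. replace (x + h - x - L * k)%C with (h - L * k)%C in K by ring.
fold k. replace (k - / L * h)%C with (- ((h - L * k) / L))%C by (field; auto).
rewrite Cmod_opp, Cmod_div; auto.
apply Rmult_le_reg_r with (Cmod L); auto.
unfold Rdiv. rewrite Rmult_assoc, Rinv_l, Rmult_1_r; [|lra].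
eapply Rle_trans; [apply K|].
apply Rle_trans with (eps * Cmod L / 2 * (2 * Cmod h)); [|right; field].
apply Rmult_le_compat_l; auto.
assert (0 < eps * Cmod L) by now apply Rmult_lt_0_compat. lra.
Qed.

End Inverse.

(** * Uniqueness of trajectories *)

(** The inequality is available only while E < eta, so the usual argument is combined with
    continuation: [tau] is the last time up to which E vanishes. By continuity E stays below eta a
    little longer, where E e^{-Mt} cannot increase, so E vanishes beyond [tau] unless tau = t1. *)
Lemma gronwall_pos (E E' : R -> R) eta M : 0 < eta ->
  (forall t, derivable_pt_lim E t (E' t)) -> (forall t, 0 <= E t) -> E 0 = 0 ->
  (forall t, E t < eta -> E' t <= M * E t) -> forall t, 0 <= t -> E t = 0.
Proof.
intros Heta HE PE E0 HB t1 Ht1. apply NNPP. intros NE.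
destruct (completeness (fun t => 0 <= t <= t1 /\ forall u, 0 <= u <= t -> E u = 0)) as [tau [U L]].
{ exists t1. intros t [Ht _]. lra. }
{ exists 0. split; [lra|]. intros u Hu. replace u with 0 by lra. auto. }
assert (T0 : 0 <= tau).
{ apply U. split; [lra|]. intros u Hu. replace u with 0 by lra. auto. }
assert (T1 : tau <= t1) by (apply L; intros t [Ht _]; lra).
assert (Z : forall u, 0 <= u < tau -> E u = 0).
{ intros u Hu. apply NNPP. intros Nu.
  assert (tau <= u); [|lra]. apply L. intros t [Ht Hz].
  apply Rnot_lt_le. intros Hut. apply Nu, Hz. lra. }
assert (Cont : forall t eps, 0 < eps -> exists e, 0 < e /\ forall s, Rabs (s - t) < e -> Rabs (E s - E t) < eps).
{ intros t. apply Rcontinuous_eps. apply (ex_derive_continuous (V:=R_NormedModule)).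
  exists (E' t). apply is_derive_Reals, HE. }
assert (Zt : E tau = 0).
{ apply Rle_antisym; auto. apply Rnot_lt_le. intros P.
  destruct (Cont tau (E tau) P) as (e & He & K).
  destruct (Rle_lt_or_eq_dec 0 tau T0) as [Pt|Pt]; [|subst tau; lra].
  set (s := Rmax 0 (tau - e / 2)).
  assert (Hs : 0 <= s < tau /\ tau - s < e).
  { unfold s. pose proof (Rmax_l 0 (tau - e / 2)). pose proof (Rmax_r 0 (tau - e / 2)).
    assert (Rmax 0 (tau - e / 2) < tau) by (apply Rmax_lub_lt; lra). lra. }
  specialize (K s). rewrite (Z s ltac:(lra)) in K.
  assert (Rabs (s - tau) < e) by (apply Rabs_def1; lra).
  specialize (K H). rewrite Rminus_0_l, Rabs_Ropp, Rabs_pos_eq in K; lra. }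
destruct (Cont tau eta Heta) as (e & He & K).
assert (Nt : tau <> t1) by congruence.
set (b := Rmin t1 (tau + e / 2)).
assert (Hb : tau < b <= t1 /\ b < tau + e).
{ unfold b. pose proof (Rmin_l t1 (tau + e / 2)). pose proof (Rmin_r t1 (tau + e / 2)).
  assert (tau < Rmin t1 (tau + e / 2)) by (apply Rmin_glb_lt; lra). lra. }
assert (tau >= b); [|lra]. apply Rle_ge, U. split; [lra|]. intros u Hu.
destruct (Rlt_or_le u tau) as [Hut|Hut]; [apply Z; lra|].
destruct (Rle_lt_or_eq_dec _ _ Hut) as [Hut'|<-]; auto.
destruct (MVT_cor2 (fun t => E t * exp (- M * t)) (fun t => E' t * exp (- M * t) + E t * (- M * exp (- M * t))) tau u)
  as (c & Ec & Hc); auto.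
{ intros c Hc. apply (derivable_pt_lim_mult E (fun t => exp (- M * t))); auto.
  apply is_derive_Reals. auto_derive; auto. ring. }
rewrite Zt, Rmult_0_l, Rminus_0_r in Ec.
assert (Ec' : E c < eta).
{ assert (Hcb : Rabs (c - tau) < e) by (apply Rabs_def1; lra).
  specialize (K c Hcb). rewrite Zt, Rminus_0_r, Rabs_pos_eq in K; auto. }
specialize (HB c Ec'). pose proof (exp_pos (- M * c)). pose proof (exp_pos (- M * u)).
assert (E u * exp (- M * u) <= 0).
{ rewrite Ec. replace (E' c * exp (- M * c) + E c * (- M * exp (- M * c))) with
   ((E' c - M * E c) * exp (- M * c)) by ring. 
  assert ((E' c - M * E c) * exp (- M * c) <= 0) by nra. nra. }
specialize (PE u). apply Rle_antisym; auto. nra.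
Qed.

Lemma gronwall (E E' : R -> R) eta M : 0 < eta ->
  (forall t, derivable_pt_lim E t (E' t)) -> (forall t, 0 <= E t) -> E 0 = 0 ->
  (forall t, E t < eta -> Rabs (E' t) <= M * E t) -> forall t, E t = 0.
Proof.
intros Heta HE PE E0 HB t. destruct (Rle_or_lt 0 t) as [Ht|Ht].
- apply (gronwall_pos E E' eta M); auto. intros u Hu. eapply Rle_trans; [apply Rle_abs|auto].
- replace t with (- - t) by ring.
  apply (gronwall_pos (fun t => E (- t)) (fun t => - E' (- t)) eta M); auto; try lra.
  + intros u. replace (- E' (- u)) with (E' (- u) * -1) by ring.
    apply (derivable_pt_lim_comp (fun t => - t) E).
    * apply (derivable_pt_lim_opp (fun t => t)). apply derivable_pt_lim_id.
    * apply HE.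
  + now rewrite Ropp_0.
  + intros u Hu. eapply Rle_trans; [apply Rle_abs|]. rewrite Rabs_Ropp. auto.
Qed.

Lemma Rderiv_C_unique f t (v v' : C) : Rderiv_C f t v -> Rderiv_C f t v' -> v = v'.
Proof.
intros [H1 H2] [H3 H4]. apply injective_projections.
- eapply uniqueness_limite; eauto.
- eapply uniqueness_limite; eauto.
Qed.

Lemma Cmod2_deriv f t (v : C) : Rderiv_C f t v ->
  derivable_pt_lim (fun t => Cmod (f t) ^ 2) t (2 * (fst (f t) * fst v + snd (f t) * snd v)).
Proof.
intros [H1 H2]. apply is_derive_Reals.
apply (is_derive_ext (fun t => fst (f t) * fst (f t) + snd (f t) * snd (f t))).
{ assert (Q : forall z : C, fst z * fst z + snd z * snd z = Cmod z ^ 2).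
  { intros z. rewrite Cmod2_alt. unfold Re, Im. ring. }
  intros u. apply Q. }
replace (2 * (fst (f t) * fst v + snd (f t) * snd v)) with
 ((fst v * fst (f t) + fst (f t) * fst v) + (snd v * snd (f t) + snd (f t) * snd v)) by ring.
apply is_derive_Reals.
apply (derivable_pt_lim_plus (fun t => fst (f t) * fst (f t)) (fun t => snd (f t) * snd (f t)));
now apply (derivable_pt_lim_mult (fun s => _ (f s)) (fun s => _ (f s))).
Qed.

Lemma Re_inner_le (a b : C) : Rabs (fst a * fst b + snd a * snd b) <= Cmod a * Cmod b.
Proof.
rewrite <- (Cmod_conj a), <- Cmod_mult.
eapply Rle_trans; [|apply fst_le_Cmod]. right. simpl. f_equal. ring.
Qed.

Section Trajectories.

Variables (w : R) (lam : C) (f g h : C -> C -> C -> C) (d K : R).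
Hypotheses (Nf : quadratic_germ d K f) (Ng : quadratic_germ d K g) (Nh : quadratic_germ d K h).

(** Only the first trajectory is known to stay in the ball of radius d / 2. While the second is
    within d / 2 of it, both lie in the domain of the germs and the Lipschitz bounds apply; the
    threshold in [gronwall] takes care of the rest. *)
Lemma trajectory_unique (a1 a2 a3 b1 b2 b3 : R -> C) :
  trajectory w lam f g h a1 a2 a3 -> trajectory w lam f g h b1 b2 b3 ->
  (forall t, N3 (a1 t, a2 t, a3 t) <= d / 2) ->
  a1 0 = b1 0 -> a2 0 = b2 0 -> a3 0 = b3 0 ->
  forall t, a1 t = b1 t /\ a2 t = b2 t /\ a3 t = b3 t.
Proof.
intros TA TB HA I1 I2 I3.
pose proof (proj1 Nf) as Hd. pose proof (proj1 (proj2 Nf)) as HK.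
set (a := fun t => (a1 t, a2 t, a3 t) : C3). set (b := fun t => (b1 t, b2 t, b3 t) : C3).
set (D1 := fun t => (b1 t - a1 t)%C). set (D2 := fun t => (b2 t - a2 t)%C).
set (D3 := fun t => (b3 t - a3 t)%C).
set (V1 := fun t => (Xdot w f (b1 t) (b2 t) (b3 t) - Xdot w f (a1 t) (a2 t) (a3 t))%C).
set (V2 := fun t => (Ydot w g (b1 t) (b2 t) (b3 t) - Ydot w g (a1 t) (a2 t) (a3 t))%C).
set (V3 := fun t => (Zdot lam h (b1 t) (b2 t) (b3 t) - Zdot lam h (a1 t) (a2 t) (a3 t))%C).
assert (HD1 : forall t, Rderiv_C D1 t (V1 t)) by (intros t; apply Rderiv_C_minus; [apply TB|apply TA]).
assert (HD2 : forall t, Rderiv_C D2 t (V2 t)) by (intros t; apply Rderiv_C_minus; [apply TB|apply TA]).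
assert (HD3 : forall t, Rderiv_C D3 t (V3 t)) by (intros t; apply Rderiv_C_minus; [apply TB|apply TA]).
set (N := fun t => Cmod (D1 t) + Cmod (D2 t) + Cmod (D3 t)).
assert (EN : forall t, N3 (sub3 (b t) (a t)) = N t) by reflexivity.
set (E := fun t => Cmod (D1 t) ^ 2 + Cmod (D2 t) ^ 2 + Cmod (D3 t) ^ 2).
assert (NE : forall t, N t ^ 2 <= 3 * E t).
{ intros t. unfold N, E.
  pose proof (pow2_ge_0 (Cmod (D1 t) - Cmod (D2 t))).
  pose proof (pow2_ge_0 (Cmod (D1 t) - Cmod (D3 t))).
  pose proof (pow2_ge_0 (Cmod (D2 t) - Cmod (D3 t))). lra. }
assert (PN : forall t, 0 <= N t) by (intros t; rewrite <- EN; apply N3_ge0).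
set (I := fun x v : C => fst x * fst v + snd x * snd v).
set (E' := fun t => 2 * I (D1 t) (V1 t) + 2 * I (D2 t) (V2 t) + 2 * I (D3 t) (V3 t)).
set (Lam := Rabs w + Cmod lam + 1 + 4 * K * d).
assert (Z : forall t, E t = 0).
(* Since N^2 <= 3 E, the threshold d^2 / 12 forces N < d / 2. Each velocity difference is at most
   Lam N, so |E'| <= 2 Lam N^2 <= 6 Lam E. *)
{ apply (gronwall E E' (d ^ 2 / 12) (6 * Lam)).
  - apply Rdiv_lt_0_compat; [apply pow_lt; auto|lra].
  - intros t. unfold E, E'.
    apply (derivable_pt_lim_plus (fun t => Cmod (D1 t) ^ 2 + Cmod (D2 t) ^ 2) (fun t => Cmod (D3 t) ^ 2)).
    + apply (derivable_pt_lim_plus (fun t => Cmod (D1 t) ^ 2) (fun t => Cmod (D2 t) ^ 2));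
      now apply Cmod2_deriv.
    + now apply Cmod2_deriv.
  - intros t. unfold E. pose proof (pow2_ge_0 (Cmod (D1 t))). pose proof (pow2_ge_0 (Cmod (D2 t))).
    pose proof (pow2_ge_0 (Cmod (D3 t))). lra.
  - assert (Q : forall x y : C, x = y -> Cmod (y - x) = 0).
    { intros x y ->. replace (y - y)%C with (RtoC 0) by ring. apply Cmod_0. }
    unfold E, D1, D2, D3. rewrite !Q; auto. ring.
  - intros t Ht.
    assert (Nt : N t < d / 2).
    { apply Rnot_le_lt. intros Hn. specialize (NE t).
      assert ((d / 2) ^ 2 <= N t ^ 2) by (apply pow_incr; lra).
      replace ((d / 2) ^ 2) with (3 * (d ^ 2 / 12)) in H by field. lra. }
    specialize (HA t). fold (a t) in HA.
    assert (Hb : N3 (b t) < d).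
    { eapply Rle_lt_trans; [apply (N3_triangle _ (a t))|]. rewrite EN. lra. }
    assert (LF : forall F, quadratic_germ d K F -> Cmod (app3 F (b t) - app3 F (a t))%C <= 4 * K * d * N t).
    { intros F HF. eapply Rle_trans; [apply (quadratic_germ_lip d K F (a t) (b t) HF); lra|].
      rewrite EN. apply Rmult_le_compat_r; auto.
      replace (4 * K * d) with (2 * K * (2 * d)) by ring. apply Rmult_le_compat_l; lra. }
    pose proof (Cmod_ge_0 lam). pose proof (Rabs_pos w).
    pose proof (Cmod_ge_0 (D1 t)). pose proof (Cmod_ge_0 (D2 t)). pose proof (Cmod_ge_0 (D3 t)).
    assert (Miw : Cmod ((0, w) : C) = Rabs w).
    { replace ((0, w) : C) with (Ci * w)%C by Ceq. rewrite Cmod_mult, Cmod_Ci, Cmod_R. ring. }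
    assert (ND1 : Cmod (D1 t) <= N t) by (unfold N; lra).
    assert (ND2 : Cmod (D2 t) <= N t) by (unfold N; lra).
    assert (ND3 : Cmod (D3 t) <= N t) by (unfold N; lra).
    assert (BV1 : Cmod (V1 t) <= Lam * N t).
    { replace (V1 t) with ((0, w) * D1 t + D2 t + (app3 f (b t) - app3 f (a t)))%C.
      2:{ unfold V1, D1, D2, Xdot, Defs.Ci, app3, a, b, p1, p2, p3. cbn [fst snd]. Ceq. }
      eapply Rle_trans; [apply Cmod_triangle|].
      eapply Rle_trans; [apply Rplus_le_compat_r, Cmod_triangle|].
      rewrite Cmod_mult, Miw. specialize (LF f Nf). specialize (PN t). unfold Lam.
      pose proof (Rmult_le_compat_l _ _ _ H0 ND1). pose proof (Rmult_le_pos _ _ H PN). lra. }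
    assert (BV2 : Cmod (V2 t) <= Lam * N t).
    { replace (V2 t) with ((0, w) * D2 t + (app3 g (b t) - app3 g (a t)))%C.
      2:{ unfold V2, D2, Ydot, Defs.Ci, app3, a, b, p1, p2, p3. cbn [fst snd]. Ceq. }
      eapply Rle_trans; [apply Cmod_triangle|].
      rewrite Cmod_mult, Miw. specialize (LF g Ng). specialize (PN t). unfold Lam.
      pose proof (Rmult_le_compat_l _ _ _ H0 ND2). pose proof (Rmult_le_pos _ _ H PN). lra. }
    assert (BV3 : Cmod (V3 t) <= Lam * N t).
    { replace (V3 t) with (lam * D3 t + (app3 h (b t) - app3 h (a t)))%C.
      2:{ unfold V3, D3, Zdot, app3, a, b, p1, p2, p3. cbn [fst snd]. Ceq. }
      eapply Rle_trans; [apply Cmod_triangle|].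
      rewrite Cmod_mult. specialize (LF h Nh). specialize (PN t). unfold Lam.
      pose proof (Rmult_le_compat_l _ _ _ H ND3). pose proof (Rmult_le_pos _ _ H0 PN). lra. }
    assert (BI : forall x v, Cmod v <= Lam * N t -> Rabs (2 * I x v) <= 2 * (Cmod x * (Lam * N t))).
    { intros x v Hv. rewrite Rabs_mult, (Rabs_pos_eq 2) by lra. apply Rmult_le_compat_l; [lra|].
      eapply Rle_trans; [apply Re_inner_le|]. apply Rmult_le_compat_l; auto. apply Cmod_ge_0. }
    assert (PL : 0 <= Lam).
    { unfold Lam. assert (0 <= 4 * K * d) by (repeat apply Rmult_le_pos; lra). lra. }
    unfold E'. eapply Rle_trans; [apply Rabs_triang|].
    eapply Rle_trans; [apply Rplus_le_compat_r, Rabs_triang|].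
    pose proof (BI (D1 t) (V1 t) BV1). pose proof (BI (D2 t) (V2 t) BV2). pose proof (BI (D3 t) (V3 t) BV3).
    apply Rle_trans with (2 * Lam * (N t ^ 2)).
    + replace (2 * Lam * N t ^ 2) with
        (2 * (Cmod (D1 t) * (Lam * N t)) + 2 * (Cmod (D2 t) * (Lam * N t)) + 2 * (Cmod (D3 t) * (Lam * N t)))
        by (unfold N; ring). lra.
    + replace (6 * Lam * E t) with (2 * Lam * (3 * E t)) by ring. apply Rmult_le_compat_l; [lra|auto]. }
intros t.
assert (N0 : N t <= 0).
{ specialize (NE t). rewrite Z in NE. specialize (PN t). nra. }
rewrite <- EN in N0. apply N3_sub_eq in N0. unfold a, b in N0. injection N0 as H1 H2 H3. auto.
Qed.

End Trajectories.

Lemma cis_neq_1 w s : w <> 0 -> 0 < s < period w -> cis (w * s) <> 1.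
Proof.
intros Hw Hs E. injection E as E _.
assert (Pw : 0 < Rabs w) by now apply Rabs_pos_lt.
assert (E2 : cos (Rabs w * s) = 1).
{ unfold Rabs. destruct (Rcase_abs w); auto. rewrite Ropp_mult_distr_l_reverse, cos_neg. auto. }
assert (Hs2 : Rabs w * s < 2 * PI).
{ apply Rlt_le_trans with (Rabs w * period w); [apply Rmult_lt_compat_l; lra|].
  right. unfold period. field. lra. }
assert (0 < Rabs w * s) by (apply Rmult_lt_0_compat; lra).
replace (Rabs w * s) with (2 * (Rabs w * s / 2)) in E2 by field.
rewrite cos_2a_sin in E2.
pose proof (sin_gt_0 (Rabs w * s / 2) ltac:(lra) ltac:(lra)). nra.
Qed.

Lemma same_germ_sym a b c e : same_germ a b c e -> same_germ c e a b.
Proof. intros (r & Hr & H). exists r; split; auto. intros x Hx. destruct (H x Hx); auto. Qed.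

Lemma same_germ_trans a b c e m n : same_germ a b c e -> same_germ c e m n -> same_germ a b m n.
Proof.
intros (r & Hr & H) (r' & Hr' & H'). exists (Rmin r r'). split; [now apply Rmin_pos|].
intros x Hx. destruct (H x); [eapply Rlt_le_trans; [apply Hx|apply Rmin_l]|].
destruct (H' x); [eapply Rlt_le_trans; [apply Hx|apply Rmin_r]|]. split; congruence.
Qed.

Lemma isochronous_germ w lam f g h phi psi phi' psi' T : same_germ phi psi phi' psi' ->
  isochronous_center w lam f g h phi psi T -> isochronous_center w lam f g h phi' psi' T.
Proof.
intros (r & Hr & H) (r' & Hr' & H'). exists (Rmin r r'). split; [now apply Rmin_pos|].
intros x [Hx1 Hx2]. destruct (H x) as [<- <-]; [eapply Rlt_le_trans; [apply Hx2|apply Rmin_l]|].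
apply H'. split; auto. eapply Rlt_le_trans; [apply Hx2|apply Rmin_r].
Qed.

(** * Center manifolds *)

Section Conclusion.

Variables (w : R) (lam : C) (f g h : C -> C -> C -> C) (d K : R).
Hypothesis Hw : w <> 0.
Hypothesis Hlam : Cre lam <> 0.
Hypotheses (Nf : quadratic_germ d K f) (Ng : quadratic_germ d K g) (Nh : quadratic_germ d K h).

(* On the graph of [(phi, psi)] the system reduces to [x' = i w x + phi x + f (x, phi x, psi x)]; the
   parametrization of this scalar equation, viewed as a system with [g = h = 0], is lifted to the graph. *)
Lemma curve_of_manifold phi psi : x_center_manifold w lam f g h phi psi ->
  exists r P, 0 < r /\ parametrization w lam f g h r P /\
    forall s, Cmod s < r -> p2 (P s) = phi (p1 (P s)) /\ p3 (P s) = psi (p1 (P s)).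
Proof.
intros (r0 & (Hr0 & Hphi) & (_ & Hpsi) & phi0 & psi0 & dphi & dpsi & Hinv).
change (Hol r0 phi) in Hphi. change (Hol r0 psi) in Hpsi.
destruct (Hol_lip_near0 r0 phi Hr0 Hphi phi0 dphi) as (d1 & K1 & Hd1 & HK1 & Q1 & _).
destruct (Hol_lip_near0 r0 psi Hr0 Hpsi psi0 dpsi) as (d2 & K2 & Hd2 & HK2 & Q2 & _).
pose proof (proj1 Nf) as Hd. pose proof (proj1 (proj2 Nf)) as HK.
set (M := 1 + K1 + K2).
set (r1 := Rmin (Rmin r0 1) (Rmin (Rmin d1 d2) (d / M))).
assert (HM : 0 < M) by (unfold M; lra).
assert (Hr1 : 0 < r1).
{ repeat apply Rmin_pos; auto; try lra. now apply Rdiv_lt_0_compat. }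
assert (Br1 : r1 <= r0 /\ r1 <= 1 /\ r1 <= d1 /\ r1 <= d2 /\ M * r1 <= d).
{ pose proof (Rmin_l (Rmin r0 1) (Rmin (Rmin d1 d2) (d / M))).
  pose proof (Rmin_r (Rmin r0 1) (Rmin (Rmin d1 d2) (d / M))).
  pose proof (Rmin_l r0 1). pose proof (Rmin_r r0 1).
  pose proof (Rmin_l (Rmin d1 d2) (d / M)). pose proof (Rmin_r (Rmin d1 d2) (d / M)).
  pose proof (Rmin_l d1 d2). pose proof (Rmin_r d1 d2).
  repeat split; try (unfold r1; lra).
  replace d with (M * (d / M)) by (field; lra). apply Rmult_le_compat_l; unfold r1; lra. }
clearbody r1. destruct Br1 as (B0 & B1 & B2 & B3 & B4).
set (Q := fun x => (x, phi x, psi x) : C3).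
assert (QN : forall x, Cmod x < r1 -> N3 (Q x) <= M * Cmod x /\ N3 (sub3 (Q x) (axis x)) <= (K1 + K2) * Cmod x ^ 2).
{ intros x Hx. specialize (Q1 x ltac:(lra)). specialize (Q2 x ltac:(lra)).
  pose proof (Cmod_ge_0 x).
  assert (Cmod x ^ 2 <= Cmod x) by nra.
  assert (K1 * Cmod x ^ 2 <= K1 * Cmod x) by now apply Rmult_le_compat_l.
  assert (K2 * Cmod x ^ 2 <= K2 * Cmod x) by now apply Rmult_le_compat_l.
  split.
  - change (Cmod x + Cmod (phi x) + Cmod (psi x) <= M * Cmod x). unfold M. lra.
  - change (Cmod (x - x)%C + Cmod (phi x - 0)%C + Cmod (psi x - 0)%C <= (K1 + K2) * Cmod x ^ 2).
    replace (x - x)%C with (RtoC 0) by ring. rewrite Cmod_0.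
    replace (phi x - 0)%C with (phi x) by (apply injective_projections; simpl; ring).
    replace (psi x - 0)%C with (psi x) by (apply injective_projections; simpl; ring). lra. }
assert (Qd : forall x, Cmod x < r1 -> N3 (Q x) < d).
{ intros x Hx. eapply Rle_lt_trans; [now apply QN|].
  apply Rlt_le_trans with (M * r1); auto. now apply Rmult_lt_compat_l. }
set (q := fun x => (phi x + app3 f (Q x))%C).
assert (qH : Hol r1 q).
{ intros x Hx. destruct (Hphi x ltac:(lra)) as [L1 H1]. destruct (Hpsi x ltac:(lra)) as [L2 H2].
  destruct (quadratic_germ_comp_deriv d K f Q x 1%C L1 L2 Nf (Qd x Hx)) as [L3 H3]; auto.
  { apply Chasderiv_id. }
  exists (L1 + L3)%C. now apply Chasderiv_plus. }
destruct (quadratic_zero q r1 (K1 + 2 * K * M ^ 2)) as [q0 q1]; auto.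
{ pose proof (pow2_ge_0 M). assert (0 <= 2 * K * M ^ 2) by (repeat apply Rmult_le_pos; lra). lra. }
{ intros x Hx. eapply Rle_trans; [apply Cmod_triangle|].
  pose proof (quadratic_germ_bound d K f (Q x) Nf (Qd x Hx)).
  assert (N3 (Q x) ^ 2 <= (M * Cmod x) ^ 2) by (apply pow_incr; split; [apply N3_ge0|now apply QN]).
  pose proof (Rmult_le_compat_l (2 * K) _ _ ltac:(lra) H0).
  specialize (Q1 x ltac:(lra)). lra. }
destruct (quadratic_germ_of_Hol r1 q Hr1 qH q0 q1) as (dq & Kq & Nq).
set (zero3 := fun _ _ _ : C => RtoC 0).
assert (Nz : quadratic_germ 1 0 zero3).
{ split; [lra|]. split; [lra|]. split; auto. intros p Hp. exists (axis 0). split.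
  - rewrite N3_axis, Cmod_0. lra.
  - intros p' Hp'. unfold app3, zero3.
    replace (0 - 0 - dot3 (axis 0) (sub3 p' p))%C with (RtoC 0)
      by (unfold dot3, axis, p1, p2, p3; simpl; ring).
    rewrite Cmod_0. lra. }
destruct (parametrization_exists w lam (fun x _ _ => q x) zero3 zero3 Hw Hlam) as (r2 & P1 & Hr2 & S1).
{ eapply quadratic_germ_common; eauto. }
destruct S1 as ((HX & HY & _) & HT & Kp & HKp & HQ).
(* With zero forcing the second component is an average of 0. Hence the first component solves the
   reduced scalar equation exactly. *)
assert (Y0 : forall s, Cmod s < r2 -> p2 (P1 s) = 0).
{ intros s Hs.
  assert (Hq : forall z, Cmod z < r2 -> Cmod (p2 (P1 z)) <= Kp * Cmod z ^ 2).
  { intros z Hz. eapply Rle_trans; [|now apply HQ].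
    replace (p2 (P1 z)) with (p2 (sub3 (P1 z) (axis z))); [apply N3_comp|].
    unfold sub3, axis, p2; simpl. ring. }
  destruct (quadratic_zero (fun s => p2 (P1 s)) r2 Kp Hr2 HKp Hq) as [Z0 Z1].
  rewrite (center_average_inv w Hw r2 (fun s => p2 (P1 s)) (fun _ => RtoC 0) s); auto.
  - unfold average. pose proof (period_pos w Hw).
    rewrite (CInt_ext _ (fun _ => RtoC 0)); [rewrite CInt_const; ring|lra|intros; ring].
  - intros z Hz. eexists; apply Chasderiv_const.
  - intros t. apply (HT s Hs t). }
set (X := fun s => p1 (P1 s)).
set (r3 := Rmin (Rmin r2 1) (r1 / (1 + Kp))).
assert (Hr3 : 0 < r3).
{ repeat apply Rmin_pos; auto; try lra. apply Rdiv_lt_0_compat; lra. }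
assert (Br3 : r3 <= r2 /\ r3 <= 1 /\ (1 + Kp) * r3 <= r1).
{ pose proof (Rmin_l (Rmin r2 1) (r1 / (1 + Kp))). pose proof (Rmin_r (Rmin r2 1) (r1 / (1 + Kp))).
  pose proof (Rmin_l r2 1). pose proof (Rmin_r r2 1).
  repeat split; try (unfold r3; lra).
  replace r1 with ((1 + Kp) * (r1 / (1 + Kp))) by (field; lra). apply Rmult_le_compat_l; unfold r3; lra. }
clearbody r3. destruct Br3 as (C1 & C2' & C3').
assert (Xs : forall s, Cmod s < r3 -> Cmod (X s - s)%C <= Kp * Cmod s ^ 2 /\ Cmod (X s) <= (1 + Kp) * Cmod s).
{ intros s Hs. specialize (HQ s ltac:(lra)).
  assert (Cmod (X s - s)%C <= Kp * Cmod s ^ 2).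
  { eapply Rle_trans; [|apply HQ]. apply (proj1 (N3_comp (sub3 (P1 s) (axis s)))). }
  split; auto. pose proof (Cmod_triangle_rev (X s) s). pose proof (Cmod_ge_0 s).
  assert (Cmod s ^ 2 <= Cmod s) by nra.
  pose proof (Rmult_le_compat_l Kp _ _ HKp H2). lra. }
assert (Xr : forall s, Cmod s < r3 -> Cmod (X s) < r1).
{ intros s Hs. eapply Rle_lt_trans; [now apply Xs|].
  apply Rlt_le_trans with ((1 + Kp) * r3); auto. apply Rmult_lt_compat_l; lra. }
exists r3, (fun s => Q (X s)). split; auto. split; [|split; reflexivity].
split; [|split].
- assert (HX3 : Hol r3 X) by (apply Hol_le with r2; auto).
  split; [exact HX3|].
  split; intros s Hs; destruct (HX3 s Hs) as [L HL]; specialize (Xr s Hs).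
  + destruct (Hphi (X s) ltac:(lra)) as [L1 H1]. exists (L1 * L)%C.
    now apply (Chasderiv_comp phi X).
  + destruct (Hpsi (X s) ltac:(lra)) as [L1 H1]. exists (L1 * L)%C.
    now apply (Chasderiv_comp psi X).
- intros s Hs t.
  assert (Hs' : Cmod (s * cis (w * t))%C < r3) by now apply Cmod_mult_cis_lt.
  assert (Dx : Rderiv_C (fun t => X (s * cis (w * t))%C) t
    (Xdot w f (X (s * cis (w * t))%C) (phi (X (s * cis (w * t))%C)) (psi (X (s * cis (w * t))%C)))).
  { eapply Rderiv_C_eq; [apply (HT s ltac:(lra) t)|].
    rewrite Y0 by lra. unfold Xdot. unfold X, q, Q, app3, p1, p2, p3. cbn [fst snd]. Ceq. }
  specialize (Xr _ Hs').
  destruct (Hphi (X (s * cis (w * t))%C) ltac:(lra)) as [L1 H1].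
  destruct (Hpsi (X (s * cis (w * t))%C) ltac:(lra)) as [L2 H2].
  (* Tangency of the field to the graph is exactly what makes the lift of the scalar solution
     satisfy the [y] and [z] equations. *)
  destruct (Hinv (X (s * cis (w * t))%C)) with (L1 := L1) (L2 := L2) as [E1 E2]; auto.
  { rewrite Cabs_Cmod. lra. }
  split; [exact Dx|]. split.
  + eapply Rderiv_C_eq; [apply (Rderiv_C_comp phi (fun t => X (s * cis (w * t))%C)); [exact H1|exact Dx]|].
    exact E1.
  + eapply Rderiv_C_eq; [apply (Rderiv_C_comp psi (fun t => X (s * cis (w * t))%C)); [exact H2|exact Dx]|].
    exact E2.
- exists (Kp + (K1 + K2) * (1 + Kp) ^ 2). split.
  { pose proof (pow2_ge_0 (1 + Kp)). assert (0 <= (K1 + K2) * (1 + Kp) ^ 2) by (apply Rmult_le_pos; lra). lra. }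
  intros s Hs. destruct (Xs s Hs) as [X1 X2]. destruct (QN (X s) (Xr s Hs)) as [_ X3].
  eapply Rle_trans; [apply (N3_sub_triangle _ (axis (X s)))|].
  assert (Ea : N3 (sub3 (axis (X s)) (axis s)) = Cmod (X s - s)).
  { unfold N3, sub3, axis, p1, p2, p3; simpl. replace (0 - 0)%C with (RtoC 0) by ring. rewrite Cmod_0. ring. }
  rewrite Ea.
  assert (Cmod (X s) ^ 2 <= ((1 + Kp) * Cmod s) ^ 2) by (apply pow_incr; split; [apply Cmod_ge_0|auto]).
  pose proof (Rmult_le_compat_l (K1 + K2) _ _ ltac:(lra) H). lra.
Qed.

Lemma center_manifold_exists : exists phi psi,
  x_center_manifold w lam f g h phi psi /\
  (forall phi' psi', x_center_manifold w lam f g h phi' psi' -> same_germ phi psi phi' psi') /\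
  isochronous_center w lam f g h phi psi (2 * PI / Rabs w).
Proof.
assert (HN : exists d K, quadratic_germ d K f /\ quadratic_germ d K g /\ quadratic_germ d K h) by (exists d, K; auto).
destruct (parametrization_exists w lam f g h Hw Hlam HN) as (r & P & Hr & SP).
assert (SP' := SP). destruct SP' as ((HX & HY & HZ) & HT & M & HM & HQ).
set (X := fun s => p1 (P s)).
set (xi := fun s => (X s - s)%C).
assert (Hxi : Hol r xi).
{ intros s Hs. destruct (HX s Hs) as [L HL]. exists (L - 1)%C. apply Chasderiv_minus; auto. apply Chasderiv_id. }
destruct (quadratic_zero xi r M) as [xi0 xi1]; auto.
{ intros z Hz. eapply Rle_trans; [|now apply HQ]. apply (proj1 (N3_comp (sub3 (P z) (axis z)))). }
destruct (Hol_lip_near0 r xi Hr Hxi xi0 xi1) as (d1 & K1 & Hd1 & HK1 & _ & Lxi).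
pose proof (proj1 Nf) as Hd.
set (rho := Rmin (Rmin r d1) (Rmin (Rmin 1 (d / (2 * (1 + M)))) (1 / (4 * (K1 + 1))))).
assert (Hrho : 0 < rho).
{ repeat apply Rmin_pos; auto; try lra; apply Rdiv_lt_0_compat; lra. }
assert (Br : rho <= r /\ rho <= d1 /\ rho <= 1 /\ (1 + M) * rho <= d / 2 /\ (K1 + 1) * rho <= 1 / 4).
{ pose proof (Rmin_l (Rmin r d1) (Rmin (Rmin 1 (d / (2 * (1 + M)))) (1 / (4 * (K1 + 1))))).
  pose proof (Rmin_r (Rmin r d1) (Rmin (Rmin 1 (d / (2 * (1 + M)))) (1 / (4 * (K1 + 1))))).
  pose proof (Rmin_l r d1). pose proof (Rmin_r r d1).
  pose proof (Rmin_l (Rmin 1 (d / (2 * (1 + M)))) (1 / (4 * (K1 + 1)))).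
  pose proof (Rmin_r (Rmin 1 (d / (2 * (1 + M)))) (1 / (4 * (K1 + 1)))).
  pose proof (Rmin_l 1 (d / (2 * (1 + M)))). pose proof (Rmin_r 1 (d / (2 * (1 + M)))).
  repeat split; try (unfold rho; lra).
  - replace (d / 2) with ((1 + M) * (d / (2 * (1 + M)))) by (field; lra).
    apply Rmult_le_compat_l; unfold rho; lra.
  - replace (1 / 4) with ((K1 + 1) * (1 / (4 * (K1 + 1)))) by (field; lra).
    apply Rmult_le_compat_l; unfold rho; lra. }
clearbody rho. destruct Br as (R1 & R2 & R3 & R4 & R5).
assert (X_near : forall s t, Cmod s < rho -> Cmod t < rho ->
  Cmod ((X t - t) - (X s - s))%C <= / 2 * Cmod (t - s)).
{ intros s t Hs Ht. eapply Rle_trans; [apply (Lxi s t); lra|].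
  apply Rmult_le_compat_r; [apply Cmod_ge_0|].
  apply Rle_trans with ((K1 + 1) * (2 * rho)); [|lra].
  pose proof (Cmod_ge_0 s). pose proof (Cmod_ge_0 t). apply Rmult_le_compat; lra. }
assert (X0 : X (RtoC 0) = 0).
{ replace (X (RtoC 0)) with (xi (RtoC 0) + 0)%C by (unfold xi; ring). rewrite xi0. ring. }
assert (HXr : Hol rho X) by (apply Hol_le with r; auto).
assert (Xinj := X_injective X rho X_near).
assert (Xb := X_bound X rho Hrho X0 X_near).
destruct (inverse_exists X rho Hrho HXr X0 X_near) as (S & HS & HSh).
(* By construction [S] is a right inverse. For |s| < rho / 4 one has |X s| < rho / 2 and |S (X s)| <
   rho, so injectivity makes it a left inverse too. *)
assert (SX : forall s, Cmod s < rho / 4 -> S (X s) = s).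
{ intros s Hs. specialize (Xb s ltac:(lra)).
  destruct (HS (X s) ltac:(lra)) as [B E]. apply Xinj; auto; lra. }
set (phi := fun x => p2 (P (S x))). set (psi := fun x => p3 (P (S x))).
assert (Hq : forall x, Cmod x < rho / 2 -> N3 (sub3 (P (S x)) (axis (S x))) <= (4 * M) * Cmod x ^ 2).
{ intros x Hx. destruct (HS x Hx) as [B _]. eapply Rle_trans; [apply HQ; lra|].
  assert (Cmod (S x) ^ 2 <= (2 * Cmod x) ^ 2) by (apply pow_incr; split; [apply Cmod_ge_0|auto]).
  pose proof (Rmult_le_compat_l M _ _ HM H). lra. }
destruct (quadratic_zero phi (rho / 2) (4 * M)) as [phi0 phi1]; try lra.
{ intros x Hx. eapply Rle_trans; [|now apply Hq].
  replace (phi x) with (p2 (sub3 (P (S x)) (axis (S x)))); [apply N3_comp|].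
  unfold phi, sub3, axis, p2; simpl. ring. }
destruct (quadratic_zero psi (rho / 2) (4 * M)) as [psi0 psi1]; try lra.
{ intros x Hx. eapply Rle_trans; [|now apply Hq].
  replace (psi x) with (p3 (sub3 (P (S x)) (axis (S x)))); [apply N3_comp|].
  unfold psi, sub3, axis, p3; simpl. ring. }
assert (Hcomp : forall u, Hol r u -> Hol (rho / 2) (fun x => u (S x))).
{ intros u Hu x Hx. destruct (HS x Hx) as [B _]. destruct (HSh x Hx) as [L1 H1].
  destruct (Hu (S x) ltac:(lra)) as [L2 H2]. exists (L2 * L1)%C. now apply (Chasderiv_comp u S). }
(* The radius rho / 8 gives |S x| < rho / 4, so [S] inverts [X] along the whole circle through
   [S x]. *)
assert (orbit : forall x, Cmod x < rho / 8 ->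
  p1 (P (S x * cis (w * 0))%C) = x /\ p2 (P (S x * cis (w * 0))%C) = phi x /\
  p3 (P (S x * cis (w * 0))%C) = psi x /\
  trajectory w lam f g h (fun t => p1 (P (S x * cis (w * t))%C)) (fun t => p2 (P (S x * cis (w * t))%C))
    (fun t => p3 (P (S x * cis (w * t))%C)) /\
  forall t, N3 (p1 (P (S x * cis (w * t))%C), p2 (P (S x * cis (w * t))%C), p3 (P (S x * cis (w * t))%C)) <= d / 2).
{ intros x Hx. destruct (HS x ltac:(lra)) as [B E].
  rewrite Rmult_0_r, cis_0, Cmult_1_r. repeat split; try exact E; try apply (HT (S x) ltac:(lra)).
  intros t. set (s := (S x * cis (w * t))%C).
  assert (Hs : Cmod s < rho) by (apply Cmod_mult_cis_lt; lra).
  change (N3 (P s) <= d / 2).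
  pose proof (N3_triangle (P s) (axis s)) as T. rewrite N3_axis in T.
  pose proof (HQ s ltac:(lra)). pose proof (Cmod_ge_0 s).
  assert (Cmod s ^ 2 <= Cmod s) by nra.
  pose proof (Rmult_le_compat_l M _ _ HM H1).
  assert ((1 + M) * Cmod s <= (1 + M) * rho) by (apply Rmult_le_compat_l; lra). lra. }
exists phi, psi. split; [|split].
- exists (rho / 8).
  refine (conj (conj _ _) (conj (conj _ _) (conj phi0 (conj psi0 (conj phi1 (conj psi1 _)))))); try lra.
  + intros x Hx. change (Cmod x < rho / 8) in Hx. apply (Hcomp (fun s => p2 (P s)) HY). lra.
  + intros x Hx. change (Cmod x < rho / 8) in Hx. apply (Hcomp (fun s => p3 (P s)) HZ). lra.
  + intros x Hx L1 L2 H1 H2. change (Cmod x < rho / 8) in Hx.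
    destruct (orbit x Hx) as (O1 & O2 & O3 & T & _).
    destruct (T 0) as (T1 & T2 & T3). rewrite O1, O2, O3 in T1, T2, T3.
    destruct (HS x ltac:(lra)) as [B E].
    (* It shows that the orbit of [x] stays on the graph; differentiating this relation at time 0 in
       two ways gives invariance at [x]. *)
    assert (SXt : forall t, S (X (S x * cis (w * t))%C) = (S x * cis (w * t))%C).
    { intros t. apply SX. apply Cmod_mult_cis_lt. lra. }
    split.
    * apply (Rderiv_C_unique (fun t => phi (X (S x * cis (w * t))%C)) 0).
      -- apply (Rderiv_C_comp phi (fun t => X (S x * cis (w * t))%C)); [|exact T1].
         change (Chasderiv phi (p1 (P (S x * cis (w * 0))%C)) L1). now rewrite O1.
      -- apply (Rderiv_C_ext (fun t => p2 (P (S x * cis (w * t))%C))); [|exact T2].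
         intros t. unfold phi. now rewrite SXt.
    * apply (Rderiv_C_unique (fun t => psi (X (S x * cis (w * t))%C)) 0).
      -- apply (Rderiv_C_comp psi (fun t => X (S x * cis (w * t))%C)); [|exact T1].
         change (Chasderiv psi (p1 (P (S x * cis (w * 0))%C)) L2). now rewrite O1.
      -- apply (Rderiv_C_ext (fun t => p3 (P (S x * cis (w * t))%C))); [|exact T3].
         intros t. unfold psi. now rewrite SXt.
(* The curve [Q] of the other manifold has the same germ as [P], so its graph relation at the
   parameter [S x] says that phi' and psi' take at [x] the values of phi and psi. *)
- intros phi' psi' Hm. destruct (curve_of_manifold phi' psi' Hm) as (r2 & Q & Hr2 & SQ & HG).
  destruct (parametrization_unique w lam f g h Hw Hlam HN r P r2 Q Hr Hr2 SP SQ) as (r3 & Hr3 & EQ).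
  exists (Rmin (rho / 2) (Rmin (r2 / 2) (r3 / 2))). split; [repeat apply Rmin_pos; lra|].
  intros x Hx. change (Cabs x) with (Cmod x) in Hx.
  pose proof (Rmin_l (rho / 2) (Rmin (r2 / 2) (r3 / 2))). pose proof (Rmin_r (rho / 2) (Rmin (r2 / 2) (r3 / 2))).
  pose proof (Rmin_l (r2 / 2) (r3 / 2)). pose proof (Rmin_r (r2 / 2) (r3 / 2)).
  destruct (HS x ltac:(lra)) as [B E]. destruct (HG (S x) ltac:(lra)) as [G1 G2].
  rewrite <- EQ in G1, G2 by lra. change (p1 (P (S x))) with (X (S x)) in G1, G2. rewrite E in G1, G2.
  split; [exact G1|exact G2].
- exists (rho / 8). split; [lra|]. intros x [Hx0 Hx].
  change (0 < Cmod x) in Hx0. change (Cmod x < rho / 8) in Hx.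
  destruct (orbit x Hx) as (O1 & O2 & O3 & T & Sm).
  split.
  + eexists _, _, _. split; [exact T|]. auto.
  + intros gx gy gz TG G1 G2 G3.
    assert (U := trajectory_unique w lam f g h d K Nf Ng Nh _ _ _ gx gy gz T TG Sm
      ltac:(congruence) ltac:(congruence) ltac:(congruence)).
    change (2 * PI / Rabs w) with (period w). split.
    * intros t. destruct (U t) as (<- & <- & <-). destruct (U (t + period w)) as (<- & <- & <-).
      rewrite cis_period; auto.
    (* A return of the first coordinate is a return of the parameter by injectivity of [X]; as [S x]
       is nonzero, cis (w t) would be 1 before a full period. *)
    * intros t Ht (K1' & _). destruct (U t) as (E1 & _). rewrite K1' in E1.
      destruct (HS x ltac:(lra)) as [B E].
      apply (fun e => eq_trans e (eq_sym O1)), Xinj in E1; try (apply Cmod_mult_cis_lt; lra).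
      rewrite Rmult_0_r, cis_0, Cmult_1_r in E1.
      assert (Ns : S x <> 0).
      { intros Z. rewrite Z, X0 in E. rewrite <- E, Cmod_0 in Hx0. lra. }
      apply (cis_neq_1 w t Hw Ht).
      replace (cis (w * t)) with (S x * cis (w * t) / S x)%C by (field; auto).
      rewrite E1. field; auto.
Qed.

End Conclusion.

Theorem theorem3p4 (w : R) (lam : Cx) (f g h : Cx -> Cx -> Cx -> Cx) :
  w <> 0 -> Cre lam <> 0 ->
  holo_near0 f -> holo_near0 g -> holo_near0 h ->
  vanish_order2 f -> vanish_order2 g -> vanish_order2 h ->
  (exists phi psi, x_center_manifold w lam f g h phi psi) /\
  (forall phi1 psi1 phi2 psi2,
     x_center_manifold w lam f g h phi1 psi1 ->
     x_center_manifold w lam f g h phi2 psi2 ->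
     same_germ phi1 psi1 phi2 psi2) /\
  (forall phi psi, x_center_manifold w lam f g h phi psi ->
     isochronous_center w lam f g h phi psi (2 * PI / Rabs w)).
Proof.
intros Hw Hlam Hf Hg Hh Vf Vg Vh.
destruct (quadratic_germ_of_Holo3 f Hf Vf) as (d1 & K1 & N1).
destruct (quadratic_germ_of_Holo3 g Hg Vg) as (d2 & K2 & N2).
destruct (quadratic_germ_of_Holo3 h Hh Vh) as (d3 & K3 & N3').
destruct (quadratic_germ_common d1 K1 f d2 K2 g d3 K3 h N1 N2 N3') as (d & K & Nf & Ng & Nh).
destruct (center_manifold_exists w lam f g h d K Hw Hlam Nf Ng Nh) as (phi & psi & H1 & H2 & H3).
split; [|split].
- now exists phi, psi.
- intros a b a' b' Ha Hb. apply same_germ_trans with phi psi.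
  + now apply same_germ_sym, H2.
  + now apply H2.
- intros a b Ha. apply (isochronous_germ w lam f g h phi psi); auto.
Qed.
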